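(* Let $\Lambda=\Lambda_{(\phi,\psi)}=\begin{pmatrix} A & {}_AN_B \\ {}_BM_A & B\end{pmatrix}$ be a Morita ring, and let $(\mathcal{C}',\mathcal{D}')$ and $(\mathcal{C}'',\mathcal{D}'')$ be cotorsion pairs in $(A/\operatorname{Im}\psi)\text{-}\mathrm{Mod}$ and $B\text{-}\mathrm{Mod}$, respectively. Assume that $\psi$ is a monomorphism. Define the following classes of left $\Lambda$-modules: $$\mathcal{M}^{\mathcal{C}'}_{\mathcal{C}''}=\Big\{\begin{pmatrix} X \\ Y \end{pmatrix}_{f,g}\ \Big|\ A/\operatorname{Im}\psi\otimes_A\operatorname{Coker} g\in\mathcal{C}',\ Y\in\mathcal{C}'',\ g\text{ is a monomorphism}\Big\},$$ $$\mathcal{N}^{\mathcal{D}'}_{\mathcal{D}''}=\Big\{\begin{pmatrix} X \\ Y \end{pmatrix}_{f,g}\ \Big|\ A/\operatorname{Im}\psi\otimes_A\operatorname{Ker}\tilde f\in\mathcal{D}',\ Y\in\mathcal{D}'',\ \tilde f\text{ is an epimorphism}\Big\}.$$ (1) If $\operatorname{Tor}^B_1(N,\mathcal{C}'')=0$, then $({}^\perp\mathcal{N}^{\mathcal{D}'}_{\mathcal{D}''},\mathcal{N}^{\mathcal{D}'}_{\mathcal{D}''})$ is a cotorsion pair in $\Lambda\text{-}\mathrm{Mod}$; if $\operatorname{Ext}_B^1(M,\mathcal{D}'')=0$, then $(\mathcal{M}^{\mathcal{C}'}_{\mathcal{C}''},(\mathcal{M}^{\mathcal{C}'}_{\mathcal{C}''})^\perp)$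 is a cotorsion pair in $\Lambda\text{-}\mathrm{Mod}$. (2) If $\operatorname{Tor}^B_1(N,\mathcal{C}'')=0$ and $\operatorname{Ext}_B^1(M,\mathcal{D}'')=0$, then $(\mathcal{M}^{\mathcal{C}'}_{\mathcal{C}''},\mathcal{N}^{\mathcal{D}'}_{\mathcal{D}''})$ is a cotorsion pair in $\Lambda\text{-}\mathrm{Mod}$; and it is complete and hereditary if so are $(\mathcal{C}',\mathcal{D}')$ and $(\mathcal{C}'',\mathcal{D}'')$.
   Context: Morita rings. Let $A,B$ be rings, ${}_BM_A$ and ${}_AN_B$ bimodules, $\phi:M\otimes_AN\to B$ a $B$-bimodule map and $\psi:N\otimes_BM\to A$ an $A$-bimodule map such that $m'\psi(n\otimes m)=\phi(m'\otimes n)m$ and $n'\phi(m\otimes n)=\psi(n'\otimes m)n$ for all $m,m'\in M$, $n,n'\in N$. The Morita ring $\Lambda_{(\phi,\psi)}=\begin{pmatrix} A & N \\ M & B \end{pmatrix}$ has componentwise addition and multiplication $\begin{pmatrix} a & n \\ m & b \end{pmatrix}\begin{pmatrix} a' & n' \\ m' & b' \end{pmatrix}=\begin{pmatrix} aa'+\psi(n\otimes m') & an'+nb' \\ ma'+bm' & \phi(m\otimes n')+bb' \end{pmatrix}$. Left $\Lambda$-modules are identified with quadruples $\begin{pmatrix} X \\ Y \end{pmatrix}_{f,g}$, where $X\in A\text{-}\mathrm{Mod}$, $Y\in B\text{-}\mathrm{Mod}$, $f\in\operatorname{Hom}_B(M\otimes_AX,Y)$, $g\in\operatorname{Hom}_A(N\otimes_BY,X)$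 satisfy $g(n\otimes f(m\otimes x))=\psi(n\otimes m)x$ and $f(m\otimes g(n\otimes y))=\phi(m\otimes n)y$ for all $m\in M,n\in N,x\in X,y\in Y$; homomorphisms are pairs $(a,b)$ of an $A$-map and a $B$-map compatible with the $f$'s and $g$'s. $\tilde f:X\to\operatorname{Hom}_B(M,Y)$ and $\tilde g:Y\to\operatorname{Hom}_A(N,X)$ denote the maps corresponding to $f$ and $g$ under the tensor-Hom adjunctions. All classes of modules are closed under isomorphisms; $\operatorname{Tor}_1^B(N,\mathcal{C})=0$ means vanishing on every object of $\mathcal{C}$, and similarly for $\operatorname{Ext}$. Cotorsion pairs. For a class $\mathcal{C}$ of modules, $\mathcal{C}^\perp=\{X\mid\operatorname{Ext}^1(C,X)=0\ \forall C\in\mathcal{C}\}$ and ${}^\perp\mathcal{C}=\{X\mid\operatorname{Ext}^1(X,C)=0\ \forall C\in\mathcal{C}\}$. $(\mathcal{C},\mathcal{D})$ is a cotorsion pair if $\mathcal{C}^\perp=\mathcal{D}$ and ${}^\perp\mathcal{D}=\mathcal{C}$. It is complete if for each module $Z$ there are short exact sequences $0\to D_1\to C_1\to Z\to0$ and $0\to Z\to D_2\to C_2\to0$ with $C_i\in\mathcal{C}$, $D_i\in\mathcal{D}$. It is hereditary if $\mathcal{C}$ is closed under kernels of epimorphisms and $\mathcal{D}$ is closed under cokernels of monomorphisms. *)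

(* Defs.v *)
From HB Require Import structures.
From mathcomp Require Import all_boot all_algebra.
From mathcomp Require Import boolp.
From mathcomp Require Import freeg.

Set Implicit Arguments.
Unset Strict Implicit.
Unset Printing Implicit Defensive.

Import GRing.Theory.
Local Open Scope ring_scope.
Local Open Scope quotient_scope.

(* Rings are pzRingType, as the quotient A / Im psi below may be the   *)
(* zero ring.                                                          *)

HB.mixin Record Zmodule_isRmodule (S : pzRingType) V of GRing.Zmodule V := {
  rscale : V -> S -> V;
  rscalerA : forall v a b, rscale (rscale v a) b = rscale v (a * b);
  rscaler1 : forall v, rscale v 1 = v;
  rscalerDl : forall a, {morph rscale^~ a : u v / u + v};
  rscalerDr : forall v, {morph rscale v : a b / a + b}
}.

#[short(type="rmodType")]
HB.structure Definition Rmodule (S : pzRingType) :=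
  {V of GRing.Zmodule V & Zmodule_isRmodule S V}.

HB.mixin Record Lmodule_Rmodule_isBimodule (R S : pzRingType) V
    of GRing.Lmodule R V & Rmodule S V := {
  bimodA : forall (a : R) (v : V) (b : S),
    rscale (a *: v) b = a *: rscale v b
}.

(* bimodType R S : left R-, right S-bimodules *)
#[short(type="bimodType")]
HB.structure Definition Bimodule (R S : pzRingType) :=
  {V of GRing.Lmodule R V & Rmodule S V & Lmodule_Rmodule_isBimodule R S V}.

Section RmoduleTheory.
Variables (S : pzRingType) (V : rmodType S).

Lemma rscale0r (v : V) : rscale v 0 = 0.
Proof. by apply: (addIr (rscale v 0)); rewrite -rscalerDr !add0r. Qed.

Lemma rscale0l (a : S) : rscale (0 : V) a = 0.
Proof. by apply: (addIr (rscale (0 : V) a)); rewrite -rscalerDl !add0r. Qed.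

Lemma rscaleBl (a : S) (u v : V) : rscale (u - v) a = rscale u a - rscale v a.
Proof. by apply/eqP; rewrite eq_sym subr_eq -rscalerDl subrK. Qed.

End RmoduleTheory.

Section RegularBimodule.
Variable R : pzRingType.

Fact regular_rscalerA (v a b : R^o) : v * a * b = v * (a * b).
Proof. by rewrite mulrA. Qed.

HB.instance Definition _ := Zmodule_isRmodule.Build R R^o
  regular_rscalerA (@mulr1 R)
  (fun a u v => @mulrDl R u v a) (fun v a b => @mulrDr R v a b).

Fact regular_bimodA (a : R) (v : R^o) (b : R) :
  rscale (a *: v) b = a *: rscale v b.
Proof. by rewrite /rscale /= -mulrA. Qed.

HB.instance Definition _ := Lmodule_Rmodule_isBimodule.Build R R R^o
  regular_bimodA.
End RegularBimodule.

Section SurjectiveExact.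

Definition surjective (T U : Type) (f : T -> U) := forall y, exists x, f x = y.

Definition exact_at (T U : Type) (V : zmodType) (f : T -> U) (g : U -> V) :=
  forall y, g y = 0 <-> exists x, f x = y.

Definition short_exact (R : pzRingType) (U V W : lmodType R)
    (i : {linear U -> V}) (p : {linear V -> W}) :=
  [/\ injective i, exact_at i p & surjective p].

Definition lmod_iso (R : pzRingType) (U V : lmodType R) :=
  exists h : {linear U -> V}, bijective h.

End SurjectiveExact.

Section QuotLift.
Variables (V W : zmodType) (I : zmodClosed V) (f : {additive V -> W}).

Definition quot_lift (q : (Quotient.quot I)) : W := f (repr q).

Hypothesis fI : forall x, x \in I -> f x = 0.

Lemma quot_liftE x : quot_lift (\pi_(Quotient.quot I) x) = f x.
Proof.
apply/eqP; rewrite -subr_eq0 -raddfB; apply/eqP/fI.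
by rewrite Quotient.idealrBE reprK.
Qed.

Lemma quot_lift_is_zmod_morphism : zmod_morphism quot_lift.
Proof.
move=> x y; rewrite -[x]reprK -[y]reprK -[_ - _]raddfB !quot_liftE.
exact: raddfB.
Qed.

End QuotLift.

Lemma quotP (V : zmodType) (I : zmodClosed V) (x y : V) :
  (\pi_(Quotient.quot I) x = \pi_(Quotient.quot I) y) <-> (x - y \in I).
Proof. by rewrite Quotient.idealrBE; split => [/eqP|/eqP]. Qed.

Lemma quot0P (V : zmodType) (I : zmodClosed V) (x : V) :
  (\pi_(Quotient.quot I) x = 0) <-> (x \in I).
Proof. by rewrite -(raddf0 (\pi_(Quotient.quot I))) quotP subr0. Qed.

Section Tensor.
Variables (R : pzRingType) (M : rmodType R) (X : lmodType R).

Notation F := {freeg (M * X)}.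

Definition free_tens (m : M) (x : X) : F := [freeg [:: (1, (m, x))]].

Inductive tens_relation : F -> Prop :=
| TensRel0 : tens_relation 0
| TensRelB u v : tens_relation u -> tens_relation v -> tens_relation (u - v)
| TensRelDl m m' x :
    tens_relation (free_tens (m + m') x - (free_tens m x + free_tens m' x))
| TensRelDr m x x' :
    tens_relation (free_tens m (x + x') - (free_tens m x + free_tens m x'))
| TensRelM m r x :
    tens_relation (free_tens (rscale m r) x - free_tens m (r *: x)).

Definition tens_rel : {pred F} := fun u => `[< tens_relation u >].

Fact tens_rel_zmod_closed : zmod_closed tens_rel.
Proof.
split=> [|u v /asboolP ru /asboolP rv]; apply/asboolP.
  exact: TensRel0.
exact: TensRelB.
Qed.

HB.instance Definition _ := GRing.isZmodClosed.Build F tens_rel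
  tens_rel_zmod_closed.

Definition tensor : Type := Quotient.quot tens_rel.
HB.instance Definition _ := GRing.Zmodule.on tensor.

Definition tens (m : M) (x : X) : tensor := \pi_(Quotient.quot tens_rel) (free_tens m x).

Lemma tensDl m m' x : tens (m + m') x = tens m x + tens m' x.
Proof. by rewrite -raddfD; apply/quotP/asboolP/TensRelDl. Qed.

Lemma tensDr m x x' : tens m (x + x') = tens m x + tens m x'.
Proof. by rewrite -raddfD; apply/quotP/asboolP/TensRelDr. Qed.

Lemma tensM m r x : tens (rscale m r) x = tens m (r *: x).
Proof. exact/quotP/asboolP/TensRelM. Qed.

Lemma tens0l x : tens 0 x = 0.
Proof. by apply: (addIr (tens 0 x)); rewrite -tensDl !add0r. Qed.

Lemma tens0r m : tens m 0 = 0.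
Proof. by apply: (addIr (tens m 0)); rewrite -tensDr !add0r. Qed.

Lemma tensor_ind (P : tensor -> Prop) :
  P 0 -> (forall s t, P s -> P t -> P (s - t)) -> (forall m x, P (tens m x)) ->
  forall t, P t.
Proof.
move=> P0 PB Pt t; have PN s : P s -> P (- s) by rewrite -sub0r; apply: PB.
have PD s s' : P s -> P s' -> P (s + s').
  by move=> Ps /PN Ps'; rewrite -[s']opprK; apply: PB.
have PMn s n : P s -> P (s *+ n).
  by move=> Ps; elim: n => [|n IHn]; rewrite ?mulr0n // mulrS; apply: PD.
rewrite -[t]reprK -[repr t]freeg_sumE raddf_sum /=.
apply: (big_ind P) => // -[m x] _.
set c := coeff _ _; have -> : [freeg [:: (c, (m, x))]] = free_tens m x *~ c.
  by rewrite /free_tens freegU_mulz intz.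
have -> : \pi_tensor (free_tens m x *~ c) = tens m x *~ c by rewrite raddfMz.
case: c => n; first by rewrite -pmulrn; apply: PMn.
by rewrite NegzE mulrNz -pmulrn; apply/PN/PMn.
Qed.

Section TensorLift.
Variables (Z : zmodType) (b : M -> X -> Z).

Record balanced : Prop := {
  balancedDl : forall m m' x, b (m + m') x = b m x + b m' x;
  balancedDr : forall m x x', b m (x + x') = b m x + b m x';
  balancedM : forall m r x, b (rscale m r) x = b m (r *: x)
}.

Definition free_lift : F -> Z :=
  fglift (fun p => b p.1 p.2 : zmodule Z).

Fact free_lift_is_zmod_morphism : zmod_morphism free_lift.
Proof. exact: (@lift_is_additive _ _ (zmodule Z) _). Qed.

HB.instance Definition _ := GRing.isZmodMorphism.Build F Z free_lift
  free_lift_is_zmod_morphism.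

Lemma free_liftE m x : free_lift (free_tens m x) = b m x.
Proof. by rewrite /free_lift liftU scale1r. Qed.

Definition tensor_lift : tensor -> Z := quot_lift free_lift.

Hypothesis bb : balanced.

Fact free_lift_rel u : u \in tens_rel -> free_lift u = 0.
Proof.
have fB : zmod_morphism free_lift := free_lift_is_zmod_morphism.
have fD v w : free_lift (v + w) = free_lift v + free_lift w.
  exact: (raddfD free_lift).
move=> /asboolP; elim=> [|{}u v _ u0 _ v0|m m' x|m x x'|m r x].
- exact: (raddf0 free_lift).
- by rewrite fB u0 v0 subrr.
- by rewrite fB fD !free_liftE (balancedDl bb) subrr.
- by rewrite fB fD !free_liftE (balancedDr bb) subrr.
- by rewrite fB !free_liftE (balancedM bb) subrr.
Qed.

Lemma tensor_liftE m x : tensor_lift (tens m x) = b m x.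
Proof. by rewrite -free_liftE; apply/quot_liftE/free_lift_rel. Qed.

Lemma tensor_lift_is_zmod_morphism : zmod_morphism tensor_lift.
Proof. exact/quot_lift_is_zmod_morphism/free_lift_rel. Qed.

End TensorLift.
End Tensor.

Lemma tensor_eq (R : pzRingType) (M : rmodType R) (X : lmodType R)
    (Z : zmodType) (f g : tensor M X -> Z) :
  zmod_morphism f -> zmod_morphism g ->
  (forall m x, f (tens m x) = g (tens m x)) -> f =1 g.
Proof.
move=> fB gB fg; have z0 (h : tensor M X -> Z) : zmod_morphism h -> h 0 = 0.
  by move=> hB; rewrite -[X in h X](subrr 0) hB subrr.
elim/tensor_ind=> [|s t es et|m x]; first by rewrite !z0.
  by rewrite fB gB es et.
exact: fg.
Qed.

Section TensorLmodule.
Variables (S R : pzRingType) (M : bimodType S R) (X : lmodType R).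
Implicit Types (a b : S) (t : tensor M X).

Definition tens_lact a t : tensor M X :=
  tensor_lift (fun m x => tens (a *: m) x : tensor M X) t.

Fact tens_lact_balanced a :
  balanced (fun m x => tens (a *: m : M) x : tensor M X).
Proof.
split=> [m m' x|m x x'|m r x]; first by rewrite scalerDr tensDl.
  exact: tensDr.
by rewrite -tensM bimodA.
Qed.

Lemma tens_lactE a m x : tens_lact a (tens m x) = tens (a *: m) x.
Proof. exact: (tensor_liftE (tens_lact_balanced a)). Qed.

Fact tens_lactB a : zmod_morphism (tens_lact a).
Proof. exact: (tensor_lift_is_zmod_morphism (tens_lact_balanced a)). Qed.

Fact tens_lactDr : right_distributive tens_lact +%R.
Proof.
move=> a s t; have fN u : tens_lact a (- u) = - tens_lact a u.
  by rewrite -sub0r -[X in X - u](subrr u) !tens_lactB subrr sub0r.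
by rewrite -[t]opprK tens_lactB [in RHS]fN.
Qed.

Fact tens_lactA a b t : tens_lact a (tens_lact b t) = tens_lact (a * b) t.
Proof.
apply: (tensor_eq (f := fun t => tens_lact a (tens_lact b t))) t.
- by move=> s t; rewrite !tens_lactB.
- exact: tens_lactB.
- by move=> m x; rewrite !tens_lactE scalerA.
Qed.

Fact tens_lact1 : left_id 1 tens_lact.
Proof.
apply: (tensor_eq (f := tens_lact 1) (g := id)) => //; first exact: tens_lactB.
by move=> m x; rewrite tens_lactE scale1r.
Qed.

Fact tens_lactDl t : {morph tens_lact^~ t : a b / a + b}.
Proof.
move=> a b; apply: (tensor_eq (f := tens_lact (a + b))
    (g := fun t => tens_lact a t + tens_lact b t)) t.
- exact: tens_lactB.
- by move=> s t; rewrite !tens_lactB opprD addrACA.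
- by move=> m x; rewrite !tens_lactE scalerDl tensDl.
Qed.

HB.instance Definition _ := GRing.Zmodule_isLmodule.Build S (tensor M X)
  tens_lactA tens_lact1 tens_lactDr tens_lactDl.

Lemma tensZ a m x : a *: tens m x = tens (a *: m) x :> tensor M X.
Proof. exact: tens_lactE. Qed.

End TensorLmodule.

Section TensorRmodule.
Variables (R T : pzRingType) (M : rmodType R) (X : bimodType R T).
Implicit Types (a b : T) (t : tensor M X).

Definition tens_ract t a : tensor M X :=
  tensor_lift (fun m x => tens m (rscale x a) : tensor M X) t.

Fact tens_ract_balanced a :
  balanced (fun m (x : X) => tens m (rscale x a) : tensor M X).
Proof.
split=> [m m' x|m x x'|m r x]; first exact: tensDl.
  by rewrite rscalerDl tensDr.
by rewrite tensM bimodA.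
Qed.

Lemma tens_ractE a m x : tens_ract (tens m x) a = tens m (rscale x a).
Proof. exact: (tensor_liftE (tens_ract_balanced a)). Qed.

Fact tens_ractB a : zmod_morphism (tens_ract^~ a).
Proof. exact: (tensor_lift_is_zmod_morphism (tens_ract_balanced a)). Qed.

Fact tens_ractDl a : {morph tens_ract^~ a : s t / s + t}.
Proof.
move=> s t; have fN u : tens_ract (- u) a = - tens_ract u a.
  by rewrite -sub0r -[X in X - u](subrr u) !tens_ractB subrr sub0r.
by rewrite -[t]opprK tens_ractB [in RHS]fN.
Qed.

Fact tens_ractA t a b : tens_ract (tens_ract t a) b = tens_ract t (a * b).
Proof.
apply: (tensor_eq (f := fun t => tens_ract (tens_ract t a) b)
  (g := tens_ract^~ (a * b))) t.
- by move=> s t; rewrite !tens_ractB.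
- exact: tens_ractB.
- by move=> m x; rewrite !tens_ractE rscalerA.
Qed.

Fact tens_ract1 t : tens_ract t 1 = t.
Proof.
apply: (tensor_eq (f := tens_ract^~ 1) (g := id)) t => //.
  exact: tens_ractB.
by move=> m x; rewrite tens_ractE rscaler1.
Qed.

Fact tens_ractDr t : {morph tens_ract t : a b / a + b}.
Proof.
move=> a b; apply: (tensor_eq (f := tens_ract^~ (a + b))
    (g := fun t => tens_ract t a + tens_ract t b)) t.
- exact: tens_ractB.
- by move=> s t; rewrite !tens_ractB opprD addrACA.
- by move=> m x; rewrite !tens_ractE rscalerDr tensDr.
Qed.

HB.instance Definition _ := Zmodule_isRmodule.Build T (tensor M X)
  tens_ractA tens_ract1 tens_ractDl tens_ractDr.

Lemma tens_rscale a m x : rscale (tens m x : tensor M X) a = tens m (rscale x a).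
Proof. exact: tens_ractE. Qed.

End TensorRmodule.

Section TensorBimodule.
Variables (S R T : pzRingType) (M : bimodType S R) (X : bimodType R T).

Fact tensor_bimodA (a : S) (t : tensor M X) (b : T) :
  rscale (a *: t) b = a *: rscale t b.
Proof.
apply: (tensor_eq (f := fun t => rscale (a *: t) b)
  (g := fun t => a *: rscale t b)) t.
- by move=> s t; rewrite scalerBr rscaleBl.
- by move=> s t; rewrite rscaleBl scalerBr.
- by move=> m x; rewrite tensZ !tens_rscale tensZ.
Qed.

HB.instance Definition _ := Lmodule_Rmodule_isBimodule.Build S T (tensor M X)
  tensor_bimodA.
End TensorBimodule.


Section TensorMap.
Variables (R : pzRingType) (N : rmodType R) (P Q : lmodType R).
Variable h : {linear P -> Q}.

Definition tensor_map : tensor N P -> tensor N Q :=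
  tensor_lift (fun n p => tens n (h p)).

Fact tensor_map_balanced : balanced (fun n p => tens n (h p) : tensor N Q).
Proof.
split=> [n n' p|n p p'|n r p]; first exact: tensDl.
  by rewrite linearD tensDr.
by rewrite linearZ tensM.
Qed.

Lemma tensor_mapE n p : tensor_map (tens n p) = tens n (h p).
Proof. exact: (tensor_liftE tensor_map_balanced). Qed.

Fact tensor_map_is_zmod_morphism : zmod_morphism tensor_map.
Proof. exact: (tensor_lift_is_zmod_morphism tensor_map_balanced). Qed.

HB.instance Definition _ := GRing.isZmodMorphism.Build _ _ tensor_map
  tensor_map_is_zmod_morphism.
End TensorMap.
Arguments tensor_map {R} N {P Q} h.

Section Hom.
Variables (R : pzRingType) (U V : lmodType R).

Definition lhom : Type := {linear U -> V}.

HB.instance Definition _ := gen_eqMixin lhom.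
HB.instance Definition _ := gen_choiceMixin lhom.

Definition lhom_fun (f : lhom) : {linear U -> V} := f.

Lemma lhomP (f g : lhom) : lhom_fun f =1 lhom_fun g -> f = g.
Proof.
case: f g => [f cf] [g cg] /= efg; have {efg} fg : f = g by apply: funext.
subst g; have -> // : cf = cg.
case: cf cg => [[c1] [c2]] [[d1] [d2]].
by rewrite (Prop_irrelevance c1 d1) (Prop_irrelevance c2 d2).
Qed.

Definition lhom_zero : lhom := \0 : {linear U -> V}.
Definition lhom_add (f g : lhom) : lhom := lhom_fun f \+ lhom_fun g : {linear U -> V}.
Definition lhom_opp (f : lhom) : lhom := \- lhom_fun f : {linear U -> V}.

Fact lhom_addA : associative lhom_add.
Proof. by move=> f g h; apply: lhomP => x; apply: addrA. Qed.
Fact lhom_addC : commutative lhom_add.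
Proof. by move=> f g; apply: lhomP => x; apply: addrC. Qed.
Fact lhom_add0 : left_id lhom_zero lhom_add.
Proof. by move=> f; apply: lhomP => x; apply: add0r. Qed.
Fact lhom_addN : left_inverse lhom_zero lhom_opp lhom_add.
Proof. by move=> f; apply: lhomP => x; apply: addNr. Qed.

HB.instance Definition _ := GRing.isZmodule.Build lhom
  lhom_addA lhom_addC lhom_add0 lhom_addN.
End Hom.

(* For M an R-S-bimodule, Hom_R(M, Y) is a left S-module by           *)
(* (a h)(m) = h(m a).                                                 *)
Section HomLmodule.
Variables (R S : pzRingType) (M : bimodType R S) (Y : lmodType R).

Definition lhom_scale_fun (a : S) (h : lhom M Y) (m : M) : Y :=
  lhom_fun h (rscale m a).

Fact lhom_scale_is_linear a h : linear (lhom_scale_fun a h).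
Proof.
by move=> r u v; rewrite /lhom_scale_fun rscalerDl bimodA linearD linearZ.
Qed.

HB.instance Definition _ a h := GRing.isLinear.Build R M Y *:%R
  (lhom_scale_fun a h) (lhom_scale_is_linear a h).

Definition lhom_scale a h : lhom M Y := lhom_scale_fun a h : {linear M -> Y}.

Fact lhom_scaleA a b h : lhom_scale a (lhom_scale b h) = lhom_scale (a * b) h.
Proof. by apply: lhomP => m; rewrite /= /lhom_scale_fun /= /lhom_scale_fun rscalerA. Qed.

Fact lhom_scale1 : left_id 1 lhom_scale.
Proof. by move=> h; apply: lhomP => m; rewrite /= /lhom_scale_fun rscaler1. Qed.

Fact lhom_scaleDr : right_distributive lhom_scale +%R.
Proof. by move=> a h k; apply: lhomP => m. Qed.

Fact lhom_scaleDl h : {morph lhom_scale^~ h : a b / a + b}.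
Proof.
move=> a b; apply: lhomP => m.
by rewrite /= /lhom_scale_fun rscalerDr linearD.
Qed.

HB.instance Definition _ := GRing.Zmodule_isLmodule.Build S (lhom M Y)
  lhom_scaleA lhom_scale1 lhom_scaleDr lhom_scaleDl.
End HomLmodule.

Section Precomp.
Variables (R : pzRingType) (P Q X : lmodType R) (d : {linear P -> Q}).
Definition precomp (h : lhom Q X) : lhom P X := (lhom_fun h \o d : {linear P -> X}).
End Precomp.

Section KernelCokernel.
Variables (R : pzRingType) (U V : lmodType R) (f : {linear U -> V}).

Definition ker_pred : {pred U} := fun u => f u == 0.

Fact ker_submod_closed : GRing.subsemimod_closed ker_pred.
Proof.
split=> [|a u /eqP fu]; last by apply/eqP; rewrite linearZ_LR fu scaler0.
split=> [|u v /eqP fu /eqP fv]; apply/eqP; first exact: raddf0.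
by rewrite raddfD /= fu fv addr0.
Qed.

HB.instance Definition _ := GRing.isSubmodClosed.Build R U ker_pred
  ker_submod_closed.

Definition kernel : Type := {u : U | ker_pred u}.
HB.instance Definition _ := SubChoice.on kernel.
HB.instance Definition _ := [SubChoice_isSubLmodule of kernel by <:].

Definition im_pred : {pred V} := fun v => `[< exists u, f u = v >].

Fact im_submod_closed : GRing.subsemimod_closed im_pred.
Proof.
split=> [|a _ /asboolP[u <-]].
  split=> [|_ _ /asboolP[u <-] /asboolP[v <-]]; apply/asboolP.
    by exists 0; apply: raddf0.
  by exists (u + v); apply: raddfD.
by apply/asboolP; exists (a *: u); apply: linearZ_LR.
Qed.

HB.instance Definition _ := GRing.isSubmodClosed.Build R V im_pred
  im_submod_closed.

Definition cokernel : Type := Quotient.quot im_pred.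
HB.instance Definition _ := GRing.Zmodule.on cokernel.

Definition coker_pi (v : V) : cokernel := \pi_(Quotient.quot im_pred) v.

Lemma coker_pi_eq u v : (coker_pi u = coker_pi v) <-> (exists w, f w = u - v).
Proof. by rewrite quotP; split => [/asboolP//|?]; apply/asboolP. Qed.

Lemma coker_piK (q : cokernel) : coker_pi (repr q) = q.
Proof. exact: reprK. Qed.

Fact coker_piB : zmod_morphism coker_pi.
Proof. exact: raddfB. Qed.

Fact coker_piD : {morph coker_pi : u v / u + v}.
Proof. exact: raddfD. Qed.

Definition coker_scale (a : R) (q : cokernel) : cokernel :=
  coker_pi (a *: repr q).

Lemma coker_scaleE a v : coker_scale a (coker_pi v) = coker_pi (a *: v).
Proof.
have [w fw] : exists w, f w = repr (coker_pi v) - v.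
  by apply/coker_pi_eq; rewrite coker_piK.
by apply/coker_pi_eq; exists (a *: w); rewrite linearZ_LR fw scalerBr.
Qed.

Fact coker_scaleA a b q : coker_scale a (coker_scale b q) = coker_scale (a * b) q.
Proof. by rewrite -(coker_piK q) !coker_scaleE scalerA. Qed.

Fact coker_scale1 : left_id 1 coker_scale.
Proof. by move=> q; rewrite -(coker_piK q) coker_scaleE scale1r. Qed.

Fact coker_scaleDr : right_distributive coker_scale +%R.
Proof.
move=> a p q; rewrite -(coker_piK p) -(coker_piK q).
by rewrite -coker_piD !coker_scaleE scalerDr coker_piD.
Qed.

Fact coker_scaleDl q : {morph coker_scale^~ q : a b / a + b}.
Proof.
by move=> a b; rewrite -(coker_piK q) !coker_scaleE scalerDl coker_piD.
Qed.

HB.instance Definition _ := GRing.Zmodule_isLmodule.Build R cokernel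
  coker_scaleA coker_scale1 coker_scaleDr coker_scaleDl.

Fact coker_pi_is_linear : linear coker_pi.
Proof. by move=> a u v; rewrite coker_piD -coker_scaleE. Qed.

HB.instance Definition _ := GRing.isLinear.Build R V cokernel *:%R coker_pi
  coker_pi_is_linear.
End KernelCokernel.

(* The library quotients only commutative rings, by proper ideals.     *)

HB.mixin Record isIdeal2 (R : pzRingType) (S : R -> bool) := {
  ideal2Ml : forall a u, u \in (S : {pred R}) -> a * u \in (S : {pred R});
  ideal2Mr : forall a u, u \in (S : {pred R}) -> u * a \in (S : {pred R})
}.

#[short(type="ideal2")]
HB.structure Definition Ideal2 (R : pzRingType) :=
  {S of GRing.ZmodClosed R S & isIdeal2 R S}.

Section RingQuotient.
Variables (R : pzRingType) (I : ideal2 R).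

Definition ring_quot : Type := Quotient.quot I.
HB.instance Definition _ := GRing.Zmodule.on ring_quot.

Definition ring_pi (a : R) : ring_quot := \pi_(Quotient.quot I) a.

Lemma ring_pi_eq a b : (ring_pi a = ring_pi b) <-> (a - b \in I).
Proof. exact: quotP. Qed.

Lemma ring_piK (q : ring_quot) : ring_pi (repr q) = q.
Proof. exact: reprK. Qed.

Fact ring_piB : zmod_morphism ring_pi.
Proof. exact: raddfB. Qed.

Fact ring_piD : {morph ring_pi : u v / u + v}.
Proof. exact: raddfD. Qed.

Definition ring_quot_mul (p q : ring_quot) : ring_quot :=
  ring_pi (repr p * repr q).

Lemma ring_quot_mulE a b : ring_quot_mul (ring_pi a) (ring_pi b) = ring_pi (a * b).
Proof.
apply/ring_pi_eq; set a' := repr _; set b' := repr _.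
have aI : a' - a \in I by apply/ring_pi_eq; rewrite ring_piK.
have bI : b' - b \in I by apply/ring_pi_eq; rewrite ring_piK.
rewrite -(subrK (a' * b) (a' * b')) -mulrBr -addrA -mulrBl.
by apply: rpredD; [apply: ideal2Ml | apply: ideal2Mr].
Qed.

Fact ring_quot_mulA : associative ring_quot_mul.
Proof.
move=> p q r; rewrite -(ring_piK p) -(ring_piK q) -(ring_piK r).
by rewrite !ring_quot_mulE mulrA.
Qed.

Fact ring_quot_mul1q : left_id (ring_pi 1) ring_quot_mul.
Proof. by move=> p; rewrite -(ring_piK p) ring_quot_mulE mul1r. Qed.

Fact ring_quot_mulq1 : right_id (ring_pi 1) ring_quot_mul.
Proof. by move=> p; rewrite -(ring_piK p) ring_quot_mulE mulr1. Qed.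

Fact ring_quot_mulDl : left_distributive ring_quot_mul +%R.
Proof.
move=> p q r; rewrite -(ring_piK p) -(ring_piK q) -(ring_piK r).
by rewrite -ring_piD !ring_quot_mulE mulrDl ring_piD.
Qed.

Fact ring_quot_mulDr : right_distributive ring_quot_mul +%R.
Proof.
move=> p q r; rewrite -(ring_piK p) -(ring_piK q) -(ring_piK r).
by rewrite -ring_piD !ring_quot_mulE mulrDr ring_piD.
Qed.

HB.instance Definition _ := GRing.Zmodule_isPzRing.Build ring_quot
  ring_quot_mulA ring_quot_mul1q ring_quot_mulq1 ring_quot_mulDl ring_quot_mulDr.

Lemma ring_piM a b : ring_pi (a * b) = ring_pi a * ring_pi b.
Proof. by rewrite -ring_quot_mulE. Qed.

(* R/I as an (R/I)-R-bimodule *)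
Definition quot_bimod : Type := ring_quot^o.
HB.instance Definition _ := GRing.Lmodule.on quot_bimod.

Definition quot_rscale (q : quot_bimod) (a : R) : quot_bimod :=
  (q : ring_quot) * ring_pi a.

Fact quot_rscaleA q a b : quot_rscale (quot_rscale q a) b = quot_rscale q (a * b).
Proof. by rewrite /quot_rscale -mulrA -ring_piM. Qed.

Fact quot_rscale1 q : quot_rscale q 1 = q.
Proof. exact: mulr1. Qed.

Fact quot_rscaleDl a : {morph quot_rscale^~ a : p q / p + q}.
Proof. by move=> p q; apply: mulrDl. Qed.

Fact quot_rscaleDr q : {morph quot_rscale q : a b / a + b}.
Proof. by move=> a b; rewrite /quot_rscale ring_piD mulrDr. Qed.

HB.instance Definition _ := Zmodule_isRmodule.Build R quot_bimod
  quot_rscaleA quot_rscale1 quot_rscaleDl quot_rscaleDr.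

Fact quot_bimodA (p : ring_quot) (q : quot_bimod) (a : R) :
  rscale (p *: q : quot_bimod) a = p *: rscale q a.
Proof. by rewrite /rscale /= /quot_rscale -mulrA. Qed.

HB.instance Definition _ := Lmodule_Rmodule_isBimodule.Build ring_quot R
  quot_bimod quot_bimodA.
End RingQuotient.


(* The map X -> Hom_B(M, Y) adjoint to f : M (x)_A X -> Y. *)
Section TensorHomAdjunction.
Variables (B A : pzRingType) (M : bimodType B A).
Variables (X : lmodType A) (Y : lmodType B) (f : {linear tensor M X -> Y}).

Definition adj_fun (x : X) (m : M) : Y := f (tens m x).

Fact adj_fun_is_linear x : linear (adj_fun x).
Proof. by move=> b m m'; rewrite /adj_fun tensDl -tensZ linearP. Qed.

HB.instance Definition _ x := GRing.isLinear.Build B M Y *:%R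
  (adj_fun x) (adj_fun_is_linear x).

Definition adj (x : X) : lhom M Y := adj_fun x : {linear M -> Y}.

Fact adj_is_linear : linear adj.
Proof.
move=> a x x'; apply: lhomP => m.
by rewrite /= /lhom_scale_fun /= /adj_fun tensDr -tensM raddfD.
Qed.

HB.instance Definition _ := GRing.isLinear.Build A X (lhom M Y) *:%R
  adj adj_is_linear.
End TensorHomAdjunction.

Definition projective (R : pzRingType) (P : lmodType R) :=
  forall (U V : lmodType R) (p : {linear U -> V}) (h : {linear P -> V}),
    surjective p -> exists k : {linear P -> U}, p \o k =1 h.

Record proj_resolution (R : pzRingType) (C : lmodType R) := ProjResolution {
  res_obj :> nat -> lmodType R;
  res_d : forall n, {linear res_obj n.+1 -> res_obj n};
  res_aug : {linear res_obj 0%N -> C};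
  res_proj : forall n, projective (res_obj n);
  res_aug_surj : surjective res_aug;
  res_exact0 : exact_at (res_d 0) res_aug;
  res_exact : forall n, exact_at (res_d n.+1) (res_d n)
}.

(* Ext^1(C, X) = 0 and Tor_1(N, Y) = 0 say that the first (co)homology *)
(* group of Hom(P, X), resp. N (x) P, vanishes. Up to isomorphism this *)
(* group does not depend on the projective resolution P.               *)
Definition Ext1_eq0 (R : pzRingType) (C X : lmodType R) :=
  forall P : proj_resolution C,
    exact_at (precomp (X := X) (res_d P 0)) (precomp (X := X) (res_d P 1)).

Definition Tor1_eq0 (R : pzRingType) (N : rmodType R) (Y : lmodType R) :=
  forall P : proj_resolution Y,
    exact_at (tensor_map N (res_d P 1)) (tensor_map N (res_d P 0)).

Section Cotorsion.
Variable R : pzRingType.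

Definition mod_class := lmodType R -> Prop.
Implicit Types C D : mod_class.

Definition eq_class C D := forall X, C X <-> D X.

Definition rperp C : mod_class := fun X => forall U, C U -> Ext1_eq0 U X.
Definition lperp C : mod_class := fun X => forall U, C U -> Ext1_eq0 X U.

Definition cotorsion_pair C D := eq_class (rperp C) D /\ eq_class (lperp D) C.

Definition complete_pair C D := forall Z : lmodType R,
  (exists (D1 C1 : lmodType R) (i : {linear D1 -> C1}) (p : {linear C1 -> Z}),
     [/\ D D1, C C1 & short_exact i p]) /\
  (exists (D2 C2 : lmodType R) (i : {linear Z -> D2}) (p : {linear D2 -> C2}),
     [/\ D D2, C C2 & short_exact i p]).

Definition epi_kernel_closed C :=
  forall (U V W : lmodType R) (i : {linear U -> V}) (p : {linear V -> W}),
    short_exact i p -> C V -> C W -> C U.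

Definition mono_cokernel_closed D :=
  forall (U V W : lmodType R) (i : {linear U -> V}) (p : {linear V -> W}),
    short_exact i p -> D U -> D V -> D W.

Definition hereditary_pair C D := epi_kernel_closed C /\ mono_cokernel_closed D.
End Cotorsion.

Record morita_datum (A B : pzRingType) (N : bimodType A B) (M : bimodType B A) :=
MoritaDatum {
  phi : {linear tensor M N -> B^o};
  psi : {linear tensor N M -> A^o};
  phi_rlinear : forall (t : tensor M N) (b : B), phi (rscale t b) = rscale (phi t) b;
  psi_rlinear : forall (t : tensor N M) (a : A), psi (rscale t a) = rscale (psi t) a;
  phi_psi : forall (m' : M) (n : N) (m : M),
    rscale m' (psi (tens n m)) = (phi (tens m' n) : B) *: m;
  psi_phi : forall (n' : N) (m : M) (n : N),
    rscale n' (phi (tens m n)) = (psi (tens n' m) : A) *: n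
}.

(* D is a phantom parameter: the multiplication depends on it. *)
Record morita_ring (A B : pzRingType) (N : bimodType A B) (M : bimodType B A)
  (D : morita_datum N M) : Type := Morita { mA : A; mN : N; mM : M; mB : B }.
Arguments Morita {A B N M D} _ _ _ _.

Section MoritaRing.
Variables (A B : pzRingType) (N : bimodType A B) (M : bimodType B A).
Variable D : morita_datum N M.

Definition im_psi : {pred A} := fun a => `[< exists t, psi D t = a >].

Fact im_psi_zmod_closed : zmod_closed im_psi.
Proof.
split=> [|_ _ /asboolP[s <-] /asboolP[t <-]]; apply/asboolP.
  by exists 0; apply: raddf0.
by exists (s - t); apply: (raddfB (psi D)).
Qed.

HB.instance Definition _ := GRing.isZmodClosed.Build A im_psi im_psi_zmod_closed.

Fact im_psi_Ml a u : u \in im_psi -> a * u \in im_psi.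
Proof.
by move=> /asboolP[t <-]; apply/asboolP; exists (a *: t); rewrite linearZ.
Qed.

Fact im_psi_Mr a u : u \in im_psi -> u * a \in im_psi.
Proof.
by move=> /asboolP[t <-]; apply/asboolP; exists (rscale t a); rewrite psi_rlinear.
Qed.

HB.instance Definition _ := isIdeal2.Build A im_psi im_psi_Ml im_psi_Mr.

Definition A_mod_psi : pzRingType := ring_quot im_psi.
Definition A_mod_psi_bimod : bimodType A_mod_psi A := quot_bimod im_psi.

Definition morita_enc (r : morita_ring D) := ((mA r, mN r), (mM r, mB r)).
Definition morita_dec (r : A * N * (M * B)) : morita_ring D :=
  Morita r.1.1 r.1.2 r.2.1 r.2.2.
Fact morita_encK : cancel morita_enc morita_dec. Proof. by case. Qed.

HB.instance Definition _ := Choice.copy (morita_ring D) (can_type morita_encK).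

Definition morita_zero : morita_ring D := Morita 0 0 0 0.
Definition morita_one : morita_ring D := Morita 1 0 0 1.
Definition morita_opp (r : morita_ring D) : morita_ring D :=
  Morita (- mA r) (- mN r) (- mM r) (- mB r).
Definition morita_add (r s : morita_ring D) : morita_ring D :=
  Morita (mA r + mA s) (mN r + mN s) (mM r + mM s) (mB r + mB s).
Definition morita_mul (r s : morita_ring D) : morita_ring D :=
  Morita (mA r * mA s + psi D (tens (mN r) (mM s)))
         (mA r *: mN s + rscale (mN r) (mB s))
         (rscale (mM r) (mA s) + mB r *: mM s)
         (phi D (tens (mM r) (mN s)) + mB r * mB s).

Fact morita_addA : associative morita_add.
Proof. by move=> r s t; rewrite /morita_add /= !addrA. Qed.
Fact morita_addC : commutative morita_add.
Proof.
by move=> r s; congr Morita; apply: addrC.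
Qed.
Fact morita_add0 : left_id morita_zero morita_add.
Proof. by case=> a n m b; rewrite /morita_add /= !add0r. Qed.
Fact morita_addN : left_inverse morita_zero morita_opp morita_add.
Proof. by move=> r; rewrite /morita_add /= !addNr. Qed.

HB.instance Definition _ := GRing.isZmodule.Build (morita_ring D)
  morita_addA morita_addC morita_add0 morita_addN.

Local Notation psit n m := (psi D (tens n m) : A).
Local Notation phit m n := (phi D (tens m n) : B).

Let psiDl n n' m : psit (n + n') m = psit n m + psit n' m.
Proof. by rewrite tensDl raddfD. Qed.
Let psiDr n m m' : psit n (m + m') = psit n m + psit n m'.
Proof. by rewrite tensDr raddfD. Qed.
Let psiZ a n m : psit (a *: n) m = a * psit n m.
Proof. by rewrite -tensZ linearZ. Qed.
Let psir n m a : psit n (rscale m a) = psit n m * a.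
Proof. by rewrite -tens_rscale psi_rlinear. Qed.
Let phiDl m m' n : phit (m + m') n = phit m n + phit m' n.
Proof. by rewrite tensDl raddfD. Qed.
Let phiDr m n n' : phit m (n + n') = phit m n + phit m n'.
Proof. by rewrite tensDr raddfD. Qed.
Let phiZ b m n : phit (b *: m) n = b * phit m n.
Proof. by rewrite -tensZ linearZ. Qed.
Let phir m n b : phit m (rscale n b) = phit m n * b.
Proof. by rewrite -tens_rscale phi_rlinear. Qed.

Fact morita_mulA : associative morita_mul.
Proof.
case=> [a n m b] [a' n' m' b'] [a'' n'' m'' b'']; rewrite /morita_mul /=.
congr Morita.
- by rewrite psiDr psir psiDl psiZ tensM mulrDr mulrDl mulrA -!addrA;
    congr (_ + _); rewrite addrCA.
- rewrite scalerDr scalerA scalerDl rscalerDl rscalerDr bimodA rscalerA.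
  by rewrite psi_phi -!addrA; congr (_ + _); rewrite addrCA.
- rewrite rscalerDr rscalerDl scalerDr scalerDl rscalerA scalerA bimodA.
  by rewrite phi_psi -!addrA; congr (_ + _); rewrite addrCA.
- by rewrite phiDr phir phiDl phiZ tensM mulrDr mulrDl mulrA -!addrA;
    congr (_ + _); rewrite addrCA.
Qed.
Fact morita_mul1r : left_id morita_one morita_mul.
Proof.
case=> a n m b; rewrite /morita_mul /=; congr Morita.
- by rewrite tens0l raddf0 mul1r addr0.
- by rewrite scale1r rscale0l addr0.
- by rewrite rscale0l scale1r add0r.
- by rewrite tens0l raddf0 mul1r add0r.
Qed.
Fact morita_mulr1 : right_id morita_one morita_mul.
Proof.
case=> a n m b; rewrite /morita_mul /=; congr Morita.
- by rewrite tens0r raddf0 mulr1 addr0.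
- by rewrite scaler0 rscaler1 add0r.
- by rewrite scaler0 rscaler1 addr0.
- by rewrite tens0r raddf0 mulr1 add0r.
Qed.
Fact morita_mulDl : left_distributive morita_mul +%R.
Proof.
case=> [a n m b] [a' n' m' b'] [a'' n'' m'' b''].
rewrite /GRing.add /= /morita_mul /morita_add /=; congr Morita.
- by rewrite psiDl mulrDl addrACA.
- by rewrite scalerDl rscalerDl addrACA.
- by rewrite scalerDl rscalerDl addrACA.
- by rewrite phiDl mulrDl addrACA.
Qed.
Fact morita_mulDr : right_distributive morita_mul +%R.
Proof.
case=> [a n m b] [a' n' m' b'] [a'' n'' m'' b''].
rewrite /GRing.add /= /morita_mul /morita_add /=; congr Morita.
- by rewrite psiDr mulrDr addrACA.
- by rewrite scalerDr rscalerDr addrACA.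
- by rewrite scalerDr rscalerDr addrACA.
- by rewrite phiDr mulrDr addrACA.
Qed.

HB.instance Definition _ := GRing.Zmodule_isPzRing.Build (morita_ring D)
  morita_mulA morita_mul1r morita_mulr1 morita_mulDl morita_mulDr.

(* The quadruple (X, Y)_{f,g}; quad_mod is the left module over the    *)
(* Morita ring it is identified with.                                  *)
Record quadruple := Quadruple {
  qX : lmodType A;
  qY : lmodType B;
  qf : {linear tensor M qX -> qY};
  qg : {linear tensor N qY -> qX};
  qgf : forall (n : N) (m : M) (x : qX),
    qg (tens n (qf (tens m x))) = (psi D (tens n m) : A) *: x;
  qfg : forall (m : M) (n : N) (y : qY),
    qf (tens m (qg (tens n y))) = (phi D (tens m n) : B) *: y
}.

Section QuadMod.
Variable q : quadruple.

Definition quad_mod : Type := (qX q * qY q)%type.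
HB.instance Definition _ := GRing.Zmodule.on quad_mod.

Definition quad_scale (r : morita_ring D) (v : quad_mod) : quad_mod :=
  (mA r *: v.1 + qg q (tens (mN r) v.2), qf q (tens (mM r) v.1) + mB r *: v.2).

Fact quad_scaleA r s v : quad_scale r (quad_scale s v) = quad_scale (r * s) v.
Proof.
case: r s v => [a n m b] [a' n' m' b'] [x y]; rewrite /quad_scale /=.
congr pair.
- rewrite tensDr tensDl !(raddfD (qg q)) /= qgf -tensZ linearZ tensM.
  by rewrite scalerDr scalerDl scalerA -!addrA; congr (_ + _); rewrite addrCA.
- rewrite tensDr tensDl !(raddfD (qf q)) /= qfg -tensZ linearZ tensM.
  by rewrite scalerDr scalerDl scalerA -!addrA; congr (_ + _); rewrite addrCA.
Qed.
Fact quad_scale1 : left_id 1 quad_scale.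
Proof.
by case=> x y; rewrite /quad_scale /= !scale1r !tens0l !raddf0 add0r addr0.
Qed.
Fact quad_scaleDr : right_distributive quad_scale +%R.
Proof.
move=> r [x y] [x' y']; congr pair => /=.
- by rewrite scalerDr tensDr raddfD addrACA.
- by rewrite scalerDr tensDr raddfD addrACA.
Qed.
Fact quad_scaleDl v : {morph quad_scale^~ v : r s / r + s}.
Proof.
move=> [a n m b] [a' n' m' b']; congr pair => /=.
- by rewrite scalerDl tensDl raddfD addrACA.
- by rewrite scalerDl tensDl raddfD addrACA.
Qed.

HB.instance Definition _ := GRing.Zmodule_isLmodule.Build (morita_ring D) quad_mod
  quad_scaleA quad_scale1 quad_scaleDr quad_scaleDl.
End QuadMod.

Definition class_M (C' : mod_class A_mod_psi) (C'' : mod_class B) :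
    mod_class (morita_ring D) :=
  fun V => exists q : quadruple,
    [/\ lmod_iso V (quad_mod q),
        C' (tensor A_mod_psi_bimod (cokernel (qg q))),
        C'' (qY q) &
        injective (qg q)].

Definition class_N (D' : mod_class A_mod_psi) (D'' : mod_class B) :
    mod_class (morita_ring D) :=
  fun V => exists q : quadruple,
    [/\ lmod_iso V (quad_mod q),
        D' (tensor A_mod_psi_bimod (kernel (adj (qf q)))),
        D'' (qY q) &
        surjective (adj (qf q))].
End MoritaRing.

(* Main.v *)
Require Import Defs.
From HB Require Import structures.
From mathcomp Require Import all_boot all_order all_algebra.
From mathcomp Require Import boolp.
From mathcomp Require Import freeg.
From mathcomp Require classical_sets.

Set Implicit Arguments.
Unset Strict Implicit.
Unset Printing Implicit Defensive.

Import Order.TTheory GRing.Theory Num.Theory.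
Local Open Scope ring_scope.

(** Write [T Y = (N (x) Y, Y)] and [H Y = (Hom(M, Y), Y)] for the two adjoints
    of [(X, Y) |-> Y], [L P = (P, M (x) P)] for the left adjoint of
    [(X, Y) |-> X], [I = Im psi], and [Z L = (L, 0)] for an [A/I]-module [L].
    [Ext^1(C, X) = 0] is used in the form: every extension of [C] by [X] splits.

    Adjunction shows that [Ext(T Y, q)] embeds into [Ext(Y, qY q)], with equality
    when [Tor_1(N, Y) = 0], and dually [Ext(q, H Y)] embeds into [Ext(qY q, Y)],
    with equality when [Ext^1(M, Y) = 0]; moreover [Ext(Z L, Z L')] is [Ext(L, L')]
    over [A/I]. With the sequences [T Y -> (X, Y) -> Z (Coker g)] for [g] monic and
    [Z (Ker f~) -> (X, Y) -> H Y] for [f~] epic this identifies the two classes as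
    [ND = {T C'', Z C'}^perp] and [MC = ^perp{H D'', Z D'}], and it gives
    [Ext(MC, ND) = 0].

    That orthogonality forces [f~] to be epic and [g] to be monic uses that [psi]
    is injective: then [g] is monic on [L P] for [P] free. The first follows by
    testing against [Coker (T(M (x) P) -> L P) = Z(P / IP)] with [P] mapping onto
    [Hom(M, Y)], the second by testing against [Z] of the injective cogenerator
    [Hom_Z(A/I, Q/Z)].

    For completeness, three pushouts embed [(X, Y)] into an object of [ND] with
    cokernel filtered by [T C''], [Z (P / IP)] and [Z C']: they put [Y] into [D''],
    make [f~] epic, and put [Ker f~] into [D']. The other approximation follows from
    this one by Salce's trick with a free cover. *)

(** Only vanishing of Ext is ever used, so long exact sequences are replaced by pushouts and
    pullbacks. Quadruples inherit these from modules over the Morita ring, through the Peirce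
    decomposition for its two diagonal idempotents. The classes [C'] and [D'] live over A/I, whereas
    Ker f~ and Coker g are A-modules. They fit together by the identity psi(n (x) m) x = g(n (x) f(m
    (x) x)): it shows that I kills Ker f~, Coker g, and also X whenever Y = 0. Hence an extension of
    Z L by Z L' again has the form Z E with E killed by I, and its Ext is the one over A/I rather
    than over A. The map g on L P is psi tensored with P, for P free a direct sum of copies of psi;
    this is where injectivity of psi enters. The order of the three pushouts matters: in the last
    two the cokernel has zero second component, so Y is no longer changed, and the sequence that
    starts with Ker f~ is available only once f~ is epic. *)

(** * Linear maps, short exact sequences and split extensions *)

Section LinearMaps.
Variable R : pzRingType.
Implicit Types U V W X C E : lmodType R.

(** The proof of linearity is an argument of the function, so that a linear structure can be
    attached to a map built inside a proof. *)
Definition mklin_fun U V (f : U -> V) (_ : linear f) x := f x.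
HB.instance Definition _ U V (f : U -> V) (lf : linear f) :=
  GRing.isLinear.Build R U V *:%R (mklin_fun lf) lf.
Definition mklin U V (f : U -> V) (lf : linear f) : {linear U -> V} :=
  mklin_fun lf.
Arguments mklin_fun U V f _ x /.
Arguments mklin U V f lf /.

Lemma raddf_eqP (U V : zmodType) (f : {additive U -> V}) x y :
  (f x = f y) <-> (f (x - y) = 0).
Proof.
by rewrite raddfB; split=> [->|/eqP]; rewrite ?subrr // subr_eq0 => /eqP.
Qed.

Lemma linear_inj U V (f : {linear U -> V}) :
  (forall x, f x = 0 -> x = 0) -> injective f.
Proof. by move=> f0 x y /raddf_eqP/f0/eqP; rewrite subr_eq0 => /eqP. Qed.

Lemma linear_inverse U V (f : {linear U -> V}) : injective f -> surjective f ->
  exists g : {linear V -> U}, cancel f g /\ cancel g f.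
Proof.
move=> fi fs; have [g gK] := choice fs.
have lg : linear g by move=> a u v; apply: fi; rewrite linearP !gK.
by exists (mklin lg); split=> x //=; apply: fi; apply: gK.
Qed.

Lemma factor_surj U V W (p : {linear U -> V}) (h : {linear U -> W}) :
  surjective p -> (forall u, p u = 0 -> h u = 0) ->
  exists k : {linear V -> W}, forall u, k (p u) = h u.
Proof.
move=> ps h0; have [s sK] := choice ps.
have hs u v : p u = p v -> h u = h v by move=> /raddf_eqP/h0/raddf_eqP.
have lk : linear (h \o s).
  by move=> a u v /=; rewrite -linearP; apply: hs; rewrite linearP !sK.
by exists (mklin lk) => u; apply: hs; apply: sK.
Qed.

Lemma factor_inj U V W (i : {linear U -> V}) (h : {linear W -> V}) :
  injective i -> (forall w, exists u, i u = h w) ->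
  exists k : {linear W -> U}, forall w, i (k w) = h w.
Proof.
move=> ii /choice[k kE].
have lk : linear k by move=> a u v; apply: ii; rewrite linearP !kE linearP.
by exists (mklin lk).
Qed.

Lemma pair_linear U V W (f : {linear U -> V}) (g : {linear U -> W}) :
  exists h : {linear U -> (V * W)%type}, forall u, h u = (f u, g u).
Proof.
have lh : linear (fun u => (f u, g u)).
  by move=> a u v; rewrite !linearP.
by exists (mklin lh).
Qed.

Lemma copair_linear U V W (f : {linear U -> W}) (g : {linear V -> W}) :
  exists h : {linear (U * V)%type -> W}, forall u, h u = f u.1 + g u.2.
Proof.
have lh : linear (fun u : U * V => f u.1 + g u.2).
  by move=> a u v; rewrite !linearP scalerDr addrACA.
by exists (mklin lh).
Qed.

Lemma coker_pi_eq0 U V (f : {linear U -> V}) v :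
  coker_pi f v = 0 <-> exists u, f u = v.
Proof. by rewrite -(raddf0 (coker_pi f)) coker_pi_eq subr0. Qed.

Lemma coker_pi_surj U V (f : {linear U -> V}) : surjective (coker_pi f).
Proof. by move=> q; exists (repr q); apply: coker_piK. Qed.

Lemma kernel_val U V (f : {linear U -> V}) :
  exists i : {linear kernel f -> U},
    injective i /\ forall u, f u = 0 <-> exists k, i k = u.
Proof.
have li : linear (val : kernel f -> U) by [].
exists (mklin li); split=> [|u]; first exact: val_inj.
split=> [fu|[[k /= /eqP fk] <-]//].
have fu' : ker_pred f u by apply/eqP.
by exists (Sub u fu').
Qed.

Lemma ses0 U V W (i : {linear U -> V}) (p : {linear V -> W}) u :
  short_exact i p -> p (i u) = 0.
Proof. by case=> _ e _; apply/e; exists u. Qed.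

Lemma ses_lift U V W (i : {linear U -> V}) (p : {linear V -> W}) v :
  short_exact i p -> p v = 0 -> exists u, i u = v.
Proof. by case=> _ e _ /e. Qed.

Lemma cokernel_ses U V (i : {linear U -> V}) : injective i ->
  short_exact i (coker_pi i).
Proof.
by move=> ii; split; [|move=> v; apply: coker_pi_eq0|apply: coker_pi_surj].
Qed.

Lemma kernel_ses U V (p : {linear U -> V}) : surjective p ->
  exists i : {linear kernel p -> U}, short_exact i p.
Proof. by move=> ps; have [i [ii ie]] := kernel_val p; exists i. Qed.

Lemma pushout_ses U V W X (i : {linear U -> V}) (p : {linear V -> W})
    (h : {linear U -> X}) : short_exact i p ->
  exists (E : lmodType R) (i' : {linear X -> E}) (p' : {linear E -> W})
    (k : {linear V -> E}),
  [/\ short_exact i' p', forall u, k (i u) = i' (h u) & forall v, p' (k v) = p v].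
Proof.
move=> ip; have [ii e ps] := ip.
(* The pushout is the cokernel of [u] |-> ([h u], - [i u]); [p'] is induced by 0 on [X] and [p] on
   [V]. *)
have [j jE] := pair_linear h (\- i).
have li : linear (fun x => coker_pi j (x, 0)).
  by move=> a x y; rewrite -linearP; congr coker_pi; congr pair;
    rewrite /= scaler0 addr0.
have lk : linear (fun v => coker_pi j (0, v)).
  by move=> a x y; rewrite -linearP; congr coker_pi; congr pair;
    rewrite /= scaler0 addr0.
have [q qE] := copair_linear (\0 : {linear X -> W}) p.
have [|p' p'E] := factor_surj (h := q) (@coker_pi_surj _ _ j).
  move=> u /coker_pi_eq0[w <-].
  by rewrite qE jE /= add0r raddfN /= (ses0 _ ip) oppr0.
exists (cokernel j), (mklin li), p', (mklin lk); split=> [|u|v] /=.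
- split=> [|y|w].
  + apply: linear_inj => x /coker_pi_eq0[u]; rewrite jE => -[<- /eqP].
    by rewrite oppr_eq0 => /eqP iu0; rewrite (ii u 0) ?raddf0.
  + have [[x v] <-] := @coker_pi_surj _ _ j y.
    rewrite p'E qE /= add0r; split=> [/e[u <-]|[x']].
      exists (x + h u); apply/coker_pi_eq; exists u.
      by rewrite jE; congr pair; rewrite /= ?sub0r // addrC addKr.
    move/coker_pi_eq => [u]; rewrite jE => -[_ /eqP].
    by rewrite sub0r eqr_opp => /eqP <-; rewrite (ses0 _ ip).
  + by have [v <-] := ps w; exists (coker_pi j (0, v)); rewrite p'E qE /= add0r.
- apply/coker_pi_eq; exists (- u); rewrite jE !raddfN.
  by congr pair; rewrite /= ?sub0r ?opprK ?subr0.
- by rewrite p'E qE /= add0r.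
Qed.

Lemma pullback_ses U V W X (i : {linear U -> V}) (p : {linear V -> W})
    (h : {linear X -> W}) : short_exact i p ->
  exists (E : lmodType R) (i' : {linear U -> E}) (p' : {linear E -> X})
    (k : {linear E -> V}),
  [/\ short_exact i' p', forall u, k (i' u) = i u & forall e, p (k e) = h (p' e)].
Proof.
move=> ip; have [ii e ps] := ip.
(* The pullback is the kernel of ([v], [x]) |-> [p v] - [h x]. *)
have [q qE] := copair_linear p (\- h).
have [j [jj jE]] := kernel_val q.
have lf : linear (fst : V * X -> V) by [].
have ls : linear (snd : V * X -> X) by [].
have [l lE] := pair_linear i (\0 : {linear U -> X}).
have [|i' i'E] := factor_inj (h := l) jj.
  by move=> u; apply/jE; rewrite qE lE /= (ses0 _ ip) raddf0 subr0.
exists (kernel q), i', (mklin ls \o j), (mklin lf \o j); split=> [|u|z] /=.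
- split=> [|z|x].
  + by apply: linear_inj => u /(congr1 j); rewrite i'E lE raddf0 => -[iu];
      apply: ii; rewrite iu raddf0.

  + split=> [jz|[u <-]]; last by rewrite /= i'E lE.
    have /jE : exists k, j k = j z by exists z.
    have {}jz : (j z).2 = 0 by [].
    rewrite qE jz /= raddf0 subr0 => /e[u uE]; exists u; apply: jj.
    by rewrite i'E lE uE [RHS]surjective_pairing jz.
  + have [v vE] := ps (h x); have /jE[k kE] : q (v, x) = 0 by rewrite qE /= vE subrr.
    by exists k; rewrite /= kE.
- by rewrite i'E lE.
- have /jE : exists k, j k = j z by exists z.
  by rewrite qE => /eqP; rewrite subr_eq0 => /eqP.
Qed.

Definition splits C X := forall E (i : {linear X -> E}) (p : {linear E -> C}),
  short_exact i p -> exists r : {linear E -> X}, cancel i r.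

(** The element [v - i (r v)] depends only on [p v], and [v - s (p v)] lies in the image of [i]. *)
Lemma retraction_section U V W (i : {linear U -> V}) (p : {linear V -> W}) :
  short_exact i p ->
  (exists r : {linear V -> U}, cancel i r) <-> (exists s : {linear W -> V}, cancel s p).
Proof.
move=> ip; have [ii e ps] := ip; split=> [[r rK]|[s sK]].
- have ls : linear (fun v => v - i (r v)).
    by move=> a u v; rewrite !linearP scalerDr addrACA.
  have [|s sE] := factor_surj (h := mklin ls) ps.
    by move=> v /e[u <-] /=; rewrite rK subrr.
  exists s => w; have [v <-] := ps w.
  by rewrite sE /= raddfB /= (ses0 _ ip) subr0.
- have lr : linear (fun v => v - s (p v)).
    by move=> a u v; rewrite !linearP scalerDr addrACA.
  have [|r rE] := factor_inj (h := mklin lr) ii.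
    by move=> v; apply: (ses_lift ip); rewrite /= raddfB /= sK subrr.
  by exists r => u; apply: ii; rewrite rE /= (ses0 _ ip) raddf0 subr0.
Qed.

Lemma splitsP C X : splits C X <->
  forall E (i : {linear X -> E}) (p : {linear E -> C}),
    short_exact i p -> exists s : {linear C -> E}, cancel s p.
Proof.
by split=> CX E i p ip; apply/(retraction_section ip); apply: CX ip.
Qed.

Lemma raddf_inj_eq0 U V (f : {linear U -> V}) x : injective f -> f x = 0 -> x = 0.
Proof. by move=> fi fx; apply: fi; rewrite fx raddf0. Qed.

Lemma lmod_iso_inv U V : lmod_iso U V ->
  exists (f : {linear U -> V}) (g : {linear V -> U}), cancel f g /\ cancel g f.
Proof.
move=> [f [f' fK f'K]]; have [|y|g fg] := @linear_inverse _ _ f.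
- exact: can_inj fK.
- by exists (f' y).
- by exists f, g.
Qed.

Lemma lmod_iso_bij U V (f : {linear U -> V}) :
  injective f -> surjective f -> lmod_iso U V.
Proof. by move=> fi fs; exists f; have [g [fK gK]] := linear_inverse fi fs;
  exists g. Qed.

Lemma lmod_iso_sym U V : lmod_iso U V -> lmod_iso V U.
Proof. by move=> /lmod_iso_inv[f [g [fK gK]]]; exists g, f. Qed.

Lemma splits_iso C C' X X' :
  lmod_iso C C' -> lmod_iso X X' -> splits C X -> splits C' X'.
Proof.
move=> /lmod_iso_inv[f [f' [fK f'K]]] /lmod_iso_inv[g [g' [gK g'K]]] CX E i p.
move=> ip; have [ii e ps] := ip.
have [|r rK] := CX E (i \o g) (f' \o p).
  split=> [|y|c] /=.
  - exact: inj_comp ii (can_inj gK).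
  - split=> [/(raddf_inj_eq0 (can_inj f'K))/e[x <-]|[x <-]]; last first.
      by rewrite (ses0 _ ip) raddf0.
    by exists (g' x); rewrite /= g'K.
  - by have [y yE] := ps (f c); exists y; rewrite yE fK.
by exists (g \o r) => x /=; rewrite -{1}(g'K x) [r _]rK g'K.
Qed.

(** Middle exactness of Ext^1(-, X). The pullback to [U] splits, so [i] lifts to [t : U -> E]. Then
    E / t(U) is an extension of [V] by [X], and a retraction of it composed with the projection of
    [E] is a retraction of [j]. *)
Lemma splits_extl U C V X (i : {linear U -> C}) (p : {linear C -> V}) :
  short_exact i p -> splits U X -> splits V X -> splits C X.
Proof.
move=> ip UX VX E j q jq; have [ii e ps] := ip; have [jj eq qs] := jq.
have [E' [j' [q' [k [jq' kj qk]]]]] := pullback_ses i jq.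
have [s sK] := (splitsP _ _).1 UX _ _ _ jq'.
pose t : {linear U -> E} := k \o s.
have qt u : q (t u) = i u by rewrite /= qk sK.
have [|q2 q2E] := factor_surj (h := p \o q) (@coker_pi_surj _ _ t).
  by move=> _ /coker_pi_eq0[u <-] /=; rewrite qt (ses0 _ ip).
have [|r rK] := VX (cokernel t) (coker_pi t \o j) q2.
  split=> [|y|v].
  - apply: linear_inj => x /coker_pi_eq0[u tu]; apply: (raddf_inj_eq0 jj).
    have iu : i u = 0 by rewrite -qt tu (ses0 _ jq).
    by rewrite -tu (raddf_inj_eq0 ii iu) raddf0.
  - have [z <-] := @coker_pi_surj _ _ t y; rewrite q2E /=; split.
      move=> /e[u iu]; have [|x jx] := ses_lift (v := z - t u) jq.
        by rewrite raddfB /= qt iu subrr.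
      exists x; apply/coker_pi_eq; exists (- u).
      by rewrite jx raddfN /= [RHS]addrC addKr.
    move=> [x xz]; have -> : p (q z) = q2 (coker_pi t z) by rewrite q2E.
    by rewrite -xz q2E /= (ses0 _ jq) raddf0.
  - have [c <-] := ps v; have [z <-] := qs c; exists (coker_pi t z).
    by rewrite q2E.
by exists (r \o coker_pi t) => x /=; apply: rK.
Qed.

(** Middle exactness of Ext^1(C, -). Splitting of the pushout along [p] extends [p] to
    [rk : E -> V]; the kernel of [rk] is an extension of [C] by [U], and a section of it gives a
    section of [q]. *)
Lemma splits_extr U X V C (i : {linear U -> X}) (p : {linear X -> V}) :
  short_exact i p -> splits C U -> splits C V -> splits C X.
Proof.
move=> ip CU CV E j q jq; apply/(retraction_section jq).
have [ii e ps] := ip; have [jj eq qs] := jq.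
have [E' [j' [q' [k [jq' kj qk]]]]] := pushout_ses p jq.
have [s sK] := (splitsP _ _).1 CV _ _ _ jq'.
have [r rK] := (retraction_section jq').2 (ex_intro _ s sK).
pose rk : {linear E -> V} := r \o k.
have rkj x : rk (j x) = p x by rewrite /= kj rK.
have [n [nn nE]] := kernel_val rk.
have [|m mE] := factor_inj (h := j \o i) nn.
  by move=> u; apply/nE; rewrite -[RHS](ses0 u ip) -rkj.
have mn : short_exact m (q \o n).
  split=> [|z|c].
  - by move=> u v /(congr1 n); rewrite !mE => /jj/ii.
  - split=> [/(ses_lift jq)[x jx]|[u <-]]; last by rewrite /= mE /= (ses0 _ jq).
    have [|u iu] := ses_lift (v := x) ip.
      by rewrite -rkj jx; apply/nE; exists z.
    by exists u; apply: nn; rewrite mE /= iu.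
  - have [z zE] := qs c; have [x xE] := ps (rk z).
    have /nE[w wE] : rk (z - j x) = 0.
      by apply/raddf_eqP; apply: etrans (esym xE) (esym (rkj x)).
    by exists w; rewrite /= wE raddfB /= zE (ses0 _ jq) subr0.
have [t tK] := (splitsP _ _).1 CU _ _ _ mn.
by exists (n \o t) => c; apply: tK.
Qed.

(** The quotient E / U is an extension of [C2] by [C1]. This lets successive embeddings be composed
    while the cokernel keeps its orthogonality. *)
Lemma ses_filtered U V E C1 C2 (i : {linear U -> V}) (p : {linear V -> C1})
    (j : {linear V -> E}) (q : {linear E -> C2}) :
  short_exact i p -> short_exact j q ->
  exists (C : lmodType R) (p' : {linear E -> C}),
    short_exact (j \o i) p' /\ forall X, splits C1 X -> splits C2 X -> splits C X.
Proof.
move=> ip jq; have [ii e ps] := ip; have [jj eq qs] := jq.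
pose k : {linear U -> E} := j \o i.
have [|f fE] := factor_surj (h := coker_pi k \o j) ps.
  by move=> v /e[u <-]; apply/coker_pi_eq0; exists u.
have [|g gE] := factor_surj (h := q) (@coker_pi_surj _ _ k).
  by move=> _ /coker_pi_eq0[u <-]; rewrite /= (ses0 _ jq).
have fg : short_exact f g.
  split=> [|c|c].
  - apply: linear_inj => c; have [v <-] := ps c; rewrite fE.
    by move=> /coker_pi_eq0[u /jj <-]; rewrite (ses0 _ ip).
  - have [z <-] := @coker_pi_surj _ _ k c; rewrite gE; split.
      by move=> /eq[v <-]; exists (p v); rewrite fE.
    move=> [c1 cz]; have -> : q z = g (coker_pi k z) by rewrite gE.
    by have [v vc] := ps c1; rewrite -cz -vc fE /= gE (ses0 _ jq).
  - by have [z <-] := qs c; exists (coker_pi k z); rewrite gE.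
exists (cokernel k), (coker_pi k); split; last by move=> X; apply: splits_extl fg.
by apply: cokernel_ses; apply: inj_comp jj ii.
Qed.

(** Five lemma, with the identity on [W]. *)
Lemma ses_five (U U' V V' W : lmodType R) (i : {linear U -> V}) (p : {linear V -> W})
    (i' : {linear U' -> V'}) (p' : {linear V' -> W}) (f : {linear U -> U'})
    (k : {linear V -> V'}) :
  short_exact i p -> short_exact i' p' -> injective f -> surjective f ->
  (forall u, k (i u) = i' (f u)) -> (forall v, p' (k v) = p v) ->
  injective k /\ surjective k.
Proof.
move=> ip ip' fi fs ki pk; split=> [|v'].
- apply: linear_inj => v kv.
  have [|u uv] := ses_lift (v := v) ip; first by rewrite -pk kv raddf0.
  rewrite -uv; suff -> : u = 0 by rewrite raddf0.
  apply: (raddf_inj_eq0 fi); have [ii _ _] := ip'; apply: (raddf_inj_eq0 ii).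
  by rewrite -ki uv.
- have [_ _ ps] := ip; have [v vE] := ps (p' v').
  have [|u' u'E] := ses_lift (v := v' - k v) ip';
    first by rewrite raddfB /= pk vE subrr.
  have [u uE] := fs u'; exists (v + i u).
  by rewrite raddfD /= ki uE u'E addrC subrK.
Qed.

(** The pushout [E] of [P] and [D] over [K] contains both, with E / D = P / K and E / P = D / K.
    This is the square of Salce's trick. *)
Lemma double_pushout_ses (K P Z D C : lmodType R) (i : {linear K ->
    P}) (p : {linear P -> Z})
    (j : {linear K -> D}) (r : {linear D -> C}) :
  short_exact i p -> short_exact j r ->
  exists (E : lmodType R) (i' : {linear D -> E}) (p' : {linear E -> Z})
    (j' : {linear P -> E}) (r' : {linear E -> C}),
  short_exact i' p' /\ short_exact j' r'.
Proof.
move=> ip jr; have [E [i' [p' [k [ip' ki pk]]]]] := pushout_ses j ip.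
have [ii e ps] := ip; have [jj er rs] := jr; have [ii' e' ps'] := ip'.
(* [E] is a quotient of [P * D] by [c], so [r'] can be defined by factoring ([x], [d]) |-> [r d]
   through [c]. *)
have [c cE] := copair_linear k i'.
have [z zE] := copair_linear (\0 : {linear P -> C}) r.
have cs : surjective c.
  move=> v; have [x xE] := ps (p' v).
  have [|d dE] := ses_lift (v := v - k x) ip'; first by rewrite raddfB /= pk xE subrr.
  by exists (x, d); rewrite cE /= dE addrC subrK.
have [|r' r'E] := factor_surj (h := z) cs.
  move=> [x d]; rewrite cE zE /= add0r => xd.
  have [|u uE] := ses_lift (v := x) ip.
    by rewrite -pk -(addrK (i' d) (k x)) xd sub0r raddfN /= (ses0 _ ip') oppr0.
  have -> : d = - j u.
    apply: ii'; rewrite raddfN /= -ki uE; apply/eqP.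
    by rewrite -addr_eq0 addrC xd.
  by rewrite raddfN /= (ses0 _ jr) oppr0.
exists E, i', p', k, r'; split=> //; split=> [|v|w].
- apply: linear_inj => x kx; have [|u uE] := ses_lift (v := x) ip.
    by rewrite -pk kx raddf0.
  rewrite -uE; suff -> : u = 0 by rewrite raddf0.
  by apply: (raddf_inj_eq0 jj); apply: (raddf_inj_eq0 ii'); rewrite -ki uE.
- have [[x d] <-] := cs v; rewrite r'E zE cE /= add0r; split.
    by move=> /er[u <-]; exists (x + i u); rewrite raddfD /= ki.
  move=> [y yE]; have : r' (k y) = r' (c (x, d)) by rewrite cE yE.
  have -> : k y = c (y, 0) by rewrite cE /= raddf0 addr0.
  by rewrite !r'E !zE /= !add0r raddf0.
- by have [d <-] := rs w; exists (i' d); rewrite -[i' d]add0r -[0](raddf0 k) -(cE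
    (0, d)) r'E zE /= add0r.
Qed.

Lemma ses_iso3 (U V W U' V' W' : lmodType R) (i : {linear U -> V}) (p : {linear V -> W})
    (u : {linear U' -> U}) (u' : {linear U -> U'}) (v : {linear V -> V'})
    (v' : {linear V' -> V}) (w : {linear W -> W'}) (w' : {linear W' -> W}) :
  cancel u u' -> cancel u' u -> cancel v v' -> cancel v' v -> cancel w w' ->
  cancel w' w -> short_exact i p -> short_exact (v \o i \o u) (w \o p \o v').
Proof.
move=> uK u'K vK v'K wK w'K ip; have [ii e ps] := ip; split=> [|y|z].
- exact: inj_comp (inj_comp (can_inj vK) ii) (can_inj uK).
- split=> [/(raddf_inj_eq0 (can_inj wK))/e[x xE]|[x <-]] /=.
    by exists (u' x); rewrite /= u'K xE v'K.
  by rewrite vK (ses0 _ ip) raddf0.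
- by have [y yE] := ps (w' z); exists (v y); rewrite /= vK yE w'K.
Qed.
End LinearMaps.
Arguments mklin_fun R U V f _ x /.
Arguments mklin R U V f lf /.

(** * Tensor products and free modules *)

Section TensorMaps.
Variables (S R : pzRingType) (M : bimodType S R).
Implicit Types X Y U V W : lmodType R.

Lemma tens_ext X (Z : lmodType S) (f g : {linear tensor M X -> Z}) :
  (forall m x, f (tens m x) = g (tens m x)) -> f =1 g.
Proof. by apply: tensor_eq; apply: raddfB. Qed.

Lemma tensor_lift_linear X (Z : lmodType S) (b : M -> X -> Z) :
  balanced b -> (forall a m x, b (a *: m) x = a *: b m x) ->
  linear (tensor_lift b).
Proof.
move=> bb bZ; pose l : tensor M X -> Z := tensor_lift b; rewrite -/l.
have lB : zmod_morphism l := tensor_lift_is_zmod_morphism bb.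
have lD u v : l (u + v) = l u + l v.
  have l0 : l 0 = 0 by rewrite -[X in l X](subrr 0) lB subrr.
  by rewrite -{1}[v]opprK -[- v]sub0r !lB l0 sub0r opprK.
move=> a u v; rewrite lD; congr (_ + _); move: u.
apply: tensor_eq => [u w|u w|m x]; first by rewrite scalerBr lB.
  by rewrite lB scalerBr.
have lE m' x' : l (tens m' x') = b m' x' := tensor_liftE bb m' x'.
by rewrite tensZ !lE bZ.
Qed.

Definition tlin X (Z : lmodType S) (b : M -> X -> Z) (bb : balanced b)
    (bZ : forall a m x, b (a *: m) x = a *: b m x) : {linear tensor M X -> Z} :=
  mklin (tensor_lift_linear bb bZ).

Lemma tlinE X (Z : lmodType S) (b : M -> X -> Z) bb bZ m x :
  tlin (b := b) bb bZ (tens m x) = b m x.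
Proof. exact: (tensor_liftE bb). Qed.

Fact tensor_map_linear X Y (h : {linear X -> Y}) : linear (tensor_map M h).
Proof.
apply: tensor_lift_linear => [|a m x]; first exact: tensor_map_balanced.
by rewrite tensZ.
Qed.
Definition tmap X Y (h : {linear X -> Y}) : {linear tensor M X -> tensor M Y} :=
  mklin (tensor_map_linear h).

Lemma tmapE X Y (h : {linear X -> Y}) m x : tmap h (tens m x) = tens m (h x).
Proof. exact: tensor_mapE. Qed.

Lemma tmap_comp U V W (f : {linear U -> V}) (g : {linear V -> W})
    (h : {linear U -> W}) t :
  (forall x, g (f x) = h x) -> tmap g (tmap f t) = tmap h t.
Proof.
move=> gf; apply: (tens_ext (f := tmap g \o tmap f) (g := tmap h)) t => m x.
by rewrite -[LHS]/(tmap g (tmap f (tens m x))) !tmapE gf.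
Qed.

Lemma tmap_eq U V (f g : {linear U -> V}) t : f =1 g -> tmap f t = tmap g t.
Proof.
move=> fg; apply: (tens_ext (f := tmap f) (g := tmap g)) t => m x.
by rewrite !tmapE fg.
Qed.

Lemma tmap_id U (f : {linear U -> U}) t : (forall x, f x = x) -> tmap f t = t.
Proof.
move=> fE; suff: tmap f =1 idfun by [].
apply: (tens_ext (g := idfun)) => m x.
by rewrite [LHS]tmapE fE.
Qed.

Lemma tmap0 U V (f : {linear U -> V}) t : (forall x, f x = 0) -> tmap f t = 0.
Proof.
move=> fE; suff: tmap f =1 \0 by [].
apply: (tens_ext (g := \0)) => m x.
by rewrite [LHS]tmapE fE tens0r.
Qed.

Lemma tmapD U V (f g h : {linear U -> V}) t : (forall x, f x = g x + h x) ->
  tmap f t = tmap g t + tmap h t.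
Proof.
move=> fE; apply: (tens_ext (f := tmap f) (g := tmap g \+ tmap h)) t => m x.
by rewrite -[RHS]/(tmap g (tens m x) + tmap h (tens m x)) !tmapE fE tensDr.
Qed.

Lemma tmap_surj V W (p : {linear V -> W}) : surjective p -> surjective (tmap p).
Proof.
move=> ps; elim/tensor_ind => [|_ _ [s <-] [t <-]|m w].
- by exists 0; rewrite raddf0.
- by exists (s - t); rewrite raddfB.
- by have [v <-] := ps w; exists (tens m v); rewrite tmapE.
Qed.

(** The map Coker(M (x) i) -> M (x) W has a left inverse: m (x) w goes to the class of m (x) v for
    any [v] over [w]. Exactness makes this independent of [v], hence balanced. *)
Lemma tmap_exact U V W (i : {linear U -> V}) (p : {linear V -> W}) :
  exact_at i p -> surjective p -> exact_at (tmap i) (tmap p).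
Proof.
move=> e ps t; split=> [pt|[s <-]]; last first.
  rewrite (tmap_comp (h := \0)) ?tmap0 // => x /=; apply/e; by exists x.
have [l lK] := choice ps.
pose b m w := coker_pi (tmap i) (tens m (l w)).
have bE m v w : p v = w -> b m w = coker_pi (tmap i) (tens m v).
  move=> pv; apply/coker_pi_eq; have [u iu] : exists u, i u = l w - v.
    by apply/e; rewrite raddfB /= lK pv subrr.
  exists (tens m u); rewrite tmapE iu; apply/eqP; rewrite eq_sym subr_eq.
  by rewrite -tensDr subrK.
have bb : balanced b.
  split=> [m m' w|m w w'|m r w]; rewrite /b.
  - by rewrite tensDl coker_piD.
  - by rewrite -coker_piD -tensDr; apply: bE; rewrite raddfD /= !lK.
  - by rewrite tensM; apply/esym/bE; rewrite linearZ_LR /= lK.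
have bZ a m w : b (a *: m) w = a *: b m w by rewrite /b -tensZ linearZ_LR.
have : tlin bb bZ (tmap p t) = coker_pi (tmap i) t.
  move: t {pt}; apply: (tens_ext (f := tlin bb bZ \o tmap p)) => m v.
  by rewrite -[LHS]/(tlin bb bZ (tmap p (tens m v))) tmapE tlinE; apply: bE.
by rewrite pt raddf0 => /esym/coker_pi_eq0.
Qed.
End TensorMaps.
Arguments tmap {S R} M {X Y} h : simpl never.
Arguments tlin {S R M X Z b} bb bZ : simpl never.
Arguments tmap_surj {S R} M {V W p} _ y.
Arguments tmap_exact {S R} M {U V W i p} _ _ y.

(* [x] is the sum of its components [c s x], only finitely many of which are
   nonzero. *)
Definition finitely_decomposed (S : eqType) (T : zmodType) (c : S -> T -> T) (x : T) :=
  exists l : seq S, forall l', uniq l' -> {subset l <= l'} -> x = \sum_(s <- l') c s x.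

(** Since every larger duplicate-free list is allowed, the lists for [x] and [y] can be joined by
    concatenation. *)
Lemma finitely_decomposedB (S : eqType) (T : zmodType) (c : S -> T -> T) x y :
  (forall s x y, c s (x - y) = c s x - c s y) ->
  finitely_decomposed c x -> finitely_decomposed c y -> finitely_decomposed c (x - y).
Proof.
move=> cB [l lP] [k kP]; exists (l ++ k) => l' ul' sl'.
rewrite (eq_bigr _ (fun s _ => cB s x y)) sumrB; apply: congr2.
- by apply: lP => // s sl; apply: sl'; rewrite mem_cat sl.
- by rewrite -kP // => s sk; apply: sl'; rewrite mem_cat sk orbT.
Qed.

(* [R] with its integer multiples as right action: the free [R]-module on a
   set [S] is [R (x)_Z Z[S]]. *)
Section FreeModule.
Variable R : pzRingType.

Definition zring : Type := R^o.
HB.instance Definition _ := GRing.Lmodule.on zring.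
Fact zring_rscalerA (v : zring) (a b : int) : v *~ a *~ b = v *~ (a * b).
Proof. by rewrite mulrzA. Qed.
Fact zring_rscaler1 (v : zring) : v *~ 1 = v.
Proof. by []. Qed.
Fact zring_rscalerDl (a : int) : {morph (fun v : zring => v *~ a) : u v / u + v}.
Proof. by move=> u v; rewrite mulrzDl. Qed.
Fact zring_rscalerDr (v : zring) : {morph (fun a : int => v *~ a) : a b / a + b}.
Proof. by move=> a b; rewrite mulrzDr. Qed.
HB.instance Definition _ := Zmodule_isRmodule.Build int zring
  zring_rscalerA zring_rscaler1 zring_rscalerDl zring_rscalerDr.
Fact zring_bimodA (a : R) (v : zring) (b : int) :
  rscale (a *: v : zring) b = a *: (rscale v b : zring).
Proof. by rewrite /rscale /= scalerMzr. Qed.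
HB.instance Definition _ := Lmodule_Rmodule_isBimodule.Build R int zring zring_bimodA.

Section FreeOn.
Variable S : choiceType.

Definition free_mod : lmodType R := tensor zring (zmodule {freeg S}).
Definition free_gen (s : S) : free_mod := tens (1 : zring) (<< s >> : zmodule
    {freeg S}).

Section Univ.
Variables (V : lmodType R) (u : S -> V).
Let g (z : zmodule {freeg S}) : V := fglift (u : S -> zmodule V) z.
Let gB : zmod_morphism g. Proof. exact: (@lift_is_additive _ _ (zmodule V) _). Qed.
Let ga : {additive zmodule {freeg S} -> V} :=
  HB.pack_for {additive zmodule {freeg S} -> V} g (GRing.isZmodMorphism.Build _ _ g gB).

Fact free_univ_balanced : balanced (fun (r : zring) z => (r : R) *: ga z).
Proof.
split=> [r r' z|r z z'|r n z].
- exact: scalerDl.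
- by rewrite raddfD scalerDr.
- have -> : ga (n *: z) = ga z *~ n by rewrite -raddfMz.
  by rewrite -scalerMzr scalerMzl.
Qed.

Lemma free_univ : exists h : {linear free_mod -> V}, forall s, h (free_gen s) = u s.
Proof.
have bZ (a : R) (r : zring) z : (a *: r : R) *: ga z = a *: ((r : R) *: ga z).
  by rewrite scalerA.
exists (tlin free_univ_balanced bZ) => s.
by rewrite /free_gen tlinE scale1r -[LHS]/(fglift _ _) liftU scale1r.
Qed.
End Univ.

Fact free_coord_balanced s : balanced (fun (r : zring) (z : zmodule {freeg S}) =>
  (r *~ coeff s z : R^o)).
Proof.
split=> [r r' z|r z z'|r n z].
- exact: mulrzDl.
- by rewrite raddfD mulrzDr.
- by rewrite -[rscale r n]/(r *~ n) -mulrzA -[n *: z]/(z *~ n) raddfMz mulrC mulrzz.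
Qed.

Definition free_coord s : {linear free_mod -> R^o} :=
  tlin (free_coord_balanced s) (fun a r z => scalerMzr _ _ _).

Lemma free_decomp x :
  finitely_decomposed (fun s x => (free_coord s x : R) *: free_gen s) x.
Proof.
elim/tensor_ind: x => [|x y lP kP|r z].
- by exists [::] => l' _ _; rewrite big1 // => s _; rewrite raddf0 scale0r.
- by apply: finitely_decomposedB => // s u v; rewrite raddfB scalerBl.
- exists (dom z) => l' ul' sl'.
  have zE : z = \sum_(s <- l') << s >> *~ coeff s z.
    apply/eqP/freeg_eqP => t; rewrite raddf_sum /=.
    have cE s : coeff t (<< s >> *~ coeff s z : {freeg S}) = (s == t)%:R * coeff s z.
      by rewrite raddfMz /= coeffU mul1r mulrzz.
    rewrite (eq_bigr _ (fun s _ => cE s)).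
    have [tl|tl] := boolP (t \in l').
      rewrite (bigD1_seq t) //= eqxx mul1r big1 ?addr0 // => s /negbTE->.
      by rewrite mul0r.
    rewrite coeff_outdom; last by apply: contra tl; apply: sl'.
    rewrite big_seq big1 // => s sl; case: eqP => [st|]; last by rewrite mul0r.
    by rewrite -st sl in tl.
  have tD (y y' : zmodule {freeg S}) : tens r (y + y') = tens r y + tens r y' :>
    free_mod.
    exact: tensDr.
  rewrite {1}zE (big_morph (fun y : zmodule {freeg S} => tens r y : free_mod) tD
    (tens0r _ _)).
  apply: eq_bigr => s _.
  have cE : free_coord s (tens r z) = r *~ coeff s z := tlinE _ _ _ _.
  rewrite cE.
  pose gs : zmodule {freeg S} := << s >>.
  have e1 := tensM (r : zring) (coeff s z) gs.
  have e2 := tensZ (r *~ coeff s z : R) (1 : zring) gs.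
  have e3 : (r *~ coeff s z : R) *: (1 : zring) = rscale r (coeff s z) :> zring.
    exact: mulr1.
  by rewrite e3 in e2; exact: etrans (esym e1) (esym e2).
Qed.

Lemma free_ext (V : lmodType R) (f g : {linear free_mod -> V}) :
  (forall s, f (free_gen s) = g (free_gen s)) -> f =1 g.
Proof.
move=> fg x; have [l lP] := free_decomp x.
rewrite (lP (undup l)) ?undup_uniq // => [|s]; last by rewrite mem_undup.
by rewrite !linear_sum; apply: eq_bigr => s _; rewrite !linearZ_LR fg.
Qed.

Lemma free_projective : projective free_mod.
Proof.
move=> U V p h ps; have [c cK] := choice ps.
have [k kE] := free_univ (fun s => c (h (free_gen s))).
by exists k; apply: free_ext => s /=; rewrite kE cK.
Qed.
End FreeOn.

Lemma free_cover (X : lmodType R) :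
  exists p : {linear free_mod X -> X}, surjective p.
Proof. by have [p pE] := free_univ (@id X); exists p => x; exists (free_gen x). Qed.

(** A state is a map packed with its source and target; [step] replaces it by a free cover of its
    kernel. The target of [st n.+1] is convertible to the source of [st n], so the maps of the
    states are the augmentation and the differentials. *)
Lemma free_resolution (X : lmodType R) : inhabited (proj_resolution X).
Proof.
pose cov (U : lmodType R) := sval (cid (free_cover U)).
have covP U : surjective (cov U) := svalP (cid (free_cover U)).
pose inc (U V : lmodType R) (f : {linear U -> V}) := sval (cid (kernel_val f)).
have incP (U V : lmodType R) (f : {linear U -> V}) := svalP (cid (kernel_val f)).
pose T := {U : lmodType R & {V : lmodType R & {linear U -> V}}}.
pose step (t : T) : T := let f := projT2 (projT2 t) in
  existT _ (free_mod (kernel f))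
    (existT (fun V : lmodType R => {linear free_mod (kernel f) -> V}) (projT1 t)
      (inc _ _ f \o cov (kernel f))).
pose st n := iter n step (existT _ (free_mod X)
  (existT (fun V : lmodType R => {linear free_mod X -> V}) X (cov X))).
have stE (t : T) : exact_at (projT2 (projT2 (step t))) (projT2 (projT2 t)).
  move=> y; have [_ ->] := incP _ _ (projT2 (projT2 t)); split=> [[k <-]|[z <-]].
    by have [z <-] := covP _ k; exists z.
  by exists (cov _ z).
constructor; apply: (@ProjResolution R X (fun n => projT1 (st n))
  (fun n => projT2 (projT2 (st n.+1))) (cov X)) => [[|n]|||n].
- exact: free_projective.
- exact: free_projective.
- exact: covP.
- exact: (stE (st 0)).
- exact: (stE (st n.+1)).
Qed.
End FreeModule.

(** * Ext and Tor *)

Section ExtTor.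
Variable R : pzRingType.
Implicit Types C X U V W : lmodType R.

(** A lift [l] of the augmentation to P_0 -> E restricts to a cocycle [h] on P_1; if [h] is [k]
    after d_0, then [l - i k] descends to a section on [C]. Conversely, a cocycle factors through
    the kernel of the augmentation; pushing Ker -> P_0 -> C out along it and retracting extends it
    to P_0. *)
Lemma Ext1P C X : Ext1_eq0 C X <-> splits C X.
Proof.
split=> [CX E i p ip|CX P h].
- have [P] := free_resolution C; have [ii e ps] := ip.
  have e0 : exact_at (res_d P 0%N) (res_aug P) := @res_exact0 _ _ P.
  have e1 : exact_at (res_d P 1%N) (res_d P 0%N) := @res_exact _ _ P 0%N.
  have as0 : surjective (res_aug P) := @res_aug_surj _ _ P.
  have [l lE] := @res_proj _ _ P 0%N _ _ p (res_aug P) ps.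
  have augd z : res_aug P (res_d P 0%N z) = 0 by apply/e0; exists z.
  have [|h hE] := factor_inj (h := l \o res_d P 0) ii.
    by move=> z; apply: (ses_lift ip); rewrite -[LHS]/((p \o l) (res_d P 0%N z)) lE.
  have /CX[k kh] : precomp (res_d P 1) (h : lhom _ X) = 0.
    apply: lhomP => z /=; apply: ii; rewrite raddf0 hE /=.
    by have /e1 -> : exists y, res_d P 1 y = res_d P 1 z; rewrite ?raddf0;
      first by exists z.
  have kE z : lhom_fun k (res_d P 0%N z) = h z by rewrite -kh.
  apply/(retraction_section ip).
  have lt : linear (fun x => l x - i (lhom_fun k x)).
    by move=> a u v; rewrite !linearP scalerDr addrACA.
  have [|s sE] := factor_surj (h := mklin lt) (as0).
    move=> x /e0[z <-]; rewrite -[LHS]/(l (res_d P 0%N z) - i (lhom_fun k _)).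
    by rewrite kE hE subrr.
  exists s => c; have [x <-] := as0 c.
  by rewrite sE /= raddfB /= (ses0 _ ip) subr0 -[RHS]lE.
- have e0 : exact_at (res_d P 0%N) (res_aug P) := @res_exact0 _ _ P.
  have e1 : exact_at (res_d P 1%N) (res_d P 0%N) := @res_exact _ _ P 0%N.
  have as0 : surjective (res_aug P) := @res_aug_surj _ _ P.
  split=> [hd|[k <-]]; last first.
    apply: lhomP => z /=.
    by have /e1 -> : exists y, res_d P 1 y = res_d P 1 z; rewrite ?raddf0;
      first by exists z.
  have hd0 z : lhom_fun h (res_d P 1 z) = 0.
    by rewrite -[LHS]/(lhom_fun (precomp (res_d P 1) h) z) hd.
  have [j [jj jE]] := kernel_val (res_aug P).
  have [|e eE] := factor_inj (h := res_d P 0) jj.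
    by move=> z; apply/jE/e0; exists z.
  have es : surjective e.
    move=> k; have /e0[z zE] : res_aug P (j k) = 0 by apply/jE; exists k.
    by exists z; apply: jj; rewrite eE.
  have [|g gE] := factor_surj (h := lhom_fun h) es.
    move=> z /(congr1 j); rewrite eE raddf0 => /e1[y <-]; exact: hd0.
  have jp : short_exact j (res_aug P).
    by split=> //; exact: as0.
  have [E [i' [p' [k [ip kj _]]]]] := pushout_ses g jp.
  have [r rK] := CX _ _ _ ip.
  exists (r \o k : {linear _ -> _}); apply: lhomP => z.
  by rewrite -[LHS]/(r (k (res_d P 0%N z))) -eE kj rK gE.
Qed.

Lemma projective_splits P X : projective P -> splits P X.
Proof.
move=> pP; apply/splitsP => E i p [_ _ ps].
by have [s sE] := pP _ _ p (idfun : {linear P -> P}) ps; exists s => x; apply: sE.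
Qed.

Lemma rperp_splits (C : mod_class R) X :
  rperp C X <-> forall U, C U -> splits U X.
Proof. by split=> CX U /CX/Ext1P. Qed.

Lemma lperp_splits (C : mod_class R) X :
  lperp C X <-> forall U, C U -> splits X U.
Proof. by split=> CX U /CX/Ext1P. Qed.

Section CotorsionPair.
Variables C D : mod_class R.
Hypothesis CD : cotorsion_pair C D.

Lemma cotorsionL X : C X <-> forall U, D U -> splits X U.
Proof. by rewrite -lperp_splits; apply: iff_sym; apply: CD.2. Qed.

Lemma cotorsionR X : D X <-> forall U, C U -> splits U X.
Proof. by rewrite -rperp_splits; apply: iff_sym; apply: CD.1. Qed.

Lemma cotorsion_isoL X Y : lmod_iso X Y -> C X -> C Y.
Proof.
move=> XY /cotorsionL CX; apply/cotorsionL => U /CX; apply: splits_iso => //.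
by exists idfun; exists id.
Qed.

Lemma cotorsion_isoR X Y : lmod_iso X Y -> D X -> D Y.
Proof.
move=> XY /cotorsionR CX; apply/cotorsionR => U /CX; apply: splits_iso => //.
by exists idfun; exists id.
Qed.
End CotorsionPair.

(** A section of the pullback along [h] is a lift of [h]. *)
Lemma splits_lift U V W X (i : {linear U -> V}) (p : {linear V -> W})
    (h : {linear X -> W}) : short_exact i p -> splits X U ->
  exists k : {linear X -> V}, forall x, p (k x) = h x.
Proof.
move=> ip XU; have [E [i' [p' [k [ip' _ pk]]]]] := pullback_ses h ip.
have [s sK] := (splitsP _ _).1 XU _ _ _ ip'.
by exists (k \o s) => x /=; rewrite pk sK.
Qed.

End ExtTor.

(** Let K = Ker(P_0 -> W). Vanishing of Tor_1 makes M (x) K -> M (x) P_0 injective, which is [tj].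
    An element of M (x) U that vanishes in M (x) V comes from M (x) K by exactness of K -> P_0 + U
    -> V, with zero image in M (x) P_0; so it is zero. *)
Lemma Tor1_tmap_inj (S R : pzRingType) (M : bimodType S R) (U V W : lmodType R)
    (i : {linear U -> V}) (p : {linear V -> W}) :
  Tor1_eq0 M W -> short_exact i p -> injective (tmap M i).
Proof.
move=> tor ip; have [ii e ps] := ip; have [P] := free_resolution W.
have e0 : exact_at (res_d P 0%N) (res_aug P) := @res_exact0 _ _ P.
have e1 : exact_at (res_d P 1%N) (res_d P 0%N) := @res_exact _ _ P 0%N.
have as0 : surjective (res_aug P) := @res_aug_surj _ _ P.
have augd z : res_aug P (res_d P 0%N z) = 0 by apply/e0; exists z.
have [j [jj jE]] := kernel_val (res_aug P).
have [|d dE] := factor_inj (h := res_d P 0) jj; first by move=> z; apply/jE.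
have ds : surjective d.
  move=> k; have /e0[z zE] : res_aug P (j k) = 0 by apply/jE; exists k.
  by exists z; apply: jj; rewrite dE.
have tj : forall t, tmap M j t = 0 -> t = 0.
  move=> t; have [t1 <-] := tmap_surj M ds t; rewrite (tmap_comp _ dE).
  move=> /(tor P)[t2 <-].
  rewrite -[tensor_map _ _ t2]/(tmap M (res_d P 1) t2).
  rewrite (tmap_comp (h := \0)) ?tmap0 // => y /=; apply: jj; rewrite dE raddf0.
  by apply/e1; exists y.
have [l lE] := @res_proj _ _ P 0%N _ _ p (res_aug P) ps.
have [|m mE] := factor_inj (h := l \o j) ii.
  move=> k; apply: (ses_lift ip); rewrite -[LHS]/((p \o l) (j k)) lE.
  by apply/jE; exists k.
(* [m : K -> U] is induced by the lift [l : P_0 -> V]. The maps [a] and [b] present [V] as the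
   pushout of [j] and [m], and [c] is the inclusion of [U]. *)
have [a aE] := pair_linear j (\- m).
have [b bE] := copair_linear l i.
have [c cE] := pair_linear (\0 : {linear U -> P 0}) (idfun : {linear U -> U}).
have lf : linear (fst : P 0 * U -> P 0) by [].
have ls : linear (snd : P 0 * U -> U) by [].
have ab : exact_at a b.
  move=> [x u]; rewrite bE; split=> [/= xu|[k <-]]; last first.
    by rewrite aE /= raddfN /= mE subrr.
  have /jE[k kE] : res_aug P x = 0.
    by rewrite -[LHS]lE /= -(addrK (i u) (l x)) xu sub0r raddfN /= (ses0 _ ip) oppr0.
  exists k; rewrite aE kE; congr pair; apply: ii; rewrite /= raddfN /= mE /= kE.
  by apply/eqP; rewrite eq_sym -addr_eq0 addrC xu.
have bs : surjective b.
  move=> v; have [x xE] := as0 (p v).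
  have [|u uE] := ses_lift (v := v - l x) ip.
    by rewrite raddfB /= (lE x : p (l x) = _) xE subrr.
  by exists (x, u); rewrite bE /= uE addrC subrK.
apply: linear_inj => t it.
have /(tmap_exact M ab bs)[s sE] : tmap M b (tmap M c t) = 0.
  by rewrite (tmap_comp (h := i)) // => u; rewrite bE cE /= raddf0 add0r.
have s0 : s = 0.
  apply: tj; rewrite -(tmap_comp (f := a) (g := mklin lf)); last by move=> k;
    rewrite /= aE.
  rewrite sE (tmap_comp (h := \0)) ?tmap0 // => u; by rewrite /= cE.
rewrite -(tmap_id t (f := idfun)) // -(tmap_comp (f := c) (g := mklin ls)).
  by rewrite -sE s0 !raddf0.
by move=> u; rewrite /= cE.
Qed.

(** * Injective cogenerators *)

(** [n] is the least positive element, or 0 if there is none. Allowing 0 treats elements of infinite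
    order like torsion elements later on. *)
Lemma int_subgroup (P : int -> Prop) :
  P 0 -> (forall a b, P a -> P b -> P (a - b)) ->
  exists n : nat, forall k, P k <-> (n%:Z %| k)%Z.
Proof.
move=> P0 PB; have PN a : P a -> P (- a) by rewrite -sub0r; apply: PB.
have PD a b : P a -> P b -> P (a + b) by move=> Pa /PN Pb; rewrite -[b]opprK; apply: PB.
have PMn a (n : nat) : P a -> P (a *+ n).
  by move=> Pa; elim: n => [|n IHn]; rewrite ?mulr0n // mulrS; apply: PD.
have PM a k : P a -> P (k * a).
  move=> Pa; case: k => n; first by rewrite mulrC -mulrzz -pmulrn; apply: PMn.
  by rewrite NegzE mulNr mulrC -mulrzz -pmulrn; apply/PN/PMn.
have [[m m0 Pm]|noP] := pselect (exists2 m : nat, (0 < m)%N & P m%:Z); last first.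
  exists 0%N => k; rewrite dvd0z; split=> [Pk|/eqP -> //]; apply/eqP.
  have Pk' : P `|k|%N%:Z.
    by case: k Pk => n // /PN; rewrite NegzE opprK.
  apply/eqP; rewrite -absz_eq0; case E : `|k|%N => [//|n]; case: noP.
  by exists n.+1 => //; rewrite -E.
have ex : exists m : nat, (0 < m)%N && `[< P m%:Z >].
  by exists m; rewrite m0; apply/asboolP.
case: (ex_minnP ex) => n /andP[n0 /asboolP Pn] nmin; exists n => k.
split=> [Pk|/dvdzP[q ->]]; last exact: PM.
have Pr : P (k %% n%:Z)%Z.
  have -> : (k %% n%:Z)%Z = k - (k %/ n%:Z)%Z * n%:Z.
    by rewrite {2}(divz_eq k n%:Z) addrC addKr.
  exact: PB Pk (PM _ _ Pn).
have r0 : 0 <= (k %% n%:Z)%Z by apply: modz_ge0; rewrite -lt0n.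
have rn : (k %% n%:Z)%Z < n%:Z by apply: ltz_pmod.
apply/dvdz_mod0P; case: (k %% n%:Z)%Z Pr r0 rn => // r Pr _ rn.
case: r Pr rn => // r Pr rn; have := nmin r.+1; rewrite (introT (asboolP _) Pr).
by move=> /(_ isT); rewrite leqNgt -ltz_nat rn.
Qed.

Section ExtendAdditive.
Variables H Q : zmodType.

(** The graph of an additive map on a subgroup of [H]. Uniqueness of values is asked at 0 only,
    which suffices by subtraction. The empty relation qualifies too. *)
Definition partial_additive (S : H * Q -> Prop) :=
  (forall u v, S u -> S v -> S (u - v)) /\ (forall y, S (0, y) -> y = 0).

Hypothesis divQ : forall (n : nat) (y : Q), (0 < n)%N -> exists z, z *+ n = y.

(** Baer's argument: the [k] with [e *~ k] in the domain are the multiples of some [n]. If [y] is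
    the value at [e *~ n], any [z] with [z *~ n = y] is an admissible value at [e]. *)
Lemma partial_additive_extend (S : H * Q -> Prop) e : partial_additive S -> S 0 ->
  exists S' : H * Q -> Prop,
    [/\ partial_additive S', forall u, S u -> S' u & exists y, S' (e, y)].
Proof.
move=> [SB Sf] S0.
have [|a b [y Sy] [z Sz]|n nP] := int_subgroup (P := fun k => exists y, S (e *~ k, y)).
- by exists 0; rewrite mulr0z.
- by exists (y - z); rewrite mulrzBr; apply: (SB (_, _) (_, _)).
have [y Sy] : exists y, S (e *~ n, y) by apply/nP.
(* For [n] = 0 divisibility says nothing, but then [y] = 0. *)
have [z zy] : exists z, z *~ n = y.
  case: n Sy {nP} => [Sy|n _]; last exact: (@divQ n.+1).
  by exists 0; rewrite mulr0z (Sf y).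
exists (fun u => exists k s, S s /\ u = s + (e *~ k, z *~ k)); split.
- split=> [_ _ [k [s [Ss ->]]] [l [t [St ->]]]|y' [k [[s1 s2] [Ss [sk ->]]]]].
    exists (k - l), (s - t); split; first exact: SB.
    by rewrite !mulrzBr opprD addrACA.
  have s1E : s1 = - (e *~ k) by apply/eqP; rewrite -addr_eq0 -sk.
  have Sk : S (e *~ k, - s2).
    by rewrite -[e *~ k]opprK -s1E -[(_, _)]/(- (s1, s2)) -sub0r; apply: SB.
  have /nP nk : exists y, S (e *~ k, y) by exists (- s2).
  (* These [k] form a subgroup that contains [n], hence every multiple of [n]. *)
  have [|a b Sa Sb|m mP] := int_subgroup (P := fun k => S (e *~ k, z *~ k)).
  - by rewrite !mulr0z.
  - by rewrite !mulrzBr; apply: (SB (_, _) (_, _)).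
  have /mP mn : S (e *~ n, z *~ n) by rewrite zy.
  have Sj : S (e *~ k, z *~ k) by apply/mP/(dvdz_trans mn).
  have := SB _ _ Sj Sk; rewrite -[_ - _]/(_ - _, _ - _) subrr opprK => /Sf.
  by rewrite addrC.
- by move=> u Su; exists 0, u; rewrite !mulr0z addr0.
- by exists z, 1, 0; rewrite add0r.
Qed.

Import classical_sets.
Local Open Scope classical_set_scope.

Lemma additive_extension (S : H * Q -> Prop) : partial_additive S -> S 0 ->
  exists chi : {additive H -> Q}, forall x y, S (x, y) -> chi x = y.
Proof.
move=> pS S0.
(* The union of the empty chain is empty and must satisfy [P], so containing [S] is asked of
   nonempty [A] only. *)
pose P (A : set (H * Q)) := partial_additive A /\ (forall u, A u -> S `<=` A).
have [|A [[pA AS] Amax]] := @Zorn_bigcup _ P.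
  move=> F FP Ftot; split; [split|].
  - move=> u v [A FA Au] [B FB Bv].
    have [AB|BA] := Ftot _ _ FA FB.
      by exists B => //; have [[BB _] _] := FP _ FB; apply: BB => //; apply: AB.
    by exists A => //; have [[AA _] _] := FP _ FA; apply: AA => //; apply: BA.
  - by move=> y [A FA Ay]; have [[_ Af] _] := FP _ FA; apply: Af.
  - by move=> u [A FA Au] v Sv; exists A => //; have [_ AS] := FP _ FA;
      exact: AS Au _ Sv.
(* If [A] were empty, then [S], which is nonempty, would be strictly larger and satisfy [P]. *)
have [u Au] : exists u, A u.
  have [//|noA] := pselect (exists u, A u); exfalso.
  apply: (Amax S); last by split=> // u _ v.
  by split=> [u Au|SA]; case: noA; [exists u|exists 0; apply: SA].
have {u Au}SA := AS _ Au; have A0 := SA _ S0.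
have tot x : exists y, A (x, y).
  have [S' [pS' AS' [y S'y]]] := partial_additive_extend x pA A0.
  have [|nS'A] := pselect (S' `<=` A); first by move=> /(_ _ S'y); exists y.
  exfalso; apply: (Amax S'); first by split.
  by split=> // _ _ v /SA/AS'.
have [f fA] := choice tot.
have fE x y : A (x, y) -> f x = y.
  move=> Axy; have := pA.1 _ _ (fA x) Axy; rewrite -[_ - _]/(_ - _, _ - _) subrr.
  by move/pA.2/eqP; rewrite subr_eq0 => /eqP.
have fB : zmod_morphism f by move=> x y; apply: fE; exact: pA.1 _ _ (fA x) (fA y).
exists (HB.pack_for {additive H -> Q} f (GRing.isZmodMorphism.Build _ _ f fB)).
by move=> x y Sxy; apply/fE/SA.
Qed.
End ExtendAdditive.

Section RationalsModIntegers.

Definition rat_int : {pred rat} := fun q => `[< exists k : int, k%:~R = q >].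
Fact rat_int_zmod_closed : zmod_closed rat_int.
Proof.
split=> [|_ _ /asboolP[k <-] /asboolP[l <-]]; apply/asboolP; first by exists 0.
by exists (k - l); rewrite rmorphB.
Qed.
HB.instance Definition _ := GRing.isZmodClosed.Build rat rat_int rat_int_zmod_closed.

Definition ratZ : zmodType := Quotient.quot rat_int.

Lemma ratZ_divisible (n : nat) (y : ratZ) : (0 < n)%N -> exists z, z *+ n = y.
Proof.
move=> n0; exists (\pi_(Quotient.quot rat_int) (repr y / n%:R))%qT.
rewrite -raddfMn /= -[RHS]reprK; congr (\pi_ _ _)%qT.
by rewrite -[LHS]mulr_natr divfK // pnatr_eq0 -lt0n.
Qed.

Lemma ratZ_torsion (n : nat) : n != 1%N -> exists2 z : ratZ, z != 0 & z *+ n = 0.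
Proof.
(* The element is the class of 1/m. For [n] = 0 every class is killed by [n], and 1/2 is a nonzero
   one. *)
move=> n1; pose m := if n is 0 then 2%N else n.
have m2 : (1 < m)%N by rewrite /m; case: (n) n1 => // -[].
exists (\pi_(Quotient.quot rat_int) (m%:R^-1))%qT.
  apply/eqP => /quot0P/asboolP[k /(congr1 (fun x => x * m%:R))].
  rewrite mulVf ?pnatr_eq0 -?lt0n ?(ltnW m2) // => /eqP.
  rewrite -[m%:R]/(m%:Z%:~R : rat) -rmorphM -[1]/(1%:~R) eqr_int => /eqP km.
  have : (m%:Z %| 1)%Z by apply/dvdzP; exists k.
  by rewrite dvdz1 /=; case: (m) m2 => [|[]].
move: m2 => _; rewrite {}/m; case: n {n1} => [|n]; first by rewrite mulr0n.
rewrite -raddfMn /= -[_ *+ _.+1]mulr_natr mulVf ?pnatr_eq0 //.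
by apply/quot0P/asboolP; exists 1.
Qed.
End RationalsModIntegers.

Section CharacterModule.
Variable R : pzRingType.

(** [R] as a left module over the integers and a right [R]-module, so that [lhom] out of it to Q/Z
    is Hom_Z(R, Q/Z) with its left [R]-action. *)
Definition zreg : Type := zmodule R^o.
HB.instance Definition _ := GRing.Lmodule.on zreg.
HB.instance Definition _ := Zmodule_isRmodule.Build R zreg
  (@regular_rscalerA R) (@mulr1 R)
  (fun a u v => @mulrDl R u v a) (fun v a b => @mulrDr R v a b).
Fact zreg_bimodA (n : int) (v : zreg) (b : R) :
  rscale (n *: v : zreg) b = n *: (rscale v b : zreg).
Proof. exact: mulrzAl. Qed.
HB.instance Definition _ := Lmodule_Rmodule_isBimodule.Build int R zreg zreg_bimodA.

Definition char_mod : lmodType R := lhom zreg (zmodule ratZ).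

(** One half of the adjunction Hom_R(E, Hom_Z(R, Q/Z)) = Hom_Z(E, Q/Z). *)
Lemma char_mod_adj (E : lmodType R) (chi : {additive E -> ratZ}) :
  exists h : {linear E -> char_mod},
    forall e (v : R), lhom_fun (h e) v = chi (v *: e).
Proof.
have lc e : linear (fun v : zreg => chi ((v : R) *: e) : zmodule ratZ).
  move=> n u v.
  have -> : ((n *: u + v : zreg) : R) *: e = (u : R) *: e *~ n + (v : R) *: e.
    by rewrite scalerMzl; apply: scalerDl.
  by rewrite raddfD raddfMz.
pose h e : char_mod := (mklin (lc e) : lhom zreg (zmodule ratZ)).
have lh : linear h.
  move=> a e f; apply: lhomP => v.
  rewrite -[LHS]/(chi ((v : R) *: (a *: e + f))) scalerDr scalerA.
  exact: raddfD.
by exists (mklin lh).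
Qed.

(** The retraction is adjoint to an additive extension to [E] of [i d] |-> [d 1], which exists
    because Q/Z is divisible. *)
Lemma char_mod_injective (C : lmodType R) : splits C char_mod.
Proof.
move=> E i p [ii _ _].
pose S (u : E * ratZ) := exists d : char_mod, u = (i d, lhom_fun d (1 : R)).
have [||chi chiE] := @additive_extension E ratZ ratZ_divisible S.
- split=> [_ _ [d ->] [d' ->]|y [d [i0 ->]]].
    by exists (d - d'); rewrite raddfB.
  by rewrite (raddf_inj_eq0 ii (esym i0)).
- by exists 0; rewrite raddf0.
have [h hE] := char_mod_adj chi; exists h => d; apply: lhomP => v.
rewrite hE; apply: chiE; exists (v *: d); rewrite linearZ_LR; congr pair.
by rewrite /= /lhom_scale_fun -[rscale _ _]/(1 * v) mul1r.
Qed.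

Lemma char_mod_cogenerates (L : lmodType R) (l : L) : l != 0 ->
  exists h : {linear L -> char_mod}, h l != 0.
Proof.
move=> l0.
have [|a b la lb|n nP] := int_subgroup (P := fun k => l *~ k = 0).
- exact: mulr0z.
- by rewrite mulrzBr la lb subrr.
(* [n] is the order of [l], or 0 if that is infinite, and is not 1 because [l] is nonzero. So [l]
   |-> [z] is well defined on the subgroup generated by [l]. *)
have [|z z0 zn] := @ratZ_torsion n.
  by apply: contra_neq l0 => n1; apply/(nP 1); rewrite n1.
pose S (u : L * ratZ) := exists k, u = (l *~ k, z *~ k).
have [||chi chiE] := @additive_extension L ratZ ratZ_divisible S.
- split=> [_ _ [k ->] [k' ->]|y [k [/esym/nP/dvdzP[j ->] ->]]].
    by exists (k - k'); rewrite !mulrzBr.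
  by rewrite mulrC mulrzA -pmulrn zn mul0rz.
- by exists 0; rewrite !mulr0z.
have [h hE] := char_mod_adj chi; exists h; apply: contra_neq z0 => hl.
have <- : chi l = z by apply: chiE; exists 1.
by rewrite -[l]scale1r -hE hl.
Qed.
End CharacterModule.

(** * Modules over a quotient ring *)

Section QuotientRingModules.
Variables (R : pzRingType) (I : ideal2 R).
Local Notation Rq := (ring_quot I).
Local Notation bim := (quot_bimod I).
Implicit Types L E : lmodType R.

Definition killed L := forall a (x : L), a \in (I : {pred R}) -> a *: x = 0.

(** Restriction of scalars along [ring_pi]. Together with [bar] it identifies modules over R / I
    with [R]-modules killed by [I]. *)
Definition restr (U : lmodType Rq) : Type := U.
HB.instance Definition _ (U : lmodType Rq) := GRing.Zmodule.on (restr U).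
Section Restr.
Variable U : lmodType Rq.
Definition restr_scale (a : R) (x : restr U) : restr U := ring_pi I a *: (x : U).
Fact restr_scaleA a b x : restr_scale a (restr_scale b x) = restr_scale (a * b) x.
Proof. by rewrite /restr_scale scalerA -ring_piM. Qed.
Fact restr_scale1 : left_id 1 restr_scale.
Proof. by move=> x; apply: (scale1r (x : U)). Qed.
Fact restr_scaleDr : right_distributive restr_scale +%R.
Proof. by move=> a x y; apply: (scalerDr _ (x : U)). Qed.
Fact restr_scaleDl x : {morph restr_scale^~ x : a b / a + b}.
Proof. by move=> a b; rewrite /restr_scale ring_piD; apply: (scalerDl (x : U)). Qed.
HB.instance Definition _ := GRing.Zmodule_isLmodule.Build R (restr U)
  restr_scaleA restr_scale1 restr_scaleDr restr_scaleDl.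

Lemma restrZ a (x : restr U) : a *: x = ring_pi I a *: (x : U).
Proof. by []. Qed.

Lemma restr_killed : killed (restr U).
Proof.
move=> a x aI; rewrite restrZ; have -> : ring_pi I a = 0 by apply/quot0P.
exact: (@scale0r _ U x).
Qed.
End Restr.

Lemma restr_linear (U V : lmodType Rq) (f : {linear U -> V}) :
  linear (f : restr U -> restr V).
Proof. by move=> a x y; rewrite restrZ -linearP. Qed.

Definition res_map (U V : lmodType Rq) (f : {linear U -> V}) :
  {linear restr U -> restr V} := mklin (restr_linear f).

Lemma restr_full (U V : lmodType Rq) (f : {linear restr U -> restr V}) :
  exists g : {linear U -> V}, forall x, g x = f x.
Proof.
have lf : linear (f : U -> V).
  move=> q x y; rewrite -(ring_piK q).
  exact: (linearP f (repr q) x y).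
by exists (mklin lf).
Qed.

Definition bar L : lmodType Rq := tensor bim L.

Lemma pi_tens L a (x : L) :
  tens (ring_pi I a : bim) x = tens (1 : bim) (a *: x).
Proof.
rewrite -tensM; congr tens.
by rewrite -[RHS]/(1 * ring_pi I a) mul1r.
Qed.

(** Surjective because (a mod I) (x) x = 1 (x) a x. For killed [L] the product of a class mod [I]
    with an element of [L] is well defined by any representative, and it gives a left inverse. *)
Lemma bar_unit L : exists u : {linear L -> restr (bar L)},
  [/\ forall x, u x = tens (1 : bim) x, surjective u & killed L -> injective u].
Proof.
have lu : linear (fun x => tens (1 : bim) x : restr (bar L)).
  move=> a x y; rewrite tensDr -pi_tens restrZ; congr (_ + _).
  have -> := tensZ (ring_pi I a) (1 : bim) x.
  congr (tens _ x); apply/esym; exact: mulr1.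
exists (mklin lu); split=> // [|kL].
  elim/tensor_ind => [|_ _ [x <-] [y <-]|q x].
  - by exists 0; apply: tens0r.
  - by exists (x - y); apply: raddfB.
  - by exists (repr q *: x); apply: etrans (esym (pi_tens _ _)) _; rewrite ring_piK.
pose b (q : bim) (x : L) := repr (q : Rq) *: x.
have bE a x : b (ring_pi I a) x = a *: x.
  apply/eqP; rewrite -subr_eq0 -scalerBl; apply/eqP/kL.
  by apply/ring_pi_eq; rewrite ring_piK.
have bb : balanced b.
  split=> [p q x|q x y|q r x].
  - by rewrite -(ring_piK p) -(ring_piK q) -ring_piD !bE scalerDl.
  - exact: scalerDr.
  - by rewrite -(ring_piK q) -[rscale _ r]/(ring_pi I _ * ring_pi I r) -ring_piM
      !bE scalerA.
have bu x : tensor_lift b (tens (1 : bim) x) = x.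
  by rewrite (tensor_liftE bb) -[b 1 x]/(b (ring_pi I 1) x) bE scale1r.
by move=> x y xy; rewrite -(bu x) -(bu y); exact: (congr1 (tensor_lift b) xy).
Qed.

Lemma bar_iso L L' : lmod_iso L L' -> lmod_iso (bar L) (bar L').
Proof.
move=> /lmod_iso_inv[f [g [fK gK]]]; exists (tmap bim f), (tmap bim g) => t.
  by rewrite (tmap_comp (h := idfun)) ?tmap_id.
by rewrite (tmap_comp (h := idfun)) ?tmap_id.
Qed.

Lemma bar_restr U : lmod_iso (bar (restr U)) U.
Proof.
have [u [uE us ui]] := bar_unit (restr U).
have [|g gE] := factor_surj (h := idfun : {linear restr U -> restr U}) us.
  by move=> x /(raddf_inj_eq0 (ui (@restr_killed U))).
have [g' g'E] := restr_full g.
apply: (@lmod_iso_bij _ _ _ g').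
- by move=> x y; rewrite !g'E; have [s <-] := us x; have [t <-] := us y;
    rewrite !gE /= => ->.
- by move=> x; exists (u x); rewrite g'E gE.
Qed.

Lemma bar_ses L L' L'' (i : {linear L -> L'}) (p : {linear L' -> L''}) :
  killed L -> killed L' -> short_exact i p ->
  short_exact (tmap bim i) (tmap bim p).
Proof.
move=> kL kL' [ii e ps]; split; last exact: tmap_surj.
  have [u [uE us _]] := bar_unit L; have [u' [u'E _ u'i]] := bar_unit L'.
  apply: linear_inj => t; have [x <-] := us t; rewrite uE tmapE -u'E.
  by move=> /(raddf_inj_eq0 (u'i kL'))/(raddf_inj_eq0 ii) ->; rewrite tens0r.
exact: tmap_exact.
Qed.

(* [Ext^1(L, L') = 0] over [R/I]. *)
Definition splits_killed L L' :=
  forall E (i : {linear L' -> E}) (p : {linear E -> L}),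
    killed E -> short_exact i p -> exists r : {linear E -> L'}, cancel i r.

(** [bar] is exact on killed modules; conversely an extension of [bar L] by [bar L'], restricted to
    [R], is one of [L] by [L'] with killed middle term. The units translate the retractions. *)
Lemma bar_splits L L' : killed L -> killed L' ->
  splits (bar L) (bar L') <-> splits_killed L L'.
Proof.
move=> kL kL'.
have [u [uE us /(_ kL) ui]] := bar_unit L;
  have [u' [u'E u's /(_ kL') u'i]] := bar_unit L'.
split=> LL' E i p => [kE|] ip.
- have [r rK] := LL' _ _ _ (bar_ses kL' kE ip).
  have [v [vE _ _]] := bar_unit E.
  have [|s sE] := factor_inj (h := res_map r \o v) u'i.
    by move=> x; apply: u's.
  exists s => x; apply: u'i.
  by rewrite sE /= vE -(tmapE (M := bim) i) rK u'E.
- have [ii e ps] := ip.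
  have [|q qE] := factor_inj (h := res_map p) ui; first by move=> x; apply: us.
  have [|s sK] := LL' (restr E) (res_map i \o u') q (@restr_killed E).
    split=> [|y|x].
    + exact: inj_comp ii u'i.
    + have -> : q y = 0 <-> p y = 0.
        by rewrite -[p y]/(res_map p y) -qE; split=> [->|/(raddf_inj_eq0 ui)//];
          rewrite raddf0.
      split=> [/e[t <-]|[x <-]].
        by have [x <-] := u's t; exists x.
      by rewrite /= (ses0 _ ip).
    + by have [y yE] := ps (u x); exists y; apply: ui; rewrite qE.
  have [r rE] := restr_full (u' \o s).
  exists r => t; rewrite rE; have [x <-] := u's t.
  by rewrite -[in LHS]/((res_map i \o u') x) /= sK.
Qed.
End QuotientRingModules.

(** * Quadruples as modules over the Morita ring *)

Section BalancedAction.
Variables (S R : pzRingType) (M : bimodType S R) (N : bimodType R S).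
Variables (theta : {linear tensor M N -> S^o}) (Y : lmodType S).
Hypothesis theta_r : forall t s, theta (rscale t s) = rscale (theta t) s.

Let b1 m (n : N) (y : Y) := (theta (tens m n) : S) *: y.
Let b m (w : tensor N Y) := tensor_lift (b1 m) w.

Fact mact_inner m : balanced (b1 m).
Proof.
split=> [n n' y|n y y'|n s y]; rewrite /b1.
- by rewrite tensDr raddfD; apply: scalerDl.
- exact: scalerDr.
- by rewrite -tens_rscale theta_r scalerA.
Qed.

Let bE m n y : b m (tens n y) = (theta (tens m n) : S) *: y.
Proof. exact: (tensor_liftE (mact_inner m)). Qed.

Let bB m : zmod_morphism (b m).
Proof. exact: (tensor_lift_is_zmod_morphism (mact_inner m)). Qed.

Let bD m w w' : b m (w + w') = b m w + b m w'.
Proof.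
have b0 : b m 0 = 0 by rewrite -[X in b m X](subrr 0) bB subrr.
by rewrite -{1}[w']opprK -[- w']sub0r !bB b0 sub0r opprK.
Qed.

Fact mact_balanced : balanced b.
Proof.
split=> [m m' w|m w w'|m r w].
- apply: (tensor_eq (f := b (m + m')) (g := fun w => b m w + b m' w)) w.
  + exact: bB.
  + by move=> w w'; rewrite !bB opprD addrACA.
  + by move=> n y; rewrite !bE tensDl raddfD; apply: scalerDl.
- exact: bD.
- apply: (tensor_eq (f := b (rscale m r)) (g := fun w => b m (r *: w))) w.
  + exact: bB.
  + by move=> w w'; rewrite scalerBr bB.
  + by move=> n y; rewrite tensZ !bE tensM.
Qed.

Fact mact_linear s m w : b (s *: m) w = s *: b m w.
Proof.
apply: (tensor_eq (f := b (s *: m)) (g := fun w => s *: b m w)) w.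
- exact: bB.
- by move=> w w'; rewrite bB scalerBr.
- by move=> n y; rewrite !bE -tensZ linearZ_LR scalerA.
Qed.

(** With [theta] = phi this is the f of [Tq], with [theta] = psi the g of [Lq]. *)
Definition mact : {linear tensor M (tensor N Y) -> Y} := tlin mact_balanced mact_linear.

Lemma mactE m n y : mact (tens m (tens n y)) = (theta (tens m n) : S) *: y.
Proof. by apply: etrans (tlinE _ _ _ _) _; apply: bE. Qed.
End BalancedAction.

Section ZeroModule.
Variable R : pzRingType.
Definition zero_mod : lmodType R := kernel (idfun : {linear R^o -> R^o}).
Lemma zero_modP (x : zero_mod) : x = 0.
Proof. by apply: val_inj; case: x => x /= /eqP. Qed.
End ZeroModule.

Lemma tensBr (R : pzRingType) (M : rmodType R) (X : lmodType R) (m : M) (x y : X) :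
  tens m (x - y) = tens m x - tens m y.
Proof. by apply/eqP; rewrite eq_sym subr_eq -tensDr subrK. Qed.

Lemma tens_sum (R : pzRingType) (M : rmodType R) (X : lmodType R) (m : M)
    (T : Type) (r : seq T) (F : T -> X) :
  tens m (\sum_(i <- r) F i) = \sum_(i <- r) tens m (F i).
Proof. by apply: (big_morph (tens m)) => [x y|]; [apply: tensDr|apply: tens0r]. Qed.

Section Quadruples.
Variables (A B : pzRingType) (N : bimodType A B) (M : bimodType B A).
Variable D : morita_datum N M.
Local Notation quad := (quadruple D).
Local Notation bim := (A_mod_psi_bimod D).
Local Notation psit n m := (psi D (tens n m) : A).
Local Notation phit m n := (phi D (tens m n) : B).

(* [Tq] and [Hq] are the left and right adjoints of [q |-> qY q], and [Lq] is
   the left adjoint of [q |-> qX q]. *)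
Section Tq.
Variable Y : lmodType B.
Let f : {linear tensor M (tensor N Y) -> Y} := mact Y (@phi_rlinear _ _ _ _ D).
Let g : {linear tensor N Y -> tensor N Y} := idfun.

Fact Tq_gf n m x : g (tens n (f (tens m x))) = psit n m *: x.
Proof.
apply: (tensor_eq (f := fun x => g (tens n (f (tens m x))))
  (g := fun x => psit n m *: x)) x => [s t|s t|n' y].
- by rewrite tensBr raddfB /= tensBr.
- exact: scalerBr.
- by rewrite /f mactE /= -tensM tensZ psi_phi.
Qed.

Fact Tq_fg m n y : f (tens m (g (tens n y))) = phit m n *: y.
Proof. exact: mactE. Qed.

Definition Tq : quad := Quadruple Tq_gf Tq_fg.
End Tq.

Section Lq.
Variable P : lmodType A.
Let f : {linear tensor M P -> tensor M P} := idfun.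
Let g : {linear tensor N (tensor M P) -> P} := mact P (@psi_rlinear _ _ _ _ D).

Fact Lq_gf n m x : g (tens n (f (tens m x))) = psit n m *: x.
Proof. exact: mactE. Qed.

Fact Lq_fg m n y : f (tens m (g (tens n y))) = phit m n *: y.
Proof.
apply: (tensor_eq (f := fun y => f (tens m (g (tens n y))))
  (g := fun y => phit m n *: y)) y => [s t|s t|m' x].
- by rewrite tensBr raddfB /= tensBr.
- exact: scalerBr.
- by rewrite /g mactE /= -tensM tensZ phi_psi.
Qed.

Definition Lq : quad := Quadruple Lq_gf Lq_fg.
End Lq.

Section Hq.
Variable Y : lmodType B.

Fact Hq_f_balanced : balanced (fun (m : M) (h : lhom M Y) => lhom_fun h m).
Proof. by split=> [m m' h|m h h'|m a h]; rewrite ?linearD. Qed.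
Let f : {linear tensor M (lhom M Y) -> Y} :=
  tlin Hq_f_balanced (fun b m h => linearZ_LR (lhom_fun h) b m).

Fact Hq_g_linear n (y : Y) : linear (fun m => phit m n *: y).
Proof.
move=> b m m'; rewrite tensDl -tensZ linearP scalerA.
exact: scalerDl.
Qed.
Let g0 n y : lhom M Y := mklin (Hq_g_linear n y).
Fact Hq_g_balanced : balanced g0.
Proof.
split=> [n n' y|n y y'|n b y]; apply: lhomP => m /=.
- by rewrite tensDr raddfD; apply: scalerDl.
- exact: scalerDr.
- by rewrite -tens_rscale phi_rlinear scalerA.
Qed.
Fact Hq_g_linearl a n y : g0 (a *: n) y = a *: g0 n y.
Proof. by apply: lhomP => m; rewrite /= /lhom_scale_fun /= tensM. Qed.
Let g : {linear tensor N Y -> lhom M Y} := tlin Hq_g_balanced Hq_g_linearl.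

Fact Hq_gf n m x : g (tens n (f (tens m x))) = psit n m *: x.
Proof.
rewrite /g /f !tlinE; apply: lhomP => m' /=; rewrite /lhom_scale_fun /= phi_psi.
by rewrite linearZ_LR.
Qed.

Fact Hq_fg m n y : f (tens m (g (tens n y))) = phit m n *: y.
Proof. by rewrite /g /f !tlinE. Qed.

Definition Hq : quad := Quadruple Hq_gf Hq_fg.
Lemma HqE m (h : lhom M Y) : qf Hq (tens m h) = lhom_fun h m.
Proof. exact: tlinE. Qed.
Lemma HqgE n (y : Y) m : lhom_fun (qg Hq (tens n y)) m = phit m n *: y.
Proof. by have -> : qg Hq (tens n y) = g0 n y := tlinE _ _ _ _. Qed.
End Hq.

Local Notation killed := (@killed A (im_psi D)).

Lemma psi_im n m : psit n m \in im_psi D.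
Proof. by apply/asboolP; exists (tens n m). Qed.

Section Zq.
Variable L : lmodType A.
Hypothesis kL : killed L.
Let f : {linear tensor M L -> zero_mod B} := \0.
Let g : {linear tensor N (zero_mod B) -> L} := \0.
Fact Zq_gf n m x : g (tens n (f (tens m x))) = psit n m *: x.
Proof. by rewrite kL // psi_im. Qed.
Fact Zq_fg m n y : f (tens m (g (tens n y))) = phit m n *: y.
Proof. by rewrite (zero_modP y) scaler0. Qed.
Definition Zq : quad := Quadruple Zq_gf Zq_fg.
End Zq.

Section Sumq.
Variables q q' : quad.
Let X := (qX q * qX q')%type.
Let Y := (qY q * qY q')%type.
Fact sumq_f_linear : linear (fun t : tensor M X =>
  (qf q (tmap M fst t), qf q' (tmap M snd t)) : Y).
Proof. by move=> a u v; rewrite !linearP. Qed.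
Fact sumq_g_linear : linear (fun t : tensor N Y =>
  (qg q (tmap N fst t), qg q' (tmap N snd t)) : X).
Proof. by move=> a u v; rewrite !linearP. Qed.
Let f : {linear tensor M X -> Y} := mklin sumq_f_linear.
Let g : {linear tensor N Y -> X} := mklin sumq_g_linear.
Let fE m x : f (tens m x) = (qf q (tens m x.1), qf q' (tens m x.2)).
Proof.
rewrite -[LHS]/(qf q (tmap M fst (tens m x)), qf q' (tmap M snd (tens m x))).
by rewrite !tmapE.
Qed.
Let gE n y : g (tens n y) = (qg q (tens n y.1), qg q' (tens n y.2)).
Proof.
rewrite -[LHS]/(qg q (tmap N fst (tens n y)), qg q' (tmap N snd (tens n y))).
by rewrite !tmapE.
Qed.
Fact sumq_gf n m x : g (tens n (f (tens m x))) = psit n m *: x.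
Proof. by rewrite fE gE /= !qgf; case: x. Qed.
Fact sumq_fg m n y : f (tens m (g (tens n y))) = phit m n *: y.
Proof. by rewrite gE fE /= !qfg; case: y. Qed.
Definition sumq : quad := Quadruple sumq_gf sumq_fg.
Lemma sumq_fE m x : qf sumq (tens m x) = (qf q (tens m x.1), qf q' (tens m x.2)).
Proof. exact: fE. Qed.
Lemma sumq_gE n y : qg sumq (tens n y) = (qg q (tens n y.1), qg q' (tens n y.2)).
Proof. exact: gE. Qed.
Lemma sumq_inj : injective (qg q) -> injective (qg q') -> injective (qg sumq).
Proof.
move=> gi gi'; apply: linear_inj => t.
move=> -[/(raddf_inj_eq0 gi) t1 /(raddf_inj_eq0 gi') t2].
have [i iE] := pair_linear (idfun : {linear qY q -> qY q}) (\0 : {linear qY q ->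
  qY q'}).
have [j jE] := pair_linear (\0 : {linear qY q' -> qY q}) (idfun : {linear qY q' ->
  qY q'}).
rewrite -(tmap_id (f := idfun) t) //.
rewrite (tmapD (g := i \o fst) (h := j \o snd)); last first.
  by move=> [y y'] /=; rewrite iE jE; congr pair; rewrite /= ?addr0 ?add0r.
rewrite -(tmap_comp (f := fst) (g := i)) // -(tmap_comp (f := snd) (g := j)) //.
have -> : tmap N fst t = 0 := t1; have -> : tmap N snd t = 0 := t2.
by rewrite !raddf0 addr0.
Qed.
End Sumq.

(** Compatibility is asked on pure tensors, which generate; [qhom_gt] extends it to all of N (x)
    Y. *)
Record qhom (q q' : quad) := Qhom {
  hX : {linear qX q -> qX q'};
  hY : {linear qY q -> qY q'};
  qhom_f : forall m x, hY (qf q (tens m x)) = qf q' (tens m (hX x));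
  qhom_g : forall n y, hX (qg q (tens n y)) = qg q' (tens n (hY y))
}.

(** Left transparent, so that [hX] and [hY] of a composite compute. *)
Definition qcomp q q' q'' (k : qhom q' q'') (h : qhom q q') : qhom q q''.
Proof.
refine (@Qhom q q'' (hX k \o hX h) (hY k \o hY h) _ _) => [m x|n y] /=.
- by rewrite !qhom_f.
- by rewrite !qhom_g.
Defined.

Lemma qhom_gt q q' (h : qhom q q') t : hX h (qg q t) = qg q' (tmap N (hY h) t).
Proof.
suff: hX h \o qg q =1 qg q' \o tmap N (hY h) by move=> /(_ t).
by apply: tens_ext => m x; rewrite [LHS]/= qhom_g -[RHS]/(qg q' (tmap N (hY h) _))
  tmapE.
Qed.

Definition qses q q' q'' (i : qhom q q') (p : qhom q' q'') :=
  short_exact (hX i) (hX p) /\ short_exact (hY i) (hY p).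

Fact quad_map_linear q q' (h : qhom q q') :
  linear (fun v : quad_mod q => (hX h v.1, hY h v.2) : quad_mod q').
Proof.
move=> r [x y] [x' y']; congr pair => /=.
- by rewrite !raddfD /= qhom_g linearZ_LR.
- by rewrite !raddfD /= qhom_f linearZ_LR.
Qed.
Definition quad_map q q' (h : qhom q q') : {linear quad_mod q -> quad_mod q'} :=
  mklin (quad_map_linear h).

(** The matrix entries inside the Morita ring; [eA 1] and [eB 1] are the complementary diagonal
    idempotents. *)
Definition eA (a : A) : morita_ring D := Morita a 0 0 0.
Definition eN (n : N) : morita_ring D := Morita 0 n 0 0.
Definition eM (m : M) : morita_ring D := Morita 0 0 m 0.
Definition eB (b : B) : morita_ring D := Morita 0 0 0 b.

Ltac msimp := rewrite /= !(tens0l, tens0r, raddf0, mul0r, mulr0, scale0r, scaler0,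
  rscale0r, rscale0l, addr0, add0r, mul1r, mulr1, scale1r, rscaler1).

Lemma mulE (r s : morita_ring D) : r * s = morita_mul r s. Proof. by []. Qed.
Lemma addE (r s : morita_ring D) : r + s = morita_add r s. Proof. by []. Qed.

Lemma eA_mulA a a' : eA a * eA a' = eA (a * a').
Proof. by rewrite mulE /morita_mul; msimp. Qed.
Lemma eB_mulB b b' : eB b * eB b' = eB (b * b').
Proof. by rewrite mulE /morita_mul; msimp. Qed.
Lemma eA_mulN a n : eA a * eN n = eN (a *: n).
Proof. by rewrite mulE /morita_mul; msimp. Qed.
Lemma eN_mulB n b : eN n * eB b = eN (rscale n b).
Proof. by rewrite mulE /morita_mul; msimp. Qed.
Lemma eB_mulM b m : eB b * eM m = eM (b *: m).
Proof. by rewrite mulE /morita_mul; msimp. Qed.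
Lemma eM_mulA m a : eM m * eA a = eM (rscale m a).
Proof. by rewrite mulE /morita_mul; msimp. Qed.
Lemma eN_mulM n m : eN n * eM m = eA (psit n m).
Proof. by rewrite mulE /morita_mul; msimp. Qed.
Lemma eM_mulN m n : eM m * eN n = eB (phit m n).
Proof. by rewrite mulE /morita_mul; msimp. Qed.
Lemma eA_D a a' : eA (a + a') = eA a + eA a'.
Proof. by rewrite addE /morita_add; msimp. Qed.
Lemma eB_D b b' : eB (b + b') = eB b + eB b'.
Proof. by rewrite addE /morita_add; msimp. Qed.
Lemma eN_D n n' : eN (n + n') = eN n + eN n'.
Proof. by rewrite addE /morita_add; msimp. Qed.
Lemma eM_D m m' : eM (m + m') = eM m + eM m'.
Proof. by rewrite addE /morita_add; msimp. Qed.
Lemma eA_eB : 1 = eA 1 + eB 1.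
Proof. by rewrite addE /morita_add; msimp. Qed.
Lemma eA_r (r : morita_ring D) : eA 1 * r = eA (mA r) * eA 1 + eN (mN r) * eB 1.
Proof.
by case: r => a n m b; rewrite !mulE addE /morita_mul /morita_add; msimp.
Qed.
Lemma eB_r (r : morita_ring D) : eB 1 * r = eM (mM r) * eA 1 + eB (mB r) * eB 1.
Proof.
by case: r => a n m b; rewrite !mulE addE /morita_mul /morita_add; msimp.
Qed.

Lemma quad_actX q (r : morita_ring D) (x : qX q) :
  r *: ((x, 0) : quad_mod q) = (mA r *: x, qf q (tens (mM r) x)).
Proof. by congr pair; msimp. Qed.
Lemma quad_actY q (r : morita_ring D) (y : qY q) :
  r *: ((0, y) : quad_mod q) = (qg q (tens (mN r) y), mB r *: y).
Proof. by congr pair; msimp. Qed.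

(** A linear map commutes with [eA 1] and [eB 1], so it preserves both components; linearity over
    [eM m] and [eN n] is compatibility with the f's and g's. *)
Lemma quad_unmap q q' (k : {linear quad_mod q -> quad_mod q'}) :
  exists h : qhom q q', forall v, k v = quad_map h v.
Proof.
pose inX (p : quad) (x : qX p) : quad_mod p := (x, 0).
pose inY (p : quad) (y : qY p) : quad_mod p := (0, y).
pose fX x := (k (inX q x)).1; pose fY y := (k (inY q y)).2.
have kX x : k (inX q x) = inX q' (fX x).
  have {1}-> : inX q x = eA 1 *: inX q x by rewrite quad_actX; msimp.
  rewrite linearZ_LR /= [k _ in LHS]surjective_pairing.
  by congr pair; msimp.
have kY y : k (inY q y) = inY q' (fY y).
  have {1}-> : inY q y = eB 1 *: inY q y by rewrite quad_actY; msimp.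
  rewrite linearZ_LR /= [k _ in LHS]surjective_pairing.
  by congr pair; msimp.
have inXD p (x y : qX p) : inX p (x + y) = inX p x + inX p y by congr pair;
  rewrite /= addr0.
have inYD p (x y : qY p) : inY p (x + y) = inY p x + inY p y by congr pair;
  rewrite /= addr0.
have inXZ p a (x : qX p) : eA a *: inX p x = inX p (a *: x).
  by rewrite quad_actX; msimp.
have inYZ p b (y : qY p) : eB b *: inY p y = inY p (b *: y).
  by rewrite quad_actY; msimp.
have inYf p m (x : qX p) : eM m *: inX p x = inY p (qf p (tens m x)).
  by rewrite quad_actX; msimp.
have inXg p n (y : qY p) : eN n *: inY p y = inX p (qg p (tens n y)).
  by rewrite quad_actY; msimp.
have lX : linear fX.
  move=> a x y; suff [] : inX q' (fX (a *: x + y)) = inX q' (a *: fX x + fX y) by [].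
  by rewrite -kX inXD -inXZ linearP !kX inXZ -inXD.
have lY : linear fY.
  move=> a x y; suff [] : inY q' (fY (a *: x + y)) = inY q' (a *: fY x + fY y) by [].
  by rewrite -kY inYD -inYZ linearP !kY inYZ -inYD.
have hf m x : mklin lY (qf q (tens m x)) = qf q' (tens m (mklin lX x)).
  suff [] : inY q' (fY (qf q (tens m x))) = inY q' (qf q' (tens m (fX x))) by [].
  by rewrite -kY -inYf linearZ_LR kX inYf.
have hg n y : mklin lX (qg q (tens n y)) = qg q' (tens n (mklin lY y)).
  suff [] : inX q' (fX (qg q (tens n y))) = inX q' (qg q' (tens n (fY y))) by [].
  by rewrite -kX -inXg linearZ_LR kY inXg.
exists (Qhom hf hg) => -[x y].
have -> : (x, y) = inX q x + inY q y by congr pair; rewrite /= ?addr0 ?add0r.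
rewrite raddfD /= kX kY.
by congr pair => /=; rewrite ?addr0 ?add0r ?raddf0.
Qed.

Record rng_hom (R L : pzRingType) := RngHom {
  rng_fun :> R -> L;
  rng_add : {morph rng_fun : a b / a + b};
  rng_mul : {morph rng_fun : a b / a * b}
}.

(* For a non-unital ring map [h : R -> L], the [R]-module [h(1) V]. *)
Section Corner.
Variables (R L : pzRingType) (h : rng_hom R L) (V : lmodType L).
Definition corner_pred : {pred V} := fun v => h 1 *: v == v.
Fact corner_zmod_closed : zmod_closed corner_pred.
Proof.
split=> [|u v /eqP hu /eqP hv]; apply/eqP; first exact: scaler0.
by rewrite scalerBr hu hv.
Qed.
HB.instance Definition _ := GRing.isZmodClosed.Build V corner_pred corner_zmod_closed.
Definition corner : Type := {v : V | corner_pred v}.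
HB.instance Definition _ := SubChoice.on corner.
HB.instance Definition _ := [SubChoice_isSubZmodule of corner by <:].

Fact corner_in a (v : V) : corner_pred (h a *: v).
Proof. by rewrite /corner_pred scalerA -rng_mul mul1r. Qed.
Definition corner_scale a (v : corner) : corner :=
    Sub (h a *: val v) (corner_in a (val v)).
Fact corner_scaleA a b v : corner_scale a (corner_scale b v) = corner_scale (a * b) v.
Proof. by apply: val_inj; rewrite /= scalerA rng_mul. Qed.
Fact corner_scale1 : left_id 1 corner_scale.
Proof. by move=> [v vP]; apply: val_inj; apply/eqP. Qed.
Fact corner_scaleDr : right_distributive corner_scale +%R.
Proof. by move=> a u v; apply: val_inj; rewrite /= -scalerDr. Qed.
Fact corner_scaleDl v : {morph corner_scale^~ v : a b / a + b}.
Proof. by move=> a b; apply: val_inj; rewrite /= rng_add scalerDl. Qed.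
HB.instance Definition _ := GRing.Zmodule_isLmodule.Build R corner
  corner_scaleA corner_scale1 corner_scaleDr corner_scaleDl.

Lemma cornerP (v : corner) : h 1 *: val v = val v. Proof. by case: v => v /= /eqP. Qed.
End Corner.

Definition iA := RngHom eA_D (fun a a' => esym (eA_mulA a a')).
Definition iB := RngHom eB_D (fun a a' => esym (eB_mulB a a')).

(** Peirce decomposition: the components are the images of [eA 1] and [eB 1], and [eM], [eN] act
    between them as f and g. *)
Lemma quad_of V : exists q : quad, lmod_iso V (quad_mod q).
Proof.
pose X := corner iA V; pose Y := corner iB V.
have fP m (x : X) : corner_pred iB (eM m *: val x).
  by rewrite /corner_pred /= scalerA eB_mulM scale1r.
have gP n (y : Y) : corner_pred iA (eN n *: val y).
  by rewrite /corner_pred /= scalerA eA_mulN scale1r.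
pose f0 m (x : X) : Y := Sub (eM m *: val x) (fP m x).
pose g0 n (y : Y) : X := Sub (eN n *: val y) (gP n y).
have fb : balanced f0.
  split=> [m m' x|m x x'|m a x]; apply: val_inj => /=.
  - by rewrite eM_D scalerDl.
  - by rewrite scalerDr.
  - by rewrite scalerA eM_mulA.
have gb : balanced g0.
  split=> [m m' x|m x x'|m a x]; apply: val_inj => /=.
  - by rewrite eN_D scalerDl.
  - by rewrite scalerDr.
  - by rewrite scalerA eN_mulB.
have fZ b m x : f0 (b *: m) x = b *: f0 m x.
  by apply: val_inj; rewrite /= scalerA eB_mulM.
have gZ a n y : g0 (a *: n) y = a *: g0 n y.
  by apply: val_inj; rewrite /= scalerA eA_mulN.
have gf n m x : tlin gb gZ (tens n (tlin fb fZ (tens m x))) = psit n m *: x.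
  by rewrite !tlinE; apply: val_inj; rewrite /= scalerA eN_mulM.
have fg m n y : tlin fb fZ (tens m (tlin gb gZ (tens n y))) = phit m n *: y.
  by rewrite !tlinE; apply: val_inj; rewrite /= scalerA eM_mulN.
pose q : quad := Quadruple gf fg; exists q.
have qfE m x : qf q (tens m x) = f0 m x by exact: tlinE.
have qgE n y : qg q (tens n y) = g0 n y by exact: tlinE.
pose cX (v : V) : X := Sub (eA 1 *: v) (corner_in iA 1 v).
pose cY (v : V) : Y := Sub (eB 1 *: v) (corner_in iB 1 v).
have lc : linear (fun v => (cX v, cY v) : quad_mod q).
  move=> r u v.
  have -> : r *: ((cX u, cY u) : quad_mod q) =
      (mA r *: cX u + g0 (mN r) (cY u), f0 (mM r) (cX u) + mB r *: cY u).
    by rewrite -qfE -qgE.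
  congr pair; apply: val_inj; rewrite /= scalerDr; congr (_ + _).
  - by rewrite !scalerA eA_r scalerDl.
  - by rewrite !scalerA eB_r scalerDl.
exists (mklin lc), (fun w : quad_mod q => val w.1 + val w.2) => [v|[x y]] /=.
  by rewrite -scalerDl -eA_eB scale1r.
have BA : eB 1 * eA 1 = 0 by rewrite mulE /morita_mul; msimp.
have AB : eA 1 * eB 1 = 0 by rewrite mulE /morita_mul; msimp.
congr pair; apply: val_inj; rewrite /= scalerDr.
- by rewrite (cornerP x) -(cornerP y) scalerA AB scale0r addr0.
- by rewrite (cornerP y) -(cornerP x) scalerA BA scale0r add0r.
Qed.
End Quadruples.

(** * Extensions, pushouts and pullbacks of quadruples *)

Section QuadrupleExtensions.
Variables (A B : pzRingType) (N : bimodType A B) (M : bimodType B A).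
Variable D : morita_datum N M.
Local Notation quad := (quadruple D).
Implicit Types q : quad.

Lemma qses_quad_map q q' q'' (i : qhom q q') (p : qhom q' q'') :
  qses i p <-> short_exact (quad_map i) (quad_map p).
Proof.
split=> [[[iX eX pX] [iY eY pY]]|[ii e ps]].
  split=> [[x y] [x' y'] /= [/iX -> /iY ->]//|[x y]|[x y]].
  - split=> [[/eX[x' <-] /eY[y' <-]]|[[x' y'] [<- <-]]]; first by exists (x', y').
    by congr pair => /=; [apply/eX; exists x'|apply/eY; exists y'].
  - by have [x' <-] := pX x; have [y' <-] := pY y; exists (x', y').
have eE x y : (hX p x, hY p y) = (0, 0) <-> exists v : quad_mod q, (hX i v.1, hY i
  v.2) = (x, y).
  exact: e (x, y).
split; split.
- apply: linear_inj => x ix.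
  have : quad_map i (x, 0) = 0 by congr pair; rewrite /= ?ix ?raddf0.
  by move=> /(raddf_inj_eq0 ii)[].
- move=> x; split=> [px|[x' <-]].
    have /eE[v [<- _]] : (hX p x, hY p 0) = (0, 0) by rewrite px raddf0.
    by exists v.1.
  have /eE[] // : exists v : quad_mod q, (hX i v.1, hY i v.2) = (hX i x', 0).
  by exists (x', 0); rewrite /= raddf0.
- by move=> x; have [v [<- _]] := ps (x, 0); exists v.1.
- apply: linear_inj => y iy.
  have : quad_map i (0, y) = 0 by congr pair; rewrite /= ?iy ?raddf0.
  by move=> /(raddf_inj_eq0 ii)[].
- move=> y; split=> [py|[y' <-]].
    have /eE[v [_ <-]] : (hX p 0, hY p y) = (0, 0) by rewrite py raddf0.
    by exists v.2.
  have /eE[] // : exists v : quad_mod q, (hX i v.1, hY i v.2) = (0, hY i y').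
  by exists (0, y'); rewrite /= raddf0.
- by move=> y; have [v [_ <-]] := ps (0, y); exists v.2.
Qed.

Lemma ses_iso (R : pzRingType) (U V W V' : lmodType R) (i : {linear U -> V})
    (p : {linear V -> W}) (f : {linear V -> V'}) (g : {linear V' -> V}) :
  cancel f g -> cancel g f -> short_exact i p -> short_exact (f \o i) (p \o g).
Proof.
move=> fK gK [ii e ps]; split=> [|y|w].
- exact: inj_comp (can_inj fK) ii.
- split=> [/e[x xE]|[x <-]]; first by exists x; rewrite /= xE gK.
  by rewrite /= fK; apply/e; exists x.
- by have [v <-] := ps w; exists (f v); rewrite /= fK.
Qed.

(** The middle term of an extension is an arbitrary module; [quad_of] replaces it by a quadruple.
    The isomorphisms [f] and [g] are returned so that further maps can be transported. *)
Lemma ses_quad q q' (E : lmodType (morita_ring D)) (i : {linear quad_mod q ->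
    E}) (p : {linear E -> quad_mod q'}) :
  short_exact i p ->
  exists (q1 : quad) (i1 : qhom q q1) (p1 : qhom q1 q')
    (f : {linear E -> quad_mod q1}) (g : {linear quad_mod q1 -> E}),
  [/\ cancel f g, cancel g f, qses i1 p1, forall v, quad_map i1 v = f (i v)
    & forall v, quad_map p1 v = p (g v)].
Proof.
move=> ip; have [q1 /lmod_iso_inv[f [g [fK gK]]]] := quad_of E.
have [i1 i1E] := quad_unmap (f \o i); have [p1 p1E] := quad_unmap (p \o g).
exists q1, i1, p1, f, g; split=> // [|v|v]; [|by rewrite -i1E|by rewrite -p1E].
apply/qses_quad_map; have [ii e ps] := ses_iso fK gK ip; split=> [|y|w].
- by move=> u v; rewrite -!i1E => /ii.
- by rewrite -p1E e; split=> -[x <-]; exists x; rewrite -?i1E // i1E.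
- by have [v <-] := ps w; exists v; rewrite -p1E.
Qed.

Definition qsplits q q' := splits (quad_mod q) (quad_mod q').

Lemma qsplitsP q q' : qsplits q q' <->
  forall q1 (i : qhom q' q1) (p : qhom q1 q), qses i p ->
    exists r : qhom q1 q', cancel (hX i) (hX r) /\ cancel (hY i) (hY r).
Proof.
split=> [qq q1 i p /qses_quad_map/qq[r rK]|qq E i p].
  have [h hE] := quad_unmap r; exists h.
  have hK : cancel (quad_map i) (quad_map h) by move=> v; rewrite -hE rK.
  split=> [x|y].
  - by have := congr1 fst (hK (x, 0)); rewrite /= ?raddf0.
  - by have := congr1 snd (hK (0, y)); rewrite /= ?raddf0.
move=> /ses_quad[q1 [i1 [p1 [f [g [fK gK ip1 i1E p1E]]]]]].
have [r [rX rY]] := qq _ _ _ ip1.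
exists (quad_map r \o f) => -[x y].
by rewrite -[LHS]/(quad_map r (f (i (x, y)))) -i1E /= rX rY.
Qed.

Lemma qsplits_sectionP q q' : qsplits q q' <->
  forall q1 (i : qhom q' q1) (p : qhom q1 q), qses i p ->
    exists s : qhom q q1, cancel (hX s) (hX p) /\ cancel (hY s) (hY p).
Proof.
split=> [/splitsP qq q1 i p /qses_quad_map/qq[r rK]|qq].
  have [h hE] := quad_unmap r; exists h.
  have hK : cancel (quad_map h) (quad_map p) by move=> v; rewrite -hE rK.
  split=> [x|y].
  - by have := congr1 fst (hK (x, 0)); rewrite /= ?raddf0.
  - by have := congr1 snd (hK (0, y)); rewrite /= ?raddf0.
apply/splitsP => E i p /ses_quad[q1 [i1 [p1 [f [g [fK gK ip1 i1E p1E]]]]]].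
have [r [rX rY]] := qq _ _ _ ip1.
exists (g \o quad_map r) => -[x y].
by rewrite -[LHS]/(p (g (quad_map r (x, y)))) -p1E /= rX rY.
Qed.

(** Formed among modules over the Morita ring and read back; the identities for the two components
    come from evaluating at (x, 0) and (0, y). *)
Lemma qpushout q q' q'' q0 (i : qhom q q') (p : qhom q' q'') (h : qhom q q0) :
  qses i p ->
  exists (q1 : quad) (i1 : qhom q0 q1) (p1 : qhom q1 q'') (k : qhom q' q1),
  [/\ qses i1 p1, (forall x, hX k (hX i x) = hX i1 (hX h x)) /\
        (forall y, hY k (hY i y) = hY i1 (hY h y)) &
      (forall x, hX p1 (hX k x) = hX p x) /\ (forall y, hY p1 (hY k y) = hY p y)].
Proof.
move=> /qses_quad_map ip.
have [E [j [r [k [jr kE rE]]]]] := pushout_ses (quad_map h) ip.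
have [q1 [i1 [p1 [f [g [fK gK ip1 i1E p1E]]]]]] := ses_quad jr.
have [k1 k1E] := quad_unmap (f \o k); exists q1, i1, p1, k1.
have e1 v : quad_map k1 (quad_map i v) = quad_map i1 (quad_map h v).
  by rewrite -k1E i1E -kE.
have e2 v : quad_map p1 (quad_map k1 v) = quad_map p v.
  by rewrite -k1E p1E /= fK rE.
split=> //; split=> x.
- by have := congr1 fst (e1 (x, 0)); rewrite /= ?raddf0.
- by have := congr1 snd (e1 (0, x)); rewrite /= ?raddf0.
- by have := congr1 fst (e2 (x, 0)); rewrite /= ?raddf0.
- by have := congr1 snd (e2 (0, x)); rewrite /= ?raddf0.
Qed.

Lemma qpullback q q' q'' q0 (i : qhom q q') (p : qhom q' q'') (h : qhom q0 q'') :
  qses i p ->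
  exists (q1 : quad) (i1 : qhom q q1) (p1 : qhom q1 q0) (k : qhom q1 q'),
  [/\ qses i1 p1, (forall x, hX k (hX i1 x) = hX i x) /\
        (forall y, hY k (hY i1 y) = hY i y) &
      (forall x, hX p (hX k x) = hX h (hX p1 x)) /\
        (forall y, hY p (hY k y) = hY h (hY p1 y))].
Proof.
move=> /qses_quad_map ip.
have [E [j [r [k [jr kE rE]]]]] := pullback_ses (quad_map h) ip.
have [q1 [i1 [p1 [f [g [fK gK ip1 i1E p1E]]]]]] := ses_quad jr.
have [k1 k1E] := quad_unmap (k \o g); exists q1, i1, p1, k1.
have e1 v : quad_map k1 (quad_map i1 v) = quad_map i v.
  by rewrite -k1E i1E /= fK kE.
have e2 v : quad_map p (quad_map k1 v) = quad_map h (quad_map p1 v).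
  by rewrite -k1E p1E; apply: rE.
split=> //; split=> x.
- by have := congr1 fst (e1 (x, 0)); rewrite /= ?raddf0.
- by have := congr1 snd (e1 (0, x)); rewrite /= ?raddf0.
- by have := congr1 fst (e2 (x, 0)); rewrite /= ?raddf0.
- by have := congr1 snd (e2 (0, x)); rewrite /= ?raddf0.
Qed.

Lemma qkernel q q' (p : qhom q q') :
  surjective (hX p) -> surjective (hY p) ->
  exists (q0 : quad) (i : qhom q0 q), qses i p.
Proof.
move=> pX pY; have ps : surjective (quad_map p).
  by move=> [x y]; have [x' <-] := pX x; have [y' <-] := pY y; exists (x', y').
have [i ip] := kernel_ses ps; have [q0 /lmod_iso_inv[f [g [fK gK]]]] :=
  quad_of (kernel (quad_map p)).
have [j jE] := quad_unmap (i \o g); exists q0, j; apply/qses_quad_map.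
have [ii e _] := ip; split=> // [u v|v].
  by rewrite -!jE /= => /ii/(can_inj gK).
rewrite e; split=> -[x <-]; last by exists (g x); rewrite -jE.
by exists (f x); rewrite -jE /= fK.
Qed.
End QuadrupleExtensions.

Lemma splits_zeror (R : pzRingType) (C : lmodType R) : splits C (zero_mod R).
Proof. by move=> E i p _; exists \0 => x; rewrite [x]zero_modP. Qed.

Lemma splits_zerol (R : pzRingType) (X : lmodType R) : splits (zero_mod R) X.
Proof.
by apply/splitsP => E i p _; exists \0 => x; rewrite [x]zero_modP /= raddf0.
Qed.

Lemma lhom_post_linear (R S : pzRingType) (M : bimodType R S) (Y Y' : lmodType R)
    (s : {linear Y -> Y'}) :
  linear (fun h : lhom M Y => (s \o lhom_fun h : {linear M -> Y'}) : lhom M Y').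
Proof.
move=> a h h'; apply: lhomP => m; exact: (raddfD s).
Qed.
Definition lhom_post (R S : pzRingType) (M : bimodType R S) (Y Y' : lmodType R)
    (s : {linear Y -> Y'}) : {linear lhom M Y -> lhom M Y'} :=
  mklin (@lhom_post_linear R S M Y Y' s).
Lemma lhom_postE (R S : pzRingType) (M : bimodType R S) (Y Y' : lmodType R)
    (s : {linear Y -> Y'}) (h : lhom M Y) m :
  lhom_fun (lhom_post M s h) m = s (lhom_fun h m).
Proof. by []. Qed.
Arguments lhom_post {R S} M {Y Y'} s : simpl never.

Arguments lhom_postE {R S M Y Y'} s h m.

Lemma ses_ext (R : pzRingType) (U V W : lmodType R) (i i' : {linear U -> V})
    (p p' : {linear V -> W}) : i =1 i' -> p =1 p' -> short_exact i p ->
      short_exact i' p'.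
Proof.
move=> ii' pp' [ii e ps]; split=> [x y|x|w]; first by rewrite -!ii' => /ii.
- by rewrite -pp' e; split=> -[u <-]; exists u.
- by have [v <-] := ps w; exists v.
Qed.

Lemma ses_isol (R : pzRingType) (U V W : lmodType R) (i : {linear U -> V})
    (p : {linear V -> W}) :
  injective i -> surjective i -> (forall w : W, w = 0) -> short_exact i p.
Proof.
move=> ii is0 w0; split=> [//|v|w]; last by exists 0; rewrite [RHS]w0 raddf0.
by split=> // _; apply: is0.
Qed.

Lemma ses_isor (R : pzRingType) (U V W : lmodType R) (i : {linear U -> V})
    (p : {linear V -> W}) :
  injective p -> surjective p -> (forall u : U, u = 0) -> short_exact i p.
Proof.
move=> pp ps u0; split=> [u v _|v|//]; first by rewrite [u]u0 [v]u0.
split=> [/(raddf_inj_eq0 pp) ->|[u <-]]; first by exists 0; rewrite raddf0.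
by rewrite (u0 u) !raddf0.
Qed.

Lemma ses_zerol (R : pzRingType) (U V W : lmodType R) (i : {linear U -> V})
    (p : {linear V -> W}) :
  short_exact i p -> (forall w : W, w = 0) -> surjective i.
Proof. by move=> ip w0 v; apply: (ses_lift ip). Qed.

(** * The functors T, L, H and Z on maps and extensions *)

Section Functors.
Variables (A B : pzRingType) (N : bimodType A B) (M : bimodType B A).
Variable D : morita_datum N M.
Local Notation quad := (quadruple D).
Local Notation killed := (@killed A (im_psi D)).
Local Notation psit n m := (psi D (tens n m) : A).
Local Notation phit m n := (phi D (tens m n) : B).
Implicit Types (q : quad) (Y : lmodType B) (L : lmodType A).

(** The g of [Tq] is the identity, so the first component has to be [qg q] after N (x) s. *)
Lemma Tq_hom Y q (s : {linear Y -> qY q}) :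
  exists h : qhom (Tq D Y) q, forall y, hY h y = s y.
Proof.
have hf m x : s (qf (Tq D Y) (tens m x)) = qf q (tens m ((qg q \o tmap N s) x)).
  apply: (tensor_eq (f := fun x => s (qf (Tq D Y) (tens m x)))
    (g := fun x => qf q (tens m ((qg q \o tmap N s) x)))) x => [u v|u v|n y].
  - by rewrite tensBr !raddfB.
  - by rewrite raddfB tensBr raddfB.
  - rewrite [qf (Tq D Y) _]mactE linearZ_LR -[(_ \o _) _]/(qg q (tmap N s _)).
    by rewrite tmapE qfg.
have hg n y : (qg q \o tmap N s) (qg (Tq D Y) (tens n y)) = qg q (tens n (s y)).
  by rewrite -[LHS]/(qg q (tmap N s (tens n y))) tmapE.
by exists (Qhom hf hg).
Qed.

Lemma Tq_homX Y q (h : qhom (Tq D Y) q) t : hX h t = qg q (tmap N (hY h) t).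
Proof. exact: (qhom_gt h t). Qed.

Lemma Lq_hom (P : lmodType A) q (s : {linear P -> qX q}) :
  exists h : qhom (Lq D P) q, forall x, hX h x = s x.
Proof.
have hf m x : (qf q \o tmap M s) (qf (Lq D P) (tens m x)) = qf q (tens m (s x)).
  by rewrite -[LHS]/(qf q (tmap M s (tens m x))) tmapE.
have hg n x : s (qg (Lq D P) (tens n x)) = qg q (tens n ((qf q \o tmap M s) x)).
  apply: (tensor_eq (f := fun x => s (qg (Lq D P) (tens n x)))
    (g := fun x => qg q (tens n ((qf q \o tmap M s) x)))) x => [u v|u v|m y].
  - by rewrite tensBr !raddfB.
  - by rewrite raddfB tensBr raddfB.
  - rewrite [qg (Lq D P) _]mactE linearZ_LR -[(_ \o _) _]/(qf q (tmap M s _)).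
    by rewrite tmapE qgf.
by exists (Qhom hf hg).
Qed.

Lemma Hq_hom Y q (s : {linear qY q -> Y}) :
  exists h : qhom q (Hq D Y), forall y, hY h y = s y.
Proof.
pose k : {linear qX q -> lhom M Y} := lhom_post M s \o adj (qf q).
have kE x m : lhom_fun (k x) m = s (qf q (tens m x)) by [].
have hf m x : s (qf q (tens m x)) = qf (Hq D Y) (tens m (k x)).
  by rewrite HqE kE.
have hg n y : k (qg q (tens n y)) = qg (Hq D Y) (tens n (s y)).
  by apply: lhomP => m; rewrite HqgE kE qfg linearZ_LR.
by exists (@Qhom _ _ _ _ _ q (Hq D Y) k s hf hg).
Qed.

Lemma Hq_homX Y q (h : qhom q (Hq D Y)) x m :
  lhom_fun (hX h x) m = hY h (qf q (tens m x)).
Proof. by rewrite qhom_f HqE. Qed.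

Lemma Zq_hom_from L (kL : killed L) q (h : {linear L -> qX q}) :
  (forall m l, qf q (tens m (h l)) = 0) ->
  exists k : qhom (Zq kL) q, forall x, hX k x = h x.
Proof.
move=> h0.
have hf m (x : L) : (\0 : {linear zero_mod B ->
  qY q}) (qf (Zq kL) (tens m x)) = qf q (tens m (h x)).
  by rewrite h0.
have hg n (y : zero_mod B) : h (qg (Zq kL) (tens n y)) =
    qg q (tens n ((\0 : {linear zero_mod B -> qY q}) y)).
  by rewrite -[qg (Zq kL) _]/(0 : L) raddf0 tens0r raddf0.
by exists (@Qhom _ _ _ _ _ (Zq kL) q h \0 hf hg).
Qed.

Lemma Zq_hom_to L (kL : killed L) q (h : {linear qX q -> L}) :
  (forall n y, h (qg q (tens n y)) = 0) ->
  exists k : qhom q (Zq kL), forall x, hX k x = h x.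
Proof.
move=> h0.
have hf m (x : qX q) : (\0 : {linear qY q ->
  zero_mod B}) (qf q (tens m x)) = qf (Zq kL) (tens m (h x)) by [].
have hg n (y : qY q) : h (qg q (tens n y)) =
    qg (Zq kL) (tens n ((\0 : {linear qY q -> zero_mod B}) y)) by rewrite h0.
by exists (@Qhom _ _ _ _ _ q (Zq kL) h \0 hf hg).
Qed.

Lemma killed_of_zero q : (forall y : qY q, y = 0) -> killed (qX q).
Proof.
move=> y0 a x /asboolP[t <-]; elim/tensor_ind: t => [|s t es et|n m].
- by rewrite raddf0 scale0r.
- by rewrite raddfB scalerBl es et subrr.
- by rewrite -qgf (y0 (qf q _)) tens0r raddf0.
Qed.

Lemma killed_coker q : killed (cokernel (qg q)).
Proof.
move=> a x /asboolP[t <-]; have [{}x <-] := @coker_pi_surj _ _ _ (qg q) x.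
rewrite -linearZ_LR; apply/coker_pi_eq0.
elim/tensor_ind: t => [|s t [u us] [v vt]|n m].
- by exists 0; rewrite !raddf0 scale0r.
- by exists (u - v); rewrite [LHS]raddfB /= us vt -scalerBl -raddfB.
- by exists (tens n (qf q (tens m x))); rewrite qgf.
Qed.

Lemma killed_ker q : killed (kernel (adj (qf q))).
Proof.
move=> a x /asboolP[t <-]; apply: val_inj; rewrite linearZ_LR /=.
have x0 m : qf q (tens m (val x)) = 0.
  have /eqP fx := valP x.
  by rewrite -[LHS]/(lhom_fun (adj (qf q) (val x)) m) fx.
elim/tensor_ind: t => [|s t es et|n m].
- by rewrite raddf0 scale0r.
- by rewrite raddfB scalerBl es et subrr.
- by rewrite -qgf x0 tens0r raddf0.
Qed.

(** A section of [hY p] yields a map out of [Tq] by adjunction. It is a section in the first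
    component too, since maps out of [Tq] are determined by their second component. *)
Lemma qsplits_Tq Y q : splits Y (qY q) -> qsplits (Tq D Y) q.
Proof.
move=> /splitsP YY; apply/qsplits_sectionP => q1 i p [_ ipY].
have [s sK] := YY _ _ _ ipY; have [h hE] := Tq_hom s; exists h.
have hK : cancel (hY h) (hY p) by move=> y; rewrite hE sK.
split=> // t; have := Tq_homX (qcomp p h) t; rewrite /= => ->.
by apply: (@tmap_id _ _ N).
Qed.

Lemma qsplits_Hq Y q : splits (qY q) Y -> qsplits q (Hq D Y).
Proof.
move=> YY; apply/qsplitsP => q1 i p [_ ipY].
have [r rK] := YY _ _ _ ipY; have [h hE] := Hq_hom r; exists h.
have hK : cancel (hY i) (hY h) by move=> y; rewrite hE rK.
split=> // t; apply: lhomP => m; apply: etrans (Hq_homX (qcomp h i) t m) _.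
by rewrite HqE; apply: hK.
Qed.

Lemma qsplits_Tq_Zq Y L (kL : killed L) : qsplits (Tq D Y) (Zq kL).
Proof. apply: qsplits_Tq; exact: splits_zeror. Qed.

Lemma qsplits_Zq_Hq Y L (kL : killed L) : qsplits (Zq kL) (Hq D Y).
Proof. apply: qsplits_Hq; exact: splits_zerol. Qed.

Lemma Zq_ses L L' L'' (kL : killed L) (kL' : killed L') (kL'' : killed L'')
    (i : {linear L -> L'}) (p : {linear L' -> L''}) : short_exact i p ->
  exists (i' : qhom (Zq kL) (Zq kL')) (p' : qhom (Zq kL') (Zq kL'')),
    [/\ qses i' p', hX i' =1 i & hX p' =1 p].
Proof.
move=> ip; have [|i' i'E] := Zq_hom_from kL (q := Zq kL') (h := i) => //.
have [|p' p'E] := Zq_hom_to kL'' (q := Zq kL') (h := p).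
  by move=> n y; exact: (raddf0 p).
exists i', p'; split=> //; split; first exact: ses_ext ip.
by apply: ses_isol => [x y _||x]; rewrite ?[x]zero_modP ?[y]zero_modP //;
  move=> x; exists 0; rewrite [x]zero_modP raddf0.
Qed.

Lemma qsplits_Zq_Zq L L' (kL : killed L) (kL' : killed L') :
  qsplits (Zq kL) (Zq kL') <-> splits_killed (im_psi D) L L'.
Proof.
split=> [/qsplitsP LL' E i p kE ip|LL'].
  have [i' [p' [ip' i'E _]]] := Zq_ses kL' kE kL ip.
  have [r [rK _]] := LL' _ _ _ ip'.
  by exists (hX r) => x; rewrite -i'E rK.
apply/qsplitsP => q1 i p [ipX ipY].
have y0 (y : qY q1) : y = 0.
  by have [u <-] := ses_zerol ipY (@zero_modP B) y; rewrite [u]zero_modP raddf0.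
have [r rK] := LL' _ _ _ (killed_of_zero y0) ipX.
have [|h hE] := Zq_hom_to kL' (h := r).
  by move=> n y; rewrite (y0 y) tens0r !raddf0.
by exists h; split=> x; rewrite ?hE ?rK // [x]zero_modP !raddf0.
Qed.

Lemma coker_qses q : injective (qg q) ->
  exists (i : qhom (Tq D (qY q)) q) (p : qhom q (Zq (@killed_coker q))),
    [/\ qses i p, forall y, hY i y = y & forall x, hX p x = coker_pi (qg q) x].
Proof.
move=> gi; have [i iE] := @Tq_hom _ q (idfun : {linear qY q -> qY q}).
have iX t : hX i t = qg q t.
  by rewrite Tq_homX; congr (qg q _); apply: (@tmap_id _ _ N).
have [|p pE] := Zq_hom_to (@killed_coker q) (h := coker_pi (qg q)).
  by move=> n y; apply/coker_pi_eq0; exists (tens n y).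
exists i, p; split=> //; split.
  exact: (ses_ext (i := qg q) _ _ (cokernel_ses gi)).
apply: ses_isol => [x y|y|y]; first by rewrite !iE.
  by exists y; rewrite iE.
exact: zero_modP.
Qed.

Lemma ker_qses q : surjective (adj (qf q)) ->
  exists (i : qhom (Zq (@killed_ker q)) q) (p : qhom q (Hq D (qY q))),
    [/\ qses i p, forall y, hY p y = y & forall x, hX i x = val x].
Proof.
move=> fs; have [p pE] := @Hq_hom _ q (idfun : {linear qY q -> qY q}).
have pX x : hX p x = adj (qf q) x.
  by apply: lhomP => m; rewrite Hq_homX pE.
have lv : linear (val : kernel (adj (qf q)) -> qX q) by [].
have v0 (x : kernel (adj (qf q))) : adj (qf q) (val x) = 0 by apply/eqP/(valP x).
have [|i iE] := Zq_hom_from (@killed_ker q) (h := mklin lv).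
  by move=> m x; rewrite -[LHS]/(lhom_fun (adj (qf q) (val x)) m) v0.
exists i, p; split=> //; split.
  split=> [x y|x|h]; first by rewrite !iE => /val_inj.
    rewrite pX; split=> [/eqP x0|[u <-]]; last by rewrite iE v0.
    by exists (Sub x x0); rewrite iE.
  by have [x <-] := fs h; exists x; rewrite pX.
apply: ses_isor => [x y|y|y]; first by rewrite !pE.
  by exists y; rewrite pE.
exact: zero_modP.
Qed.

Lemma Tq_ses (U V W : lmodType B) (i : {linear U -> V}) (p : {linear V -> W}) :
  Tor1_eq0 N W -> short_exact i p ->
  exists (i' : qhom (Tq D U) (Tq D V)) (p' : qhom (Tq D V) (Tq D W)),
    [/\ qses i' p', hY i' =1 i & hY p' =1 p].
Proof.
move=> tor ip; have [ii e ps] := ip.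
have [i' i'E] := @Tq_hom _ (Tq D V) i; have [p' p'E] := @Tq_hom _ (Tq D W) p.
have i'X t : hX i' t = tmap N i t.
  by rewrite Tq_homX; apply: (@tmap_eq _ _ N).
have p'X t : hX p' t = tmap N p t.
  by rewrite Tq_homX; apply: (@tmap_eq _ _ N).
exists i', p'; split=> //; split; last by apply: ses_ext ip.
apply: (ses_ext (i := tmap N i) (p := tmap N p)) => //; split.
- exact: Tor1_tmap_inj ip.
- exact: tmap_exact.
- exact: tmap_surj.
Qed.

Lemma Hq_ses (U V W : lmodType B) (i : {linear U -> V}) (p : {linear V -> W}) :
  Ext1_eq0 M U -> short_exact i p ->
  exists (i' : qhom (Hq D U) (Hq D V)) (p' : qhom (Hq D V) (Hq D W)),
    [/\ qses i' p', hY i' =1 i & hY p' =1 p].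
Proof.
move=> /Ext1P MU ip; have [ii e ps] := ip.
have [i' i'E] := @Hq_hom _ (Hq D U) i; have [p' p'E] := @Hq_hom _ (Hq D V) p.
have i'X h m : lhom_fun (hX i' h) m = i (lhom_fun h m) by rewrite Hq_homX i'E HqE.
have p'X h m : lhom_fun (hX p' h) m = p (lhom_fun h m) by rewrite Hq_homX p'E HqE.
exists i', p'; split=> //; split; last by apply: ses_ext ip.
split=> [h h' hh'|h|h].
- by apply: lhomP => m; apply: ii; rewrite -!i'X hh'.
- split=> [ph|[k <-]]; last first.
    by apply: lhomP => m; rewrite p'X i'X (ses0 _ ip).
  have [|k kE] := factor_inj (h := lhom_fun h) ii.
    by move=> m; apply: (ses_lift ip); rewrite -p'X ph.
  by exists k; apply: lhomP => m; rewrite i'X.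
- have [k kE] := splits_lift (lhom_fun h) ip MU.
  by exists k; apply: lhomP => m; rewrite p'X.
Qed.

(* Push [T i, T p] out along the counit [T (qY q) -> q]. *)
Lemma splits_of_Tq Y q : Tor1_eq0 N Y -> qsplits (Tq D Y) q -> splits Y (qY q).
Proof.
move=> tor /qsplitsP TY E i p ip.
have [i' [p' [ip' i'E p'E]]] := Tq_ses tor ip.
have [h hE] := @Tq_hom _ q (idfun : {linear qY q -> qY q}).
have [q1 [i1 [p1 [k [ip1 [_ kY] _]]]]] := qpushout h ip'.
have [r [_ rY]] := TY _ _ _ ip1.
by exists (hY r \o hY k) => y; rewrite /= -i'E kY rY hE.
Qed.

(** Dually, the sequence of the [Hq] is pulled back along the unit [q -> Hq (qY q)], the identity on
    second components. *)
Lemma splits_of_Hq Y q : Ext1_eq0 M Y -> qsplits q (Hq D Y) -> splits (qY q) Y.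
Proof.
move=> ext /qsplits_sectionP HY; apply/splitsP => E i p ip.
have [i' [p' [ip' i'E p'E]]] := Hq_ses ext ip.
have [h hE] := @Hq_hom _ q (idfun : {linear qY q -> qY q}).
have [q1 [i1 [p1 [k [ip1 _ [_ kY]]]]]] := qpullback h ip'.
have [r [_ rY]] := HY _ _ _ ip1.
by exists (hY k \o hY r) => y; rewrite /= -p'E kY rY hE.
Qed.
End Functors.

(** * Monic g and epic adjoint of f *)

Section Covers.
Variables (A B : pzRingType) (N : bimodType A B) (M : bimodType B A).
Variable D : morita_datum N M.
Hypothesis psi_inj : injective (psi D).
Local Notation quad := (quadruple D).
Local Notation killed := (@killed A (im_psi D)).
Local Notation psit n m := (psi D (tens n m) : A).
Local Notation phit m n := (phi D (tens m n) : B).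
Implicit Types (q : quad) (Y : lmodType B) (L : lmodType A).

(* For [P] free with coordinates [c s], the component [c s (g t)] is the image
   under [psi] of the component of [t] in [N (x) M]. *)
Lemma Lq_inj (S : choiceType) : injective (qg (Lq D (free_mod A S))).
Proof.
set P := free_mod A S.
pose b (s : S) (m : M) (p : P) : M := rscale m (free_coord A s p : A).
have bb s : balanced (b s).
  split=> [m m' p|m p p'|m a p]; rewrite /b.
  - exact: rscalerDl.
  - by rewrite raddfD rscalerDr.
  - by rewrite rscalerA linearZ_LR.
have bZ s c m p : b s (c *: m) p = c *: b s m p by rewrite /b bimodA.
pose k s : {linear tensor M P -> M} := tlin (bb s) (bZ s).
have kE s m p : k s (tens m p) = rscale m (free_coord A s p : A) by apply: tlinE.
have lj s : linear (fun m : M => tens m (free_gen A s) : tensor M P).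
  by move=> a u v; rewrite tensDl tensZ.
pose j s : {linear M -> tensor M P} := mklin (lj s).
have wP (w : tensor M P) : finitely_decomposed (fun s w => j s (k s w)) w.
  elim/tensor_ind: w => [|w w' wP w'P|m p].
  - by exists [::] => l _ _; rewrite big1 // => s _; rewrite !raddf0.
  - by apply: finitely_decomposedB => // s u v; rewrite !raddfB.
  - have [l lP] := free_decomp p; exists l => l' ul sl.
    rewrite {1}(lP l' ul sl) tens_sum; apply: eq_bigr => s _.
    by rewrite kE -tensM.
have tP (t : tensor N (tensor M P)) :
    finitely_decomposed (fun s t => tmap N (j s) (tmap N (k s) t)) t.
  elim/tensor_ind: t => [|t t' tP t'P|n w].
  - by exists [::] => l _ _; rewrite big1 // => s _; rewrite !raddf0.
  - by apply: finitely_decomposedB => // s u v; rewrite !raddfB.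
  - have [l lP] := wP w; exists l => l' ul sl.
    rewrite {1}(lP l' ul sl) tens_sum; apply: eq_bigr => s _.
    by rewrite !tmapE.
have cE s t : free_coord A s (qg (Lq D P) t) = psi D (tmap N (k s) t) :> A.
  apply: (tensor_eq (f := fun t => (free_coord A s (qg (Lq D P) t) : A))
    (g := fun t => (psi D (tmap N (k s) t) : A))) t => [u v|u v|n w].
  - by rewrite !raddfB.
  - by rewrite !raddfB.
  apply: (tensor_eq (f := fun w => (free_coord A s (qg (Lq D P) (tens n w)) : A))
    (g := fun w => (psi D (tmap N (k s) (tens n w)) : A))) w => [u v|u v|m p].
  - by rewrite tensBr !raddfB.
  - by rewrite tensBr !raddfB.
  rewrite [qg (Lq D P) _]mactE linearZ_LR tmapE kE -tens_rscale psi_rlinear.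
  by [].
apply: linear_inj => t t0; have [l lP] := tP t.
rewrite (lP (undup l)) ?undup_uniq // => [|s]; last by rewrite mem_undup.
rewrite big1 // => s _; have -> : tmap N (k s) t = 0; last by rewrite raddf0.
by apply: (raddf_inj_eq0 psi_inj); rewrite -cE t0 raddf0.
Qed.

(** The cokernel is P / IP. A lift of P -> P / IP to a killed module kills IP, so it descends to a
    section. *)
Lemma projective_splits_killed (P : lmodType A) L : projective P ->
  splits_killed (im_psi D) (cokernel (qg (Lq D P))) L.
Proof.
move=> pP E i p kE ip; apply/(retraction_section ip); have [_ _ ps] := ip.
have [h hE] := pP _ _ p (coker_pi (qg (Lq D P))) ps.
have h0 t : h (qg (Lq D P) t) = 0.
  elim/tensor_ind: t => [|t t' t0 t0'|n w]; first by rewrite !raddf0.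
    by rewrite !raddfB /= t0 t0' subrr.
  elim/tensor_ind: w => [|t t' t0 t0'|m x]; first by rewrite tens0r !raddf0.
    by rewrite tensBr !raddfB /= t0 t0' subrr.
  by rewrite [qg (Lq D P) _]mactE linearZ_LR /= kE // psi_im.
have [|s sE] := factor_surj (h := h) (@coker_pi_surj _ _ _ (qg (Lq D P))).
  by move=> x /coker_pi_eq0[t <-].
exists s => c; have [x <-] := @coker_pi_surj _ _ _ (qg (Lq D P)) c.
by rewrite sE -hE.
Qed.

(* Pushing [T(M (x) P) -> L P -> Z(P / IP)] out along the map
   [T(M (x) P) -> q] adjoint to [s] makes the maps [s x] come from [qX]. *)
Lemma adjoin_maps (S : choiceType) q (s : {linear free_mod A S -> lhom M (qY q)}) :
  exists (q1 : quad) (i : qhom q q1)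
    (p : qhom q1 (Zq (@killed_coker _ _ _ _ _ (Lq D (free_mod A S)))))
    (k : free_mod A S -> qX q1),
  qses i p /\ forall m x, qf q1 (tens m (k x)) = hY i (lhom_fun (s x) m).
Proof.
set P := free_mod A S.
have [i0 [p0 [ip0 i0E _]]] := coker_qses (@Lq_inj S).
have bb : balanced (fun (m : M) (x : P) => lhom_fun (s x) m).
  split=> [m m' x|m x x'|m a x]; rewrite ?raddfD //.
  by rewrite linearZ_LR.
have bZ b m x : lhom_fun (s x) (b *: m) = b *: lhom_fun (s x) m by rewrite linearZ_LR.
have [h hE] := @Tq_hom _ _ _ _ D (tensor M P) q (tlin bb bZ).
have [q1 [i [p [k [ip [_ kY] _]]]]] := qpushout h ip0.
exists q1, i, p, (hX k); split=> // m x.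
have -> : qf q1 (tens m (hX k x)) = hY k (tens m x) by rewrite -qhom_f.
have := kY (tens m x); rewrite i0E => ->.
by rewrite hE tlinE.
Qed.

Lemma sumq_hom q q1 q2 (h1 : qhom q1 q) (h2 : qhom q2 q) :
  exists h : qhom (sumq q1 q2) q,
    (forall x, hX h x = hX h1 x.1 + hX h2 x.2) /\
    (forall y, hY h y = hY h1 y.1 + hY h2 y.2).
Proof.
have [f fE] := copair_linear (hX h1) (hX h2).
have [g gE] := copair_linear (hY h1) (hY h2).
have hf m x : g (qf (sumq q1 q2) (tens m x)) = qf q (tens m (f x)).
  by rewrite gE sumq_fE fE tensDr raddfD /= -!qhom_f.
have hg n y : f (qg (sumq q1 q2) (tens n y)) = qg q (tens n (g y)).
  by rewrite fE sumq_gE gE tensDr raddfD /= -!qhom_g.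
by exists (@Qhom _ _ _ _ _ (sumq q1 q2) q f g hf hg).
Qed.

(** The sum of L F, with F a free cover of the first component, and T of the second component maps
    onto [q], and g is monic on both summands. *)
Lemma mono_cover q :
  exists (q0 q1 : quad) (i : qhom q0 q1) (p : qhom q1 q), qses i p /\ injective (qg q1).
Proof.
have [c cs] := free_cover (qX q).
have [h1 h1E] := @Lq_hom _ _ _ _ D _ q c.
have [h2 h2E] := @Tq_hom _ _ _ _ D _ q (idfun : {linear qY q -> qY q}).
have [p [pX pY]] := sumq_hom h1 h2.
have [||q0 [i ip]] := qkernel (p := p).
- move=> x; have [y <-] := cs x; exists (y, 0).
  by rewrite pX /= h1E raddf0 addr0.
- by move=> y; exists (0, y); rewrite pY /= h2E raddf0 add0r.
exists q0, (sumq (Lq D (free_mod A (qX q))) (Tq D (qY q))), i, p; split=> //.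
by apply: sumq_inj => //; exact: Lq_inj.
Qed.

Lemma qextend q q' q'' q0 (i : qhom q q') (p : qhom q' q'') (h : qhom q q0) :
  qses i p -> qsplits q'' q0 ->
  exists k : qhom q' q0, forall x, hX k (hX i x) = hX h x.
Proof.
move=> ip /qsplitsP qq; have [q1 [i1 [p1 [k [ip1 [kX _] _]]]]] := qpushout h ip.
have [r [rX _]] := qq _ _ _ ip1.
by exists (qcomp r k) => x; rewrite /= kX rX.
Qed.

(** The adjoined elements [k x] of [qX q1] represent the maps [s x]; a retraction [q1 -> q] carries
    them into [qX q]. *)
Lemma surj_of_Zq q (S : choiceType) (s : {linear free_mod A S -> lhom M (qY q)}) :
  surjective s ->
  qsplits (Zq (@killed_coker _ _ _ _ _ (Lq D (free_mod A S)))) q ->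
  surjective (adj (qf q)).
Proof.
move=> ss /qsplitsP Zs; have [q1 [i [p [k [ip kE]]]]] := adjoin_maps s.
have [r [_ rY]] := Zs _ _ _ ip.
move=> h; have [x <-] := ss h; exists (hX r (k x)); apply: lhomP => m.
by rewrite -[LHS]/(qf q (tens m (hX r (k x)))) -qhom_f kE rY.
Qed.

(** An extension of Z L by Z (Ker f~) is pushed out to [q] and split there. Its middle term has zero
    second component, so the resulting map to [q] lands in Ker f~. *)
Lemma qsplits_ker q L (kL : killed L) : surjective (adj (qf q)) ->
  qsplits (Zq kL) q -> qsplits (Zq kL) (Zq (@killed_ker _ _ _ _ _ q)).
Proof.
move=> fs /qsplitsP Lq'; have [i [p [ip _ iE]]] := ker_qses fs.
apply/qsplitsP => q1 i1 p1 ip1.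
have y0 (y : qY q1) : y = 0.
  by have [u <-] := ses_zerol ip1.2 (@zero_modP B) y; rewrite [u]zero_modP raddf0.
have [q2 [i2 [p2 [k [ip2 [kX _] _]]]]] := qpushout i ip1.
have [r [rX _]] := Lq' _ _ _ ip2.
pose c := qcomp r k.
have c0 x : adj (qf q) (hX c x) == 0.
  by apply/eqP/lhomP => m; rewrite -[LHS]/(qf q (tens m (hX c x))) -qhom_f (y0 (qf
    _ _)) raddf0.
have lc : linear (fun x => Sub (hX c x) (c0 x) : kernel (adj (qf q))).
  by move=> a u v; apply: val_inj; rewrite /= !linearP.
have [|h hE] := Zq_hom_to (@killed_ker _ _ _ _ _ q) (h := mklin lc).
  by move=> n y; apply: val_inj; rewrite (y0 y) tens0r !raddf0.
exists h; split=> x; last by rewrite [x]zero_modP !raddf0.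
by rewrite hE; apply: val_inj; rewrite /= kX rX iE.
Qed.

(** Dually, the pullback to [q] has a section. The middle term has zero second component, so the
    resulting map from [q] vanishes on Im g and descends to Coker g. *)
Lemma qsplits_coker q L (kL : killed L) : injective (qg q) ->
  qsplits q (Zq kL) -> qsplits (Zq (@killed_coker _ _ _ _ _ q)) (Zq kL).
Proof.
move=> gi /qsplits_sectionP qL; have [i [p [ip _ pE]]] := coker_qses gi.
apply/qsplits_sectionP => q1 i1 p1 ip1.
have y0 (y : qY q1) : y = 0.
  by have [u <-] := ses_zerol ip1.2 (@zero_modP B) y; rewrite [u]zero_modP raddf0.
have [q2 [i2 [p2 [k [ip2 _ [kX _]]]]]] := qpullback p ip1.
have [r [rX _]] := qL _ _ _ ip2.
pose c := qcomp k r.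
have [|s sE] := factor_surj (h := hX c) (@coker_pi_surj _ _ _ (qg q)).
  move=> x /coker_pi_eq0[t <-].
  by rewrite qhom_gt (tmap0 (M := N)) ?raddf0 // => y; apply: y0.
have [|h hE] := Zq_hom_from (@killed_coker _ _ _ _ _ q) (h := s).
  by move=> m x; apply: y0.
exists h; split=> x; last by rewrite [x]zero_modP !raddf0.
by have [u <-] := @coker_pi_surj _ _ _ (qg q) x; rewrite hE sE /= kX rX pE.
Qed.

(* Let [q0 -> q1 -> q] be exact with [g1] injective. By the snake lemma
   [Ker g] embeds into [Coker g0] by a connecting map [u |-> w]. A map from
   [Coker g0] to an [A/I]-module is a map [q0 -> Z _]; if it extends to [q1] it
   kills [g1 u], the image of [w]. *)
Lemma inj_of_Zq q :
  qsplits q (Zq (@restr_killed A (im_psi D) (char_mod (A_mod_psi D)))) ->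
  injective (qg q).
Proof.
move=> qD; have [q0 [q1 [i [p [ip gi]]]]] := mono_cover q.
apply: linear_inj => t t0.
have [[iX eX pX] [iY eY pY]] := ip; have [u uE] := tmap_surj N pY t.
have /eX[w wE] : hX p (qg q1 u) = 0 by rewrite qhom_gt uE.
have /coker_pi_eq0[t' t'E] : coker_pi (qg q0) w = 0.
  have [v [_ _ /(_ (@killed_coker _ _ _ _ _ q0)) vi]] :=
    bar_unit (im_psi D) (cokernel (qg q0)).
  apply: (raddf_inj_eq0 vi); apply/eqP/negP => /negP/(@char_mod_cogenerates
    (A_mod_psi D))[h].
  pose c := res_map h \o v \o coker_pi (qg q0).
  have [|c' c'E] := Zq_hom_to (@restr_killed A (im_psi D) (char_mod (A_mod_psi D)))
      (q := q0) (h := c).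
    move=> n y; rewrite -[LHS]/(res_map h (v (coker_pi (qg q0) _))).
    have -> : coker_pi (qg q0) (qg q0 (tens n y)) = 0 by apply/coker_pi_eq0;
      exists (tens n y).
    by rewrite !raddf0.
  have [k kE] := qextend c' ip qD.
  move=> /eqP; apply; apply: etrans (esym (c'E w)) _.
  by rewrite -kE wE qhom_gt.
rewrite -uE; have -> : u = tmap N (hY i) t' by apply: gi; rewrite -wE -t'E qhom_gt.
rewrite (tmap_comp (h := \0)) ?(tmap0 (M := N)) // => y /=.
by apply/eY; exists y.
Qed.
End Covers.

(** * Membership in the two classes as orthogonality *)

Section CotorsionClasses.
Variables (A B : pzRingType) (N : bimodType A B) (M : bimodType B A).
Variable D : morita_datum N M.
Variables (C' D' : mod_class (A_mod_psi D)) (C'' D'' : mod_class B).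
Hypothesis cot' : cotorsion_pair C' D'.
Hypothesis cot'' : cotorsion_pair C'' D''.
Hypothesis psi_inj : injective (psi D).
Local Notation quad := (quadruple D).
Local Notation killed := (@killed A (im_psi D)).
Local Notation bar := (@bar A (im_psi D)).
Implicit Types (q : quad) (Y : lmodType B) (L : lmodType A).

Definition quad_M q :=
  [/\ C' (bar (cokernel (qg q))), C'' (qY q) & injective (qg q)].
Definition quad_N q :=
  [/\ D' (bar (kernel (adj (qf q)))), D'' (qY q) & surjective (adj (qf q))].

Lemma splits_killed_cotorsion L L' : killed L -> killed L' ->
  C' (bar L) -> D' (bar L') -> splits_killed (im_psi D) L L'.
Proof. by move=> kL kL' CL DL; apply/bar_splits => //;
  apply: (cotorsionL cot' _).1 CL _ DL. Qed.

(** Every module over A/I is [bar] of its restriction, so killed A-modules are enough test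
    objects. *)
Lemma killed_cotorsionL L : killed L ->
  (forall L', killed L' -> D' (bar L') -> splits_killed (im_psi D) L L') -> C' (bar L).
Proof.
move=> kL LP; apply/(cotorsionL cot') => U DU; have UU := bar_restr U.
apply: (splits_iso (C := bar L) (X := bar (restr U))) => //;
  first by exists idfun, idfun.
apply/bar_splits => //; first exact: restr_killed.
apply: LP; first exact: restr_killed.
exact: (cotorsion_isoR cot') (lmod_iso_sym UU) DU.
Qed.

Lemma killed_cotorsionR L : killed L ->
  (forall L', killed L' -> C' (bar L') -> splits_killed (im_psi D) L' L) -> D' (bar L).
Proof.
move=> kL LP; apply/(cotorsionR cot') => U DU; have UU := bar_restr U.
apply: (splits_iso (C := bar (restr U)) (X := bar L)) => //;
  first by exists idfun, idfun.
apply/bar_splits => //; first exact: restr_killed.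
apply: LP; first exact: restr_killed.
exact: (cotorsion_isoL cot') (lmod_iso_sym UU) DU.
Qed.

Lemma qsplits_Tq_N q Y : quad_N q -> C'' Y -> qsplits (Tq D Y) q.
Proof. by move=> [_ DY _] CY; apply: qsplits_Tq;
  apply: (cotorsionL cot'' _).1 CY _ DY. Qed.

Lemma qsplits_M_Hq q Y : quad_M q -> D'' Y -> qsplits q (Hq D Y).
Proof. by move=> [_ CY _] DY; apply: qsplits_Hq;
  apply: (cotorsionL cot'' _).1 CY _ DY. Qed.

Lemma qsplits_Zq_N q L (kL : killed L) : quad_N q -> C' (bar L) -> qsplits (Zq kL) q.
Proof.
move=> [DK _ fs] CL; have [i [p [ip _ _]]] := ker_qses fs.
apply: (splits_extr ((qses_quad_map i p).1 ip)); last exact: qsplits_Zq_Hq.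
by apply/qsplits_Zq_Zq/splits_killed_cotorsion => //; exact: killed_ker.
Qed.

Lemma qsplits_M_Zq q L (kL : killed L) : quad_M q -> D' (bar L) -> qsplits q (Zq kL).
Proof.
move=> [CK _ gi] DL; have [i [p [ip _ _]]] := coker_qses gi.
apply: (splits_extl ((qses_quad_map i p).1 ip)); first exact: qsplits_Tq_Zq.
by apply/qsplits_Zq_Zq/splits_killed_cotorsion => //; exact: killed_coker.
Qed.

Lemma cotorsion_Lq_coker (P : lmodType A) :
  projective P -> C' (bar (cokernel (qg (Lq D P)))).
Proof.
move=> pP; apply: killed_cotorsionL; first exact: killed_coker.
by move=> L kL _; apply: projective_splits_killed.
Qed.

Hypothesis tor : forall Y, C'' Y -> Tor1_eq0 N Y.

Lemma quad_N_of_splits q :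
  (forall Y, C'' Y -> qsplits (Tq D Y) q) ->
  (forall L (kL : killed L), C' (bar L) -> qsplits (Zq kL) q) -> quad_N q.
Proof.
move=> Tsq Zsq; have fs : surjective (adj (qf q)).
  have [s ss] := free_cover (lhom M (qY q)).
  apply: (surj_of_Zq psi_inj ss); apply: Zsq.
  exact: cotorsion_Lq_coker (@free_projective _ _).
split=> //.
- apply: killed_cotorsionR => [|L kL CL]; first exact: killed_ker.
  by apply/(qsplits_Zq_Zq kL (@killed_ker _ _ _ _ _ q)); apply: qsplits_ker => //;
    apply: Zsq.
- apply/(cotorsionR cot'') => Y CY; apply: splits_of_Tq; first exact: tor.
  exact: Tsq.
Qed.
End CotorsionClasses.

Section CotorsionClassM.
Variables (A B : pzRingType) (N : bimodType A B) (M : bimodType B A).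
Variable D : morita_datum N M.
Variables (C' D' : mod_class (A_mod_psi D)) (C'' D'' : mod_class B).
Hypothesis cot' : cotorsion_pair C' D'.
Hypothesis cot'' : cotorsion_pair C'' D''.
Hypothesis psi_inj : injective (psi D).
Hypothesis ext : forall Y, D'' Y -> Ext1_eq0 M Y.
Local Notation killed := (@killed A (im_psi D)).
Local Notation bar := (@bar A (im_psi D)).

Lemma quad_M_of_splits (q : quadruple D) :
  (forall Y, D'' Y -> qsplits q (Hq D Y)) ->
  (forall L (kL : killed L), D' (bar L) -> qsplits q (Zq kL)) -> quad_M C' C'' q.
Proof.
move=> qH qZ; have gi : injective (qg q).
  apply: (inj_of_Zq psi_inj); apply: qZ.
  (* The character module is injective, hence in [D'], and is isomorphic to [bar] of its
     restriction. *)
  apply: (cotorsion_isoR cot') (lmod_iso_sym (bar_restr _)) _.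
  by apply/(cotorsionR cot') => U _; apply: char_mod_injective.
split=> //.
- apply: (killed_cotorsionL cot') => [|L kL DL]; first exact: killed_coker.
  by apply/(qsplits_Zq_Zq (@killed_coker _ _ _ _ _ q) kL);
    apply: qsplits_coker => //; apply: qZ.
- apply/(cotorsionL cot'') => Y DY; apply: splits_of_Hq; first exact: ext.
  exact: qH.
Qed.
End CotorsionClassM.

(** * The two classes *)

Lemma lmod_iso_refl (R : pzRingType) (U : lmodType R) : lmod_iso U U.
Proof. by exists idfun, id. Qed.

Lemma splits_isol (R : pzRingType) (C C' X : lmodType R) :
  lmod_iso C C' -> splits C X -> splits C' X.
Proof. by move=> CC; apply: splits_iso CC (lmod_iso_refl X). Qed.

Lemma splits_isor (R : pzRingType) (C X X' : lmodType R) :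
  lmod_iso X X' -> splits C X -> splits C X'.
Proof. exact: splits_iso (lmod_iso_refl C). Qed.

Section MoritaCotorsion.
Variables (A B : pzRingType) (N : bimodType A B) (M : bimodType B A).
Variable D : morita_datum N M.
Variables (C' D' : mod_class (A_mod_psi D)) (C'' D'' : mod_class B).
Hypothesis cot' : cotorsion_pair C' D'.
Hypothesis cot'' : cotorsion_pair C'' D''.
Hypothesis psi_inj : injective (psi D).
Local Notation quad := (quadruple D).
Local Notation killed := (@killed A (im_psi D)).
Local Notation bar := (@bar A (im_psi D)).
Local Notation quad_M := (@quad_M A B N M D C' C'').
Local Notation quad_N := (@quad_N A B N M D D' D'').
Local Notation MC := (@class_M A B N M D C' C'').
Local Notation ND := (@class_N A B N M D D' D'').
Implicit Types (q : quad) (Y : lmodType B) (L : lmodType A).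

Lemma class_M_quad q : quad_M q -> MC (quad_mod q).
Proof. by move=> [? ? ?]; exists q; split=> //; apply: lmod_iso_refl. Qed.

Lemma class_N_quad q : quad_N q -> ND (quad_mod q).
Proof. by move=> [? ? ?]; exists q; split=> //; apply: lmod_iso_refl. Qed.

Lemma class_M_iso V : MC V -> exists2 q, lmod_iso V (quad_mod q) & quad_M q.
Proof. by move=> [q [Vq ? ? ?]]; exists q. Qed.

Lemma class_N_iso V : ND V -> exists2 q, lmod_iso V (quad_mod q) & quad_N q.
Proof. by move=> [q [Vq ? ? ?]]; exists q. Qed.

(** The g of [Tq] is the identity, so Coker g is zero. *)
Lemma quad_M_Tq Y : C'' Y -> quad_M (Tq D Y).
Proof.
move=> CY; split=> //.
have c0 (x : cokernel (qg (Tq D Y))) : x = 0.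
  have [u <-] := @coker_pi_surj _ _ _ (qg (Tq D Y)) x.
  by apply/coker_pi_eq0; exists u.
apply: (killed_cotorsionL cot') => [|L kL _ E i p _ ip]; first exact: killed_coker.
apply/(retraction_section ip); exists \0 => x.
by rewrite [x]c0 /= raddf0.
Qed.

Lemma quad_N_Hq Y : D'' Y -> quad_N (Hq D Y).
Proof.
move=> DY; have adjE (h : lhom M Y) : adj (qf (Hq D Y)) h = h.
  by apply: lhomP => m; apply: HqE.
split=> // [|h]; last by exists h.
have c0 (x : kernel (adj (qf (Hq D Y)))) : x = 0.
  by apply: val_inj; apply: etrans (esym (adjE _)) _; apply/eqP/(valP x).
apply: (killed_cotorsionR cot') => [|L kL _ E i p _ ip]; first exact: killed_ker.
by exists \0 => x; rewrite [x]c0 /=.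
Qed.

Lemma quad_M_Zq L (kL : killed L) : C' (bar L) -> quad_M (Zq kL).
Proof.
move=> CL; have g0 t : qg (Zq kL) t = 0 by [].
split.
- apply: (cotorsion_isoL cot') CL; apply: bar_iso.
  apply: (@lmod_iso_bij _ _ _ (coker_pi (qg (Zq kL)))); last exact: coker_pi_surj.
  by apply: linear_inj => x /coker_pi_eq0[u <-].
- by apply/(cotorsionL cot'') => Y _; apply: splits_zerol.
- apply: linear_inj => t _; elim/tensor_ind: t => [//|s t -> ->|n y].
    by rewrite subrr.
  by rewrite (zero_modP y) tens0r.
Qed.

Lemma quad_N_Zq L (kL : killed L) : D' (bar L) -> quad_N (Zq kL).
Proof.
move=> DL; have h0 (h : lhom M (zero_mod B)) : h = 0.
  by apply: lhomP => m; rewrite [LHS]zero_modP [RHS]zero_modP.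
split.
- apply: (cotorsion_isoR cot') DL; apply: bar_iso; apply: lmod_iso_sym.
  have lv : linear (val : kernel (adj (qf (Zq kL))) -> L) by [].
  apply: (@lmod_iso_bij _ _ _ (mklin lv)) => [|x]; first exact: val_inj.
  have x0 : ker_pred (adj (qf (Zq kL))) x by apply/eqP/h0.
  by exists (Sub x x0).
- by apply/(cotorsionR cot'') => Y _; apply: splits_zeror.
- by move=> h; exists 0; rewrite [RHS]h0 raddf0.
Qed.

Lemma lperp_N V : lperp ND V <-> forall q, quad_N q -> splits V (quad_mod q).
Proof.
rewrite lperp_splits; split=> [NV q /class_N_quad/NV //|Nq U /class_N_iso[q Uq /Nq]].
exact: splits_isor (lmod_iso_sym Uq).
Qed.

Lemma rperp_M V : rperp MC V <-> forall q, quad_M q -> splits (quad_mod q) V.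
Proof.
rewrite rperp_splits; split=> [NV q /class_M_quad/NV //|Nq U /class_M_iso[q Uq /Nq]].
exact: splits_isol (lmod_iso_sym Uq).
Qed.

Let tor_NC := forall Y, C'' Y -> Tor1_eq0 N Y.
Let ext_MD := forall Y, D'' Y -> Ext1_eq0 M Y.

Lemma class_N_of_splits V : tor_NC ->
  (forall Y, C'' Y -> splits (quad_mod (Tq D Y)) V) ->
  (forall L (kL : killed L), C' (bar L) -> splits (quad_mod (Zq kL)) V) -> ND V.
Proof.
move=> tor TV ZV; have [q Vq] := quad_of V.
suff [? ? ?] : quad_N q by exists q.
apply: (quad_N_of_splits cot' cot'' psi_inj tor) => [Y /TV|L kL /(ZV L kL)].
  exact: splits_isor.
exact: splits_isor.
Qed.

Lemma class_M_of_splits V : ext_MD ->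
  (forall Y, D'' Y -> splits V (quad_mod (Hq D Y))) ->
  (forall L (kL : killed L), D' (bar L) -> splits V (quad_mod (Zq kL))) -> MC V.
Proof.
move=> ext VH VZ; have [q Vq] := quad_of V.
suff [? ? ?] : quad_M q by exists q.
apply: (quad_M_of_splits cot' cot'' psi_inj ext) => [Y /VH|L kL /(VZ L kL)].
  exact: splits_isol.
exact: splits_isol.
Qed.

(** One half is formal. For the other, [Tq D Y] and [Zq kL] with [Y] in [C''] and [bar L] in [C']
    lie in [lperp ND], and orthogonality to them already forces membership in [ND]. *)
Lemma cotorsion_N : tor_NC -> cotorsion_pair (lperp ND) ND.
Proof.
move=> tor; split=> // V; split=> [/rperp_splits NV|NV]; last by move=> U; apply.
apply: class_N_of_splits => // [Y CY|L kL CL]; apply/NV/lperp_N => q Nq.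
- exact: qsplits_Tq_N Nq CY.
- exact: qsplits_Zq_N Nq CL.
Qed.

Lemma cotorsion_M : ext_MD -> cotorsion_pair MC (rperp MC).
Proof.
move=> ext; split=> // V; split=> [/lperp_splits NV|NV]; last by move=> U; apply.
apply: class_M_of_splits => // [Y CY|L kL CL]; apply/NV/rperp_M => q Mq.
- exact: qsplits_M_Hq Mq CY.
- exact: qsplits_M_Zq Mq CL.
Qed.

Lemma quad_M_N_splits q q' : quad_M q -> quad_N q' -> qsplits q q'.
Proof.
move=> [CK CY gi] Nq; have [i [p [ip _ _]]] := coker_qses gi.
apply: (splits_extl ((qses_quad_map i p).1 ip)); first exact: qsplits_Tq_N Nq CY.
exact: qsplits_Zq_N Nq CK.
Qed.

(** The quadruples [Hq D Y] and [Zq kL] that detect membership in [MC] themselves satisfy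
    [quad_N]. *)
Lemma class_M_lperp V : ext_MD -> MC V <-> forall q, quad_N q -> splits V (quad_mod q).
Proof.
move=> ext; split=> [/class_M_iso[q Vq Mq] q' Nq'|NV].
  exact: splits_isol (lmod_iso_sym Vq) (quad_M_N_splits Mq Nq').
by apply: class_M_of_splits => // [Y /quad_N_Hq/NV|L kL /(quad_N_Zq kL)/NV].
Qed.

Lemma cotorsion_M_N : tor_NC -> ext_MD -> cotorsion_pair MC ND.
Proof.
move=> tor ext; split=> V.
  split=> [/rperp_M MV|/class_N_iso[q Vq Nq]].
    by apply: class_N_of_splits => // [Y /quad_M_Tq/MV|L kL /(quad_M_Zq kL)/MV].
  apply/rperp_M => q' Mq'.
  exact: splits_isor (lmod_iso_sym Vq) (quad_M_N_splits Mq' Nq).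
by rewrite lperp_N class_M_lperp.
Qed.

(** * The hereditary property *)

Section Hereditary.

(** Vanishing of Tor_1 on [qY q''] makes N (x) Y -> N (x) Y' injective, so g is monic on [q]. As g
    is monic on [q''], the snake lemma makes the sequence of cokernels short exact. *)
Lemma quad_M_epi_kernel q q' q'' (i : qhom q q') (p : qhom q' q'') :
  tor_NC -> epi_kernel_closed C' -> epi_kernel_closed C'' ->
  qses i p -> quad_M q' -> quad_M q'' -> quad_M q.
Proof.
move=> tor her' her'' [ipX ipY] [CK CY gi] [CK' CY' gi'].
have [iX eX pX] := ipX; have [iY eY pY] := ipY.
have ti := Tor1_tmap_inj (tor _ CY') ipY.
have gq : injective (qg q).
  apply: linear_inj => t t0; apply: (raddf_inj_eq0 ti); apply: (raddf_inj_eq0 gi).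
  by rewrite -qhom_gt t0 raddf0.
have [|ci ciE] := factor_surj (h := coker_pi (qg q') \o hX i) (@coker_pi_surj _ _ _
  (qg q)).
  move=> _ /coker_pi_eq0[t <-]; apply/coker_pi_eq0; exists (tmap N (hY i) t).
  by rewrite -qhom_gt.
have [|cp cpE] := factor_surj (h := coker_pi (qg q'') \o hX p) (@coker_pi_surj _ _
  _ (qg q')).
  move=> _ /coker_pi_eq0[t <-]; apply/coker_pi_eq0; exists (tmap N (hY p) t).
  by rewrite -qhom_gt.
have cses : short_exact ci cp.
  split=> [|z|z].
  - apply: linear_inj => z; have [x <-] := @coker_pi_surj _ _ _ (qg q) z.
    rewrite ciE => /coker_pi_eq0[t' t'E].
    have [|t tE] := (tmap_exact N eY pY t').1.
      by apply: (raddf_inj_eq0 gi'); rewrite -qhom_gt t'E (ses0 _ ipX).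
    apply/coker_pi_eq0; exists t; apply: iX.
    by rewrite qhom_gt tE.
  - have [x <-] := @coker_pi_surj _ _ _ (qg q') z; rewrite cpE; split.
      move=> /coker_pi_eq0[t'' t''E]; have [t' t'E] := tmap_surj N pY t''.
      have [|y yE] := ses_lift (v := x - qg q' t') ipX.
        by rewrite raddfB /= qhom_gt t'E t''E subrr.
      exists (coker_pi _ y); rewrite ciE; apply/coker_pi_eq; exists (- t').
      by rewrite /= yE raddfN /= [RHS]addrC addKr.
    move=> [w]; have [y <-] := @coker_pi_surj _ _ _ (qg q) w.
    rewrite ciE => /coker_pi_eq[t tE].
    have -> : x = hX i y - qg q' t by rewrite tE subKr.
    apply/coker_pi_eq0; exists (- tmap N (hY p) t).
    by rewrite raddfN raddfB /= (ses0 _ ipX) sub0r qhom_gt.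
  - have [x <-] := @coker_pi_surj _ _ _ (qg q'') z; have [y <-] := pX x.
    by exists (coker_pi _ y); rewrite cpE.
split=> //; last exact: her'' ipY CY CY'.
apply: (her' _ _ _ _ _ (bar_ses _ _ cses)) => //; exact: killed_coker.
Qed.

(** Ext^1(M, Y) = 0 for Y = [qY q] lifts maps M -> Y'' to M -> Y', so f~ is epic on [q'']. The
    kernels of f~ form a short exact sequence, on the right because f~ is epic on [q]. *)
Lemma quad_N_mono_cokernel q q' q'' (i : qhom q q') (p : qhom q' q'') :
  ext_MD -> mono_cokernel_closed D' -> mono_cokernel_closed D'' ->
  qses i p -> quad_N q -> quad_N q' -> quad_N q''.
Proof.
move=> ext her' her'' [ipX ipY] [DK DY fs] [DK' DY' fs'].
have [iX eX pX] := ipX; have [iY eY pY] := ipY.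
have adjE q0 q1 (h : qhom q0 q1) x m :
    lhom_fun (adj (qf q1) (hX h x)) m = hY h (lhom_fun (adj (qf q0) x) m).
  by rewrite -[LHS]/(qf q1 (tens m (hX h x))) -qhom_f.
have fs'' : surjective (adj (qf q'')).
  move=> h; have /Ext1P/splits_lift MY := ext _ DY.
  have [k kE] := MY _ _ _ _ (lhom_fun h) ipY.
  have [x xE] := fs' (k : lhom M _); exists (hX p x).
  by apply: lhomP => m; rewrite adjE xE kE.
have [j [jj jE]] := kernel_val (adj (qf q)).
have [j' [jj' jE']] := kernel_val (adj (qf q')).
have [j'' [jj'' jE'']] := kernel_val (adj (qf q'')).
have j0 x : adj (qf q) (j x) = 0 by apply/jE; exists x.
have j0' x : adj (qf q') (j' x) = 0 by apply/jE'; exists x.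
have j0'' x : adj (qf q'') (j'' x) = 0 by apply/jE''; exists x.
have [|ki kiE] := factor_inj (h := hX i \o j) jj'.
  by move=> x; apply/jE'; apply: lhomP => m; rewrite adjE j0 raddf0.
have [|kp kpE] := factor_inj (h := hX p \o j') jj''.
  by move=> x; apply/jE''; apply: lhomP => m; rewrite adjE j0' raddf0.
have kses : short_exact ki kp.
  split=> [|x|x].
  - by move=> x y /(congr1 j'); rewrite !kiE => /iX/jj.
  - split=> [kx|[y <-]]; last first.
      by apply: jj''; rewrite kpE /= kiE /= (ses0 _ ipX) raddf0.
    have [|y yE] := ses_lift (v := j' x) ipX.
      by have := kpE x; rewrite kx raddf0.
    have /jE[z zE] : adj (qf q) y = 0.
      by apply: lhomP => m; apply: iY; rewrite -adjE yE j0' raddf0.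
    by exists z; apply: jj'; rewrite kiE /= zE.
  - have [y yE] := pX (j'' x).
    have [|k kE] := factor_inj (h := lhom_fun (adj (qf q') y)) iY.
      by move=> m; apply: (ses_lift ipY); rewrite -adjE yE j0''.
    (* The map f~(y) takes values in the image of [hY i]. Subtracting [hX i z] moves [y] into Ker f~
       without changing its image under [hX p]. *)
    have [z zE] := fs (k : lhom M _).
    have /jE'[w wE] : adj (qf q') (y - hX i z) = 0.
      apply/raddf_eqP; apply: lhomP => m; by rewrite adjE zE kE.
    exists w; apply: jj''; rewrite kpE /= wE raddfB /= (ses0 _ ipX) subr0.
    exact: yE.
split=> //; last exact: her'' ipY DY DY'.
apply: (her' _ _ _ _ _ (bar_ses _ _ kses)) => //; exact: killed_ker.
Qed.

Lemma ses_quads (U V W : lmodType (morita_ring D)) (i : {linear U -> V})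
    (p : {linear V -> W}) q q' q'' :
  lmod_iso U (quad_mod q) -> lmod_iso V (quad_mod q') -> lmod_iso W (quad_mod q'') ->
  short_exact i p -> exists (i' : qhom q q') (p' : qhom q' q''), qses i' p'.
Proof.
move=> /lmod_iso_inv[u [u' [uK u'K]]] /lmod_iso_inv[v [v' [vK v'K]]].
move=> /lmod_iso_inv[w [w' [wK w'K]]] ip.
have [i' i'E] := quad_unmap (v \o i \o u'); have [p' p'E] := quad_unmap (w \o p \o v').
exists i', p'; apply/qses_quad_map; apply: ses_ext i'E p'E _.
exact: (ses_iso3 u'K uK vK v'K wK w'K ip).
Qed.

Lemma hereditary_M_N : tor_NC -> ext_MD ->
  hereditary_pair C' D' -> hereditary_pair C'' D'' -> hereditary_pair MC ND.
Proof.
move=> tor ext [h1 h2] [h3 h4]; split=> U V W i p ip.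
- move=> /class_M_iso[q' Vq' Mq'] /class_M_iso[q'' Wq'' Mq''].
  have [q Uq] := quad_of U; have [i' [p' ip']] := ses_quads Uq Vq' Wq'' ip.
  by have [? ? ?] := quad_M_epi_kernel tor h1 h3 ip' Mq' Mq''; exists q.
- move=> /class_N_iso[q' Uq' Nq'] /class_N_iso[q'' Vq'' Nq''].
  have [q Wq] := quad_of W; have [i' [p' ip']] := ses_quads Uq' Vq'' Wq ip.
  by have [? ? ?] := quad_N_mono_cokernel ext h2 h4 ip' Nq' Nq''; exists q.
Qed.
End Hereditary.

(** * Approximations *)

Section Complete.
Hypotheses (tor : tor_NC) (ext : ext_MD).
Hypotheses (comp' : complete_pair C' D') (comp'' : complete_pair C'' D'').

Lemma adj_qhom q q1 (h : qhom q q1) x m :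
  lhom_fun (adj (qf q1) (hX h x)) m = hY h (lhom_fun (adj (qf q) x) m).
Proof. by rewrite -[LHS]/(qf q1 (tens m (hX h x))) -qhom_f. Qed.

(** A sequence [qY q -> E -> Y] with [E] in [D''] and [Y] in [C''] is sent through T and pushed out
    along the counit T (qY q) -> q. The counit is the identity on second components, so the pushout
    has second component [E] up to isomorphism. *)
Lemma embed_qY q : exists (q1 : quad) (Y : lmodType B) (i : qhom q q1)
    (p : qhom q1 (Tq D Y)),
  [/\ qses i p, C'' Y & D'' (qY q1)].
Proof.
have [_ [E [Y [i [p [DE CY ip]]]]]] := comp'' (qY q).
have [i' [p' [ip' i'E p'E]]] := Tq_ses D (tor CY) ip.
have [h hE] := @Tq_hom _ _ _ _ D _ q (idfun : {linear qY q -> qY q}).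
have [q1 [i1 [p1 [k [ip1 [_ kY] [_ pY]]]]]] := qpushout h ip'.
exists q1, Y, i1, p1; split=> //.
have [||||ki ks] := @ses_five _ _ _ _ _ _ _ _ _ _ (hY h) (hY k) ip'.2 ip1.2.
- by move=> y y'; rewrite !hE.
- by move=> y; exists y; rewrite hE.
- exact: kY.
- exact: pY.
exact: (cotorsion_isoR cot'') (lmod_iso_bij ki ks) DE.
Qed.

(** The cokernel has zero second component, so [hY i] is bijective and every map M -> [qY q1] comes
    from M -> [qY q], for which a preimage has been adjoined. *)
Lemma embed_adj_surj q : exists (q1 : quad) (L : lmodType A) (kL : killed L)
    (i : qhom q q1) (p : qhom q1 (Zq kL)),
  [/\ qses i p, C' (bar L), surjective (hY i) & surjective (adj (qf q1))].
Proof.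
have [s ss] := free_cover (lhom M (qY q)).
have [q1 [i [p [k [ip kE]]]]] := adjoin_maps psi_inj s.
exists q1, _, _, i, p; split=> //.
- exact: (cotorsion_Lq_coker cot' (@free_projective _ _)).
- by apply: (ses_zerol ip.2); apply: zero_modP.
move=> h; have [||h' h'E] := factor_inj (h := lhom_fun h) (i := hY i).
- by have [] := ip.2.
- move=> m; apply: (ses_zerol ip.2); exact: zero_modP.
have [x xE] := ss (h' : lhom M _); exists (k x); apply: lhomP => m.
by rewrite -[LHS]/(qf q1 (tens m (k x))) kE xE h'E.
Qed.

(** With [bar K] embedded into [E] in [D'], the map Z K -> Z E is pushed out along Z K -> q; the
    kernel of the new f~ is then [E]. *)
Lemma embed_adj_ker q : surjective (adj (qf q)) ->
  exists (q1 : quad) (L : lmodType A) (kL : killed L)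
    (i : qhom q q1) (p : qhom q1 (Zq kL)),
  [/\ qses i p, C' (bar L), surjective (hY i), surjective (adj (qf q1))
    & D' (bar (kernel (adj (qf q1))))].
Proof.
move=> fs; set K := kernel (adj (qf q)); pose kK : killed K := @killed_ker _ _ _ _ _ q.
have [_ [E [C [i [p [DE CC ip]]]]]] := comp' (bar K).
have [u [uE us /(_ kK) ui]] := bar_unit (im_psi D) K.
have ip0 : short_exact (res_map i \o u) (res_map p).
  have [ii e ps] := ip; split=> [|x|//]; first exact: inj_comp ii ui.
  split=> [/e[t <-]|[x' <-]]; last exact: (ses0 _ ip).
  by have [x' <-] := us t; exists x'.
have [i0 [p0 [ipZ i0E p0E]]] := Zq_ses kK (@restr_killed _ _ E) (@restr_killed _ _
  C) ip0.
have [j [j' [_ _ jE]]] := ker_qses fs.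
have [q1 [i1 [p1 [k [ip1 [kX _] [pX _]]]]]] := qpushout j ipZ.
have i1s : surjective (hY i1) by apply: (ses_zerol ip1.2); apply: zero_modP.
have [i1i _ _] := ip1.2; have [i1Xi _ _] := ip1.1.
exists q1, _, _, i1, p1; split=> //.
- exact: (cotorsion_isoL cot') (lmod_iso_sym (bar_restr _)) CC.
- move=> h; have [|h' h'E] := factor_inj (h := lhom_fun h) i1i; first by move=> m;
    apply: i1s.
  have [x xE] := fs (h' : lhom M _); exists (hX i1 x); apply: lhomP => m.
  by rewrite adj_qhom xE h'E.
have [v [vv vE]] := kernel_val (adj (qf q1)).
have k0 x : adj (qf q1) (hX k x) = 0.
  by apply: lhomP => m; rewrite adj_qhom -[RHS](raddf0 (hY k)); congr (hY k _);
     apply: zero_modP.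
have [|w wE] := factor_inj (h := hX k) vv; first by move=> x; apply/vE/k0.
apply: (cotorsion_isoR cot') DE; apply: lmod_iso_sym.
(* The isomorphism is [w]. For surjectivity, an element of the new kernel differs from one of [E] by
   some [y] in [qX q], which lies in the old kernel because [hY i1] is injective. *)
suff ww : lmod_iso (restr E) (kernel (adj (qf q1))).
  have [f [g [fK gK]]] := lmod_iso_inv (bar_iso (im_psi D) (lmod_iso_sym ww)).
  have [f' [g' [f'K g'K]]] := lmod_iso_inv (bar_restr E).
  exists (f' \o f), (g \o g') => x /=; first by rewrite f'K fK.
  by rewrite gK g'K.
apply: (@lmod_iso_bij _ _ _ w).
- apply: linear_inj => x wx; have kx : hX k x = 0 by rewrite -wE wx raddf0.
  have [|y yE] := ses_lift (v := x) ipZ.1; first by rewrite -pX kx raddf0.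
  rewrite -yE; suff -> : y = 0 by rewrite raddf0.
  have : hX i1 (hX j y) = 0 by rewrite -kX yE.
  move=> /(raddf_inj_eq0 i1Xi); rewrite jE => y0; exact: val_inj.
- move=> z; have [_ _ p0s] := ipZ.1; have [x xE] := p0s (hX p1 (v z)).
  have [|y yE] := ses_lift (v := v z - hX k x) ip1.1.
    by rewrite raddfB /= pX xE subrr.
  have y0 : ker_pred (adj (qf q)) y.
    have vz : adj (qf q1) (v z) = 0 by apply/vE; exists z.
    have vk : adj (qf q1) (v z - hX k x) = 0.
      by apply/raddf_eqP; apply: etrans vz (esym (k0 x)).
    by apply/eqP; apply: lhomP => m; apply: i1i; rewrite -adj_qhom yE vk raddf0.
  exists (x + hX i0 (Sub y y0)); apply: vv.
  by rewrite wE raddfD /= kX jE /= yE addrC subrK.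
Qed.

Lemma quad_preenvelope q : exists (q1 : quad) (C : lmodType (morita_ring D))
    (i : {linear quad_mod q -> quad_mod q1}) (p : {linear quad_mod q1 -> C}),
  [/\ short_exact i p, quad_N q1 & forall q', quad_N q' -> splits C (quad_mod q')].
Proof.
have [q1 [Y [i1 [p1 [ip1 CY DY]]]]] := embed_qY q.
have [q2 [L2 [k2 [i2 [p2 [ip2 CL2 s2 f2]]]]]] := embed_adj_surj q1.
have [q3 [L3 [k3 [i3 [p3 [ip3 CL3 s3 f3 D3]]]]]] := embed_adj_ker f2.
have [E1 [r1 [ir1 sE1]]] := ses_filtered ((qses_quad_map _ _).1 ip1)
  ((qses_quad_map _ _).1 ip2).
have [E2 [r2 [ir2 sE2]]] := ses_filtered ir1 ((qses_quad_map _ _).1 ip3).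
exists q3, E2, (quad_map i3 \o (quad_map i2 \o quad_map i1)), r2; split;
  first exact: ir2.
  (* The last two embeddings are bijective on second components, so these stay in [D'']. *)
  split=> //; apply: (cotorsion_isoR cot'') DY.
  apply: (@lmod_iso_bij _ _ _ (hY i3 \o hY i2)).
    by have [ii3 _ _] := ip3.2; have [ii2 _ _] := ip2.2; apply: inj_comp.
  by move=> y; have [y' <-] := s3 y; have [y'' <-] := s2 y'; exists y''.
move=> q' Nq'; apply: sE2; first apply: sE1.
- exact: qsplits_Tq_N Nq' CY.
- exact: qsplits_Zq_N Nq' CL2.
- exact: qsplits_Zq_N Nq' CL3.
Qed.

Lemma preenvelope (V : lmodType (morita_ring D)) :
  exists (E C : lmodType (morita_ring D)) (i : {linear V -> E}) (p : {linear E -> C}),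
    [/\ ND E, MC C & short_exact i p].
Proof.
have [q /lmod_iso_inv[f [g [fK gK]]]] := quad_of V.
have [q1 [C [i [p [ip Nq1 sC]]]]] := quad_preenvelope q.
exists (quad_mod q1), C, (i \o f), p; split; first exact: class_N_quad.
  exact/class_M_lperp.
have [ii e ps] := ip; split=> [|x|//]; first exact: inj_comp ii (can_inj fK).
split=> [/e[y <-]|[y <-]]; last exact: (ses0 _ ip).
by exists (g y); rewrite /= gK.
Qed.

(** With K the kernel of a free cover P -> V and K embedded into [E] with cokernel [C], the pushout
    [F] is an extension of V by [E] and also of [C] by P. Both P and [C] are left orthogonal to
    [ND], so [F] is too. *)
Lemma complete_M_N : complete_pair MC ND.
Proof.
move=> V; split; last exact: preenvelope.
have [p ps] := free_cover V; have [i ip] := kernel_ses ps.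
have [E [C [j [r [NE MCC jr]]]]] := preenvelope (kernel p).
have [F [i' [p' [j' [r' [ip' jr']]]]]] := double_pushout_ses ip jr.
exists E, F, i', p'; split=> //.
apply/class_M_lperp => // q Nq; apply: (splits_extl jr').
  exact: projective_splits (@free_projective _ _).
by move: q Nq; apply/class_M_lperp.
Qed.
End Complete.
End MoritaCotorsion.

Theorem corollary4p7 (A B : pzRingType) (N : bimodType A B) (M : bimodType B A)
    (D : morita_datum N M)
    (C' D' : mod_class (A_mod_psi D)) (C'' D'' : mod_class B) :
  cotorsion_pair C' D' ->
  cotorsion_pair C'' D'' ->
  injective (psi D) ->
  let MC := class_M C' C'' in
  let ND := class_N D' D'' in
  let Tor_N_C'' := forall Y : lmodType B, C'' Y -> Tor1_eq0 N Y in
  let Ext_M_D'' := forall Y : lmodType B, D'' Y -> Ext1_eq0 M Y in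
  [/\ Tor_N_C'' -> cotorsion_pair (lperp ND) ND,
      Ext_M_D'' -> cotorsion_pair MC (rperp MC) &
      Tor_N_C'' -> Ext_M_D'' ->
        cotorsion_pair MC ND /\
        (complete_pair C' D' /\ hereditary_pair C' D' ->
         complete_pair C'' D'' /\ hereditary_pair C'' D'' ->
         complete_pair MC ND /\ hereditary_pair MC ND)].
Proof.
move=> cot' cot'' psi_inj MC ND Tor_N_C'' Ext_M_D''; split.
- exact: (cotorsion_N cot' cot'' psi_inj).
- exact: (cotorsion_M cot' cot'' psi_inj).
move=> tor ext; split; first exact: (cotorsion_M_N cot' cot'' psi_inj).
move=> [comp' her'] [comp'' her'']; split;
  first exact: (complete_M_N cot' cot'' psi_inj).
exact: hereditary_M_N tor ext her' her''.
Qed.
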